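(* Let $\rho_1,\sigma_1\in H^2(-1,0)$ and $\rho_2,\sigma_2\in H^2(0,1)$ be uniformly positive, $q_1\in L^1(-1,0)$, $q_2\in L^1(0,1)$ nonnegative, $M>0$, and let $0<\lambda_1<\lambda_2<\cdots$ be the eigenvalues of the problem $$\begin{cases}-(\sigma_1u')'+q_1u=\lambda\rho_1u, & x\in(-1,0),\\ -(\sigma_2v')'+q_2v=\lambda\rho_2v, & x\in(0,1),\\ u(-1)=v(1)=0,\ u(0)=v(0),\\ \sigma_1(0)u'(0)-\sigma_2(0)v'(0)=\lambda Mu(0).\end{cases}$$ Then there exists a subsequence $(\lambda_{\varphi(n)})_{n\ge1}$ such that $$\sqrt{\lambda_{\varphi(n)+1}}-\sqrt{\lambda_{\varphi(n)}}=\mathcal O\Big(\frac1n\Big),$$ and there exists $\delta>0$ such that $\sqrt{\lambda_{n+2}}-\sqrt{\lambda_n}>2\delta$ for all $n\ge1$. *)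

(* Defs.v *)
From HB Require Import structures.
From mathcomp Require Import all_boot all_order all_algebra.
From mathcomp Require Import all_classical all_reals all_analysis.
Set Implicit Arguments. Unset Strict Implicit. Unset Printing Implicit Defensive.
Import Order.TTheory GRing.Theory Num.Theory.
Local Open Scope classical_set_scope.
Local Open Scope ring_scope.

Section Defs.
Variable R : realType.
Local Notation mu := (@lebesgue_measure R).

Definition L1on (a b : R) (f : R -> R) : Prop :=
  mu.-integrable `[a, b] (EFin \o f).

Definition L2on (a b : R) (f : R -> R) : Prop :=
  measurable_fun `[a, b] f /\ mu.-integrable `[a, b] (EFin \o (fun x => f x ^+ 2)).

(* f in H^2(a,b) (continuous representative): f and its first derivative f1
   are absolutely continuous (indefinite integrals of integrable functions)
   and the second derivative f2 lies in L^2(a,b). *)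
Definition H2on (a b : R) (f : R -> R) : Prop :=
  exists f1 f2 : R -> R,
    [/\ L2on a b f2, L1on a b f1,
        (forall x, a <= x <= b -> f1 x = f1 a + \int[mu]_(t in `[a, x]) f2 t) &
        (forall x, a <= x <= b -> f x = f a + \int[mu]_(t in `[a, x]) f1 t)].

Definition unif_pos (a b : R) (f : R -> R) : Prop :=
  exists c : R, 0 < c /\ forall x, a <= x <= b -> c <= f x.

(* (u, w) solves  -(sigma u')' + q u = lam rho u  on (a,b) in the
   Caratheodory sense, where w = sigma u' is the flux:
   u' = w / sigma  and  w' = (q - lam rho) u  (integrated form). *)
Definition SL_sol (a b : R) (sigma rho q : R -> R) (lam : R)
    (u w : R -> R) : Prop :=
  [/\ L1on a b (fun x => w x / sigma x),
      L1on a b (fun x => (q x - lam * rho x) * u x),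
      (forall x, a <= x <= b ->
         u x = u a + \int[mu]_(t in `[a, x]) (w t / sigma t)) &
      (forall x, a <= x <= b ->
         w x = w a + \int[mu]_(t in `[a, x]) ((q t - lam * rho t) * u t))].

(* lam is an eigenvalue of the transmission problem with eigenparameter
   dependent interface condition; w1 = sigma1 u', w2 = sigma2 v'. *)
Definition is_eigenvalue (rho1 sigma1 q1 rho2 sigma2 q2 : R -> R) (M : R)
    (lam : R) : Prop :=
  exists u w1 v w2 : R -> R,
    [/\ SL_sol (-1) 0 sigma1 rho1 q1 lam u w1,
        SL_sol 0 1 sigma2 rho2 q2 lam v w2,
        [/\ u (-1) = 0, v 1 = 0 & u 0 = v 0],
        w1 0 - w2 0 = lam * M * u 0 &
        ((exists x, (-1 <= x <= 0) /\ u x != 0) \/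
         (exists x, (0 <= x <= 1) /\ v x != 0))].

End Defs.

(* Main.v *)
(* Write k for the square root of the eigenvalue. With r = (rho sigma)^(1/4) and
   p = sqrt (rho / sigma), the vector (k r u, sigma u' / r) of a solution rotates
   at speed k p up to an error O(1/k), by Liouville-Green.

   The bound C / n is indexed by the position in the subsequence, so the first
   claim only asks for arbitrarily small gaps arbitrarily far. Let g1 and g2 be
   the integrals of p over the two sides. Shooting from -1 to 1 gives a function of
   k, vanishing only at eigenvalues, of the form
     A s1 c2 + B c1 s2 - k M s1 s2,  s_i ~ sin (k g_i),  c_i ~ cos (k g_i).
   Where k g1 and k g2 are simultaneously close to multiples of 2 pi, both s_i
   change sign while the c_i stay positive. The last term makes the function
   negative at both ends of a short window, and it becomes nonnegative in between
   near the last zero of s1 s2, so it vanishes twice.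

   For the second claim, eigenfunctions are orthogonal for the form
   int rho1 u u' + int rho2 v v' + M u(0) u'(0). An eigenfunction is close to
   (A sin, B sin) on the two sides, and the interface condition makes the last
   term negligible. Three eigenvalues in a short window far away would give three
   almost orthogonal vectors (A, B) of a plane. *)
Require Import Defs.
From HB Require Import structures.
From mathcomp Require Import all_boot all_order all_algebra.
From mathcomp Require Import all_classical all_reals all_analysis.
From mathcomp Require Import measurable_realfun.
From mathcomp Require Import ring lra.
Set Implicit Arguments. Unset Strict Implicit. Unset Printing Implicit Defensive.
Import Order.TTheory GRing.Theory Num.Theory.
Import numFieldNormedType.Exports.
Local Open Scope ring_scope.

(** With [q] merely integrable, a solution and its flux are absolutely continuous and [SL_sol]
    speaks of integrals only. The calculus rules are therefore proved for pairs (function, density),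
    by estimating increments instead of differentiating almost everywhere.

    In the system for (k r u, sigma u' / r) the logarithmic derivative of [r] enters without a
    factor 1/k, so a Gronwall bound alone leaves an error O(1). The O(1/k) comes from an integration
    by parts against the rotation, and H^2 makes the coefficient to be differentiated absolutely
    continuous.

    The orthogonality relation is multiplied by k k', which makes the two integrals of the order of
    the amplitudes. The Dirichlet condition at an outer end fixes the phase there, so each side
    keeps a single amplitude: this is the plane. The fluxes at 0 are bounded by the amplitudes,
    hence so is k^2 M u(0), and k k' M u(0) u'(0) is of order 1/(k k'). *)

Local Notation "'I[' x , y ] f" := (\int[lebesgue_measure]_(t in `[x, y]%classic) f t)
  (at level 36, x at level 99, y at level 99, f at level 36).

(** * Integrals over segments *)

Section Integrals.
Variable R : realType.
Implicit Types (a b x y : R) (f g : R -> R).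

Local Notation measurable_on a b f := (@measurable_fun _ _
  (measurableTypeR R) (measurableTypeR R) `[a, b]%classic f).

Lemma L1on_sub a b x y f : L1on a b f -> a <= x -> y <= b -> L1on x y f.
Proof.
move=> fi ax yb; apply: integrableS fi => //.
by apply: subset_itv; rewrite bnd_simp.
Qed.

Lemma eq_L1on a b f g : (forall x, a <= x <= b -> f x = g x) ->
  L1on a b f -> L1on a b g.
Proof.
move=> fg; apply: eq_integrable => // x; rewrite inE /= in_itv /= => xab.
by rewrite /= fg.
Qed.

Lemma L1onD a b f g : L1on a b f -> L1on a b g ->
  L1on a b (fun x => f x + g x).
Proof. by move=> fi gi; exact: (integrableD _ fi gi). Qed.

Lemma L1onZ a b c f : L1on a b f -> L1on a b (fun x => c * f x).
Proof. by move=> fi; apply: (integrableZl _ c fi). Qed.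

Lemma L1onN a b f : L1on a b f -> L1on a b (fun x => - f x).
Proof. by move=> /(L1onZ (-1)); apply: eq_L1on => x _; rewrite mulN1r. Qed.

Lemma L1onB a b f g : L1on a b f -> L1on a b g ->
  L1on a b (fun x => f x - g x).
Proof. by move=> fi gi; apply: L1onD => //; exact: L1onN. Qed.

Lemma L1on_norm a b f : L1on a b f -> L1on a b (fun x => `|f x|).
Proof. by move=> /integrable_norm. Qed.

Lemma L1on_cst a b c : L1on a b (fun=> c).
Proof.
apply: measurable_bounded_integrable => //.
  by rewrite /= lebesgue_measure_itv/=; case: ifP => // _; rewrite -EFinD ltry.
by exists `|c|; split=> // M cM x _ /=; exact: ltW.
Qed.

Lemma L1onM a b f g C : measurable_on a b f ->
  (forall x, a <= x <= b -> `|f x| <= C) -> L1on a b g ->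
  L1on a b (fun x => f x * g x).
Proof.
move=> mf fC gi.
have bf : [bounded f x | x in `[a, b]%classic].
  exists C; split; first exact: num_real.
  move=> M CM x /=; rewrite in_itv /= => /fC fxC.
  exact: le_trans fxC (ltW CM).
exact: (@integrableMr _ (measurableTypeR R) R _ _ _ f _ mf bf gi).
Qed.

Lemma I_itv1 x f : I[x, x] f = 0.
Proof. by rewrite set_itv1 Rintegral_set1. Qed.

Lemma eq_I x y f g : (forall t, x <= t <= y -> f t = g t) ->
  I[x, y] f = I[x, y] g.
Proof. by move=> fg; apply: eq_Rintegral => t; rewrite inE /= in_itv /=; exact: fg. Qed.

Lemma I_D x y f g : L1on x y f -> L1on x y g ->
  I[x, y] (fun t => f t + g t) = I[x, y] f + I[x, y] g.
Proof. by move=> fi gi; rewrite RintegralD. Qed.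

Lemma I_B x y f g : L1on x y f -> L1on x y g ->
  I[x, y] (fun t => f t - g t) = I[x, y] f - I[x, y] g.
Proof. by move=> fi gi; rewrite RintegralB. Qed.

Lemma I_Z x y c f : L1on x y f -> I[x, y] (fun t => c * f t) = c * I[x, y] f.
Proof. by move=> fi; rewrite RintegralZl. Qed.

Lemma le_I x y f g : L1on x y f -> L1on x y g ->
  (forall t, x <= t <= y -> f t <= g t) -> I[x, y] f <= I[x, y] g.
Proof.
by move=> fi gi fg; apply: le_Rintegral => // t; rewrite /= in_itv /=; exact: fg.
Qed.

Lemma I_ge0 x y f : (forall t, x <= t <= y -> 0 <= f t) -> 0 <= I[x, y] f.
Proof. by move=> f0; apply: Rintegral_ge0 => t; rewrite /= in_itv /=; exact: f0. Qed.

Lemma norm_I_le x y f : L1on x y f -> `|I[x, y] f| <= I[x, y] (fun t => `|f t|).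
Proof. by move=> fi; apply: le_normr_Rintegral. Qed.

Lemma norm_I_le_dom x y f g : L1on x y f -> L1on x y g ->
  (forall t, x <= t <= y -> `|f t| <= g t) -> `|I[x, y] f| <= I[x, y] g.
Proof.
move=> fi gi fg; apply: le_trans (norm_I_le fi) _.
by apply: le_I => //; exact: L1on_norm.
Qed.

Lemma I_cst x y c : x <= y -> I[x, y] (fun=> c) = c * (y - x).
Proof.
move=> xy; rewrite Rintegral_cst //= lebesgue_measure_itv /= lte_fin.
by have [//|yx] := ltP x y; rewrite (@le_anti _ _ x y) ?xy// subrr.
Qed.

Lemma I_chasles a x y f : L1on a y f -> a <= x -> x <= y ->
  I[a, y] f = I[a, x] f + I[x, y] f.
Proof.
move=> fi ax xy.
have := @Rintegral_itvB R f (BLeft a) (BRight y) x fi.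
rewrite !bnd_simp => /(_ ax xy) /eqP; rewrite subr_eq addrC => /eqP ->.
congr (_ + _); apply: Rintegral_itv_obnd_cbnd.
apply: integrableS fi => //.
by apply: subset_itv; rewrite bnd_simp.
Qed.

Lemma I_split a b x y f : L1on a b f -> a <= x -> x <= y -> y <= b ->
  I[x, y] f = I[a, y] f - I[a, x] f.
Proof.
move=> fi ax xy yb; rewrite (@I_chasles a x y) //; last exact: L1on_sub fi _ _.
by rewrite addrAC subrr add0r.
Qed.

Lemma continuous_I a b f : a <= b -> L1on a b f ->
  {within `[a, b], continuous (fun x => I[a, x] f)}%classic.
Proof. by move=> ab fi; apply: parameterized_integral_continuous. Qed.

Lemma within_continuous_bounded a b f : {within `[a, b], continuous f}%classic ->
  exists2 C, 0 < C & forall x, a <= x <= b -> `|f x| <= C.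
Proof.
move=> cf; have /compact_bounded[M [_ Mf]] :=
    continuous_compact cf (@segment_compact R a b).
exists (`|M| + 1); first by rewrite ltr_pwDr.
move=> x xab; apply: (Mf (`|M| + 1)).
  by rewrite ltr_pwDr // ler_norm.
by exists x => //=; rewrite in_itv.
Qed.

Lemma within_continuous_measurable a b f : {within `[a, b], continuous f}%classic ->
  measurable_on a b f.
Proof. by move=> cf; apply: subspace_continuous_measurable_fun. Qed.

Lemma L1onMC a b f g : {within `[a, b], continuous f}%classic -> L1on a b g ->
  L1on a b (fun x => f x * g x).
Proof.
move=> cf gi; have [C _ fC] := within_continuous_bounded cf.
by apply: (@L1onM _ _ _ _ C) => //; exact: within_continuous_measurable.
Qed.

Lemma L1on_continuous a b f : {within `[a, b], continuous f}%classic -> L1on a b f.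
Proof.
move=> cf; apply: eq_L1on (L1onMC cf (L1on_cst a b 1)) => x _.
by rewrite mulr1.
Qed.

Lemma L2on_L1on a b f : L2on a b f -> L1on a b f.
Proof.
move=> [mf f2]; have fd := L1onD (L1on_cst a b 1) f2.
apply: le_integrable fd => //=; first exact/measurable_EFinP.
move=> x _; rewrite lee_fin [leRHS]ger0_norm ?addr_ge0 ?sqr_ge0//.
have := sqr_ge0 (`|f x| - 1); rewrite -(real_normK (num_real (f x))); nra.
Qed.

(* Partition [x, y] at the points where N takes equally spaced values: the
   total increment of D is at most n * C * ((N y - N x) / n)^2. *)
Lemma quadratic_increments_eq x y C (N D : R -> R) : x <= y ->
  {within `[x, y], continuous N}%classic ->
  (forall s t, x <= s -> s <= t -> t <= y -> N s <= N t) ->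
  (forall s t, x <= s -> s <= t -> t <= y ->
    `|D t - D s| <= C * (N t - N s) ^+ 2) ->
  D x = D y.
Proof.
move=> xy cN Nmono DN.
pose L := N y - N x.
have step (n : nat) : `|D y - D x| <= C * L ^+ 2 / n.+1%:R.
  have n0 : (0 : R) < n.+1%:R by [].
  suff H : forall i, (i <= n.+1)%N -> exists z, [/\ x <= z, z <= y,
      N z = N x + i%:R * (L / n.+1%:R) &
      `|D z - D x| <= i%:R * (C * (L / n.+1%:R) ^+ 2)].
    have [z [xz zy Nz Dz]] := H _ (leqnn _).
    have Dyz : `|D y - D z| <= 0.
      rewrite (le_trans (DN z y xz zy (lexx _))) // Nz.
      have -> : N y - (N x + n.+1%:R * (L / n.+1%:R)) = 0.
        by rewrite mulrC divfK ?gt_eqF // /L; ring.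
      by rewrite expr0n /= mulr0.
    have -> : D y - D x = (D y - D z) + (D z - D x) by ring.
    apply: le_trans (ler_normD _ _) _.
    have -> : C * L ^+ 2 / n.+1%:R = 0 + n.+1%:R * (C * (L / n.+1%:R) ^+ 2).
      by field; rewrite nat1r gt_eqF.
    exact: lerD.
  elim=> [_|i IH iln].
    by exists x; rewrite subrr normr0 !mul0r addr0.
  have [z [xz zy Nz Dz]] := IH (ltnW iln).
  have L0 : 0 <= L by rewrite subr_ge0 Nmono.
  have cN' : {within `[z, y], continuous N}%classic.
    by apply: continuous_subspaceW cN; apply: subset_itv; rewrite bnd_simp.
  have [|t] := @IVT R N z y (N x + i.+1%:R * (L / n.+1%:R)) zy cN'.
    have -> : Num.min (N z) (N y) = N z by apply/min_idPl; rewrite Nmono.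
    have -> : Num.max (N z) (N y) = N y by apply/max_idPr; rewrite Nmono.
    rewrite Nz lerD2l ler_wpM2r ?divr_ge0 ?ler_nat // /=.
    have -> : N y = N x + n.+1%:R * (L / n.+1%:R).
      by rewrite [n.+1%:R * _]mulrC divfK ?gt_eqF // /L; ring.
    by rewrite lerD2l ler_wpM2r ?divr_ge0 // ler_nat.
  rewrite in_itv /= => /andP[zt ty] Nt.
  exists t; split => //; first exact: le_trans zt.
  have -> : D t - D x = (D t - D z) + (D z - D x) by ring.
  apply: le_trans (ler_normD _ _) _.
  have -> : i.+1%:R * (C * (L / n.+1%:R) ^+ 2) =
      C * (L / n.+1%:R) ^+ 2 + i%:R * (C * (L / n.+1%:R) ^+ 2).
    by rewrite -natr1 mulrDl mul1r addrC.
  apply: lerD => //; apply: le_trans (DN z t xz zt ty) _.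
  have -> : N t - N z = L / n.+1%:R by rewrite Nt Nz -natr1; ring.
  by [].
apply/eqP; rewrite eq_sym -subr_eq0 -normr_le0 leNgt; apply/negP => D0.
set e := `|D y - D x| in step D0.
have [n nP] : exists n : nat, C * L ^+ 2 / e < n%:R.
  have := archi_boundP (normr_ge0 (C * L ^+ 2 / e)).
  by move=> H; eexists; apply: le_lt_trans (ler_norm _) H.
have := step n; rewrite ler_pdivlMr // leNgt => /negP; apply.
rewrite ltr_pdivrMr // in nP; apply: lt_le_trans nP _.
by rewrite mulrC ler_pM2l // ler_nat.
Qed.

End Integrals.

(** * Absolutely continuous functions *)

Section AbsolutelyContinuous.
Variable R : realType.
Implicit Types (a b x y : R) (f g : R -> R).

(* Absolute continuity in the integrated form used by SL_sol: f' is a density of f. *)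
Definition ac_on a b f f' :=
  L1on a b f' /\ forall x, a <= x <= b -> f x = f a + I[a, x] f'.

Lemma ac_onW a b x y f f' : ac_on a b f f' -> a <= x -> x <= y -> y <= b ->
  f y = f x + I[x, y] f'.
Proof.
move=> [fi fE] ax xy yb; have xb := le_trans xy yb; have ay := le_trans ax xy.
rewrite (fE y) ?ay// (fE x) ?ax// -addrA; congr (_ + _).
by apply: I_chasles => //; exact: L1on_sub fi _ _.
Qed.

Lemma ac_on_sub a b x y f f' : ac_on a b f f' -> a <= x -> y <= b ->
  ac_on x y f f'.
Proof.
move=> Hf ax yb; split; first by apply: L1on_sub ax yb; case: Hf.
by move=> z /andP[xz zy]; apply: (ac_onW Hf) => //; exact: le_trans yb.
Qed.

Lemma eq_ac_on a b f g f' g' : (forall x, a <= x <= b -> f x = g x) ->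
  (forall x, a <= x <= b -> f' x = g' x) -> ac_on a b f f' -> ac_on a b g g'.
Proof.
move=> fg fg' [fi fE]; split; first exact: eq_L1on fi.
move=> x /andP[ax xb]; rewrite -!fg ?ax ?xb ?lexx ?(le_trans ax xb)//.
rewrite fE ?ax ?xb//; congr (_ + _); apply: eq_I => t /andP[at_ tx].
by apply: fg'; rewrite at_ (le_trans tx xb).
Qed.

Lemma ac_on_cst a b c : ac_on a b (fun=> c) (fun=> 0).
Proof.
split; first exact: L1on_cst.
by move=> x /andP[ax _]; rewrite I_cst// mul0r addr0.
Qed.

Lemma ac_onD a b f g f' g' : ac_on a b f f' -> ac_on a b g g' ->
  ac_on a b (fun x => f x + g x) (fun x => f' x + g' x).
Proof.
move=> [fi fE] [gi gE]; split; first exact: L1onD.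
move=> x /andP[ax xb];
    rewrite (I_D (L1on_sub fi (lexx a) xb) (L1on_sub gi (lexx a) xb)).
by rewrite fE ?ax// gE ?ax//; ring.
Qed.

Lemma ac_onZ a b c f f' : ac_on a b f f' ->
  ac_on a b (fun x => c * f x) (fun x => c * f' x).
Proof.
move=> [fi fE]; split; first exact: L1onZ.
move=> x /andP[ax xb]; rewrite (I_Z _ (L1on_sub fi (lexx a) xb)).
by rewrite fE ?ax//; ring.
Qed.

Lemma ac_onB a b f g f' g' : ac_on a b f f' -> ac_on a b g g' ->
  ac_on a b (fun x => f x - g x) (fun x => f' x - g' x).
Proof.
move=> Hf Hg; apply: eq_ac_on (ac_onD Hf (ac_onZ (-1) Hg)) => x _.
  by rewrite mulN1r.
by rewrite mulN1r.
Qed.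

Lemma ac_on_int a b f' c : L1on a b f' ->
  ac_on a b (fun x => c + I[a, x] f') f'.
Proof. by move=> fi; split=> // x _; rewrite I_itv1 addr0. Qed.

(** Serves twice: an absolutely continuous function inherits continuity from the integral of its
    density, and [F' (f x)] in the chain rule inherits it from [f]. *)
Lemma within_continuous_lip a b C f g : {within `[a, b], continuous f}%classic ->
  (forall s t, a <= s <= b -> a <= t <= b -> `|g s - g t| <= C * `|f s - f t|) ->
  {within `[a, b], continuous g}%classic.
Proof.
move=> /subspace_continuousP cf gf; apply/subspace_continuousP => x xab.
have /cvgrPdist_lt fx := cf x xab; apply/cvgrPdist_lt => e e0.
have D0 : 0 < e / (`|C| + 1) by rewrite divr_gt0// ltr_pwDr.
have /= := fx _ D0.
rewrite !near_withinE; apply: filterS => y yf yab.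
have := yf yab; rewrite ltr_pdivlMr ?ltr_pwDr// => fe.
apply: le_lt_trans fe; move: xab yab; rewrite /= !in_itv /= => xab yab.
apply: le_trans (gf _ _ xab yab) _; rewrite mulrC ler_wpM2l//.
by apply: le_trans (ler_norm _) _; rewrite lerDl.
Qed.

Lemma ac_on_continuous a b f f' : a <= b -> ac_on a b f f' ->
  {within `[a, b], continuous f}%classic.
Proof.
move=> ab [fi fE]; apply: (within_continuous_lip (C := 1) (continuous_I ab fi)).
move=> s t sab tab; rewrite (fE s sab) (fE t tab) mul1r.
by rewrite opprD addrACA subrr add0r.
Qed.

Lemma variation_mono a b f' s t : L1on a b f' -> a <= s -> s <= t -> t <= b ->
  I[a, s] (fun x => `|f' x|) <= I[a, t] (fun x => `|f' x|).
Proof.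
move=> fi a_s st tb; rewrite -subr_ge0 -(I_split (L1on_norm fi) a_s st tb).
exact: I_ge0.
Qed.

Lemma ac_on_incr_le a b f f' s t u : ac_on a b f f' ->
  a <= s -> s <= u -> u <= t -> t <= b ->
  `|f t - f u| <= I[a, t] (fun x => `|f' x|) - I[a, s] (fun x => `|f' x|) /\
  `|f u - f s| <= I[a, t] (fun x => `|f' x|) - I[a, s] (fun x => `|f' x|).
Proof.
move=> Hf a_s su ut tb; have fi := Hf.1.
have ub := le_trans ut tb; have au := le_trans a_s su.
have -> : f t - f u = I[u, t] f' by rewrite (ac_onW Hf au ut tb) addrAC subrr add0r.
have -> : f u - f s = I[s, u] f' by rewrite (ac_onW Hf a_s su ub) addrAC subrr add0r.
have fin := L1on_norm fi.
have Hst : I[a, s] (fun x => `|f' x|) <= I[a, u] (fun x => `|f' x|)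
    by apply: variation_mono ub.
have Hut : I[a, u] (fun x => `|f' x|) <= I[a, t] (fun x => `|f' x|)
    by apply: variation_mono tb.
split.
  apply: le_trans (norm_I_le _) _; first exact: L1on_sub fi _ _.
  by rewrite (I_split fin)//; lra.
apply: le_trans (norm_I_le _) _; first exact: L1on_sub fi _ _.
by rewrite (I_split fin)//; lra.
Qed.

(** Let [D] be the product minus the integral of the candidate density. Its increments are at most
    the squared increments of the joint variation [N], so [quadratic_increments_eq] makes [D]
    constant. *)
Lemma ac_onM a b f g f' g' : ac_on a b f f' -> ac_on a b g g' ->
  ac_on a b (fun x => f x * g x) (fun x => f' x * g x + f x * g' x).
Proof.
move=> Hf Hg; have [fi _] := Hf; have [gi _] := Hg.
have [ab|ba] := leP a b; last first.
  split.
    rewrite /L1on set_itv_ge ?bnd_simp -?ltNge//; exact: integrable_set0.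
  by move=> x /andP[ax /(le_trans ax)]; rewrite leNgt ba.
have cf := ac_on_continuous ab Hf; have cg := ac_on_continuous ab Hg.
have fg'i := L1onMC cf gi; have gf'i := L1onMC cg fi.
have hi : L1on a b (fun x => f' x * g x + f x * g' x).
  by apply: eq_L1on (L1onD gf'i fg'i) => x _; rewrite mulrC.
split => // x /andP[ax xb].
pose N y := I[a, y] (fun t => `|f' t| + `|g' t|).
pose D y := f y * g y - I[a, y] (fun t => f' t * g t + f t * g' t).
have Ni : L1on a b (fun t => `|f' t| + `|g' t|) by apply: L1onD; exact: L1on_norm.
have NE y : a <= y -> y <= b -> N y = I[a, y] (fun x => `|f' x|) + I[a, y]
    (fun x => `|g' x|).
  move=> ay yb.
  by rewrite /N (I_D (L1on_sub (L1on_norm fi) (lexx a) yb) (L1on_sub (L1on_norm gi)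
      (lexx a) yb)).
suff : D a = D x.
  by rewrite /D I_itv1 subr0 => ->; rewrite subrK.
apply: (@quadratic_increments_eq R a x 1 N D ax).
- by apply: continuous_I => //; exact: L1on_sub Ni _ xb.
- move=> s t a_s st tx; rewrite -subr_ge0 /N -(I_split Ni a_s st (le_trans tx xb)).
  by apply: I_ge0 => u _; rewrite addr_ge0.
move=> s t a_s st tx; have tb := le_trans tx xb; have sb := le_trans st tb.
have ata := le_trans a_s st.
have sub h : L1on a b h -> L1on s t h by move=> hi'; exact: L1on_sub hi' _ _.
set n := N t - N s.
(* With [g] frozen at [t] and [f] at [s], only increments over parts of [s, t] remain. Each is at
   most [n], and integrating the densities gives the second factor [n]. *)
have DE : D t - D s = I[s, t] (fun u => (g t - g u) * f' u + (f s - f u) * g' u).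
  have -> : D t - D s = (f t - f s) * g t + f s * (g t - g s) -
     I[s, t] (fun u => f' u * g u + f u * g' u).
    by rewrite (I_split hi a_s st tb) /D; ring.
  have -> : f t - f s = I[s, t] f' by rewrite (ac_onW Hf a_s st tb); ring.
  have -> : g t - g s = I[s, t] g' by rewrite (ac_onW Hg a_s st tb); ring.
  rewrite mulrC -(I_Z _ (sub _ fi)) -(I_Z _ (sub _ gi)).
  rewrite -I_D; [|exact: sub (L1onZ _ fi)|exact: sub (L1onZ _ gi)].
  rewrite -I_B; [|exact: sub (L1onD (L1onZ _ fi) (L1onZ _ gi))|exact: sub].
  by apply: eq_I => u _; ring.
have nE : n = I[s, t] (fun u => `|f' u| + `|g' u|).
  by rewrite /n /N (I_split Ni a_s st tb).
rewrite DE mul1r expr2 {2}nE -I_Z; last exact: sub.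
apply: norm_I_le_dom.
- have H1 : L1on s t (fun u => g t * f' u - g u * f' u).
    by apply: sub; apply: L1onB => //; exact: L1onZ.
  have H2 : L1on s t (fun u => f s * g' u - f u * g' u).
    by apply: sub; apply: L1onB => //; exact: L1onZ.
  by apply: eq_L1on (L1onD H1 H2) => u _; ring.
- by apply: sub; exact: L1onZ.
move=> u /andP[su ut].
apply: le_trans (ler_normD _ _) _; rewrite !normrM mulrDr.
have [Hg1 _] := ac_on_incr_le Hg a_s su ut tb.
have [_ Hf1] := ac_on_incr_le Hf a_s su ut tb.
have vf := variation_mono fi a_s st tb.
have vg := variation_mono gi a_s st tb.
have nE2 : n = (I[a, t] (fun x => `|f' x|) - I[a, s] (fun x => `|f' x|)) +
  (I[a, t] (fun x => `|g' x|) - I[a, s] (fun x => `|g' x|)).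
  by rewrite /n !NE//; ring.
apply: lerD; apply: ler_wpM2r => //; first lra.
by rewrite distrC; lra.
Qed.

(** The Taylor bound is required only at values of [f], which admits the inverse and the square root
    away from 0 and the exponential below a bound. The argument is that of [ac_onM]: the Taylor
    remainder and the variation of [F'] are both quadratic in the increment of [N]. *)
Lemma ac_on_comp a b f f' (F F' : R -> R) C : 0 <= C -> ac_on a b f f' ->
  (forall s t, a <= s <= b -> a <= t <= b ->
    `|F (f t) - F (f s) - F' (f s) * (f t - f s)| <= C * (f t - f s) ^+ 2) ->
  ac_on a b (fun x => F (f x)) (fun x => F' (f x) * f' x).
Proof.
move=> C0 Hf FF; have [fi _] := Hf.
have [ab|ba] := leP a b; last first.
  split.
    rewrite /L1on set_itv_ge ?bnd_simp -?ltNge//; exact: integrable_set0.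
  by move=> x /andP[ax /(le_trans ax)]; rewrite leNgt ba.
have cf := ac_on_continuous ab Hf.
(* The Taylor bounds at [s] and at [t] are added: the values of [F] cancel and
   [(F' (f s) - F' (f t)) * (f s - f t)] is left. *)
have F'lip s t : a <= s <= b -> a <= t <= b ->
    `|F' (f s) - F' (f t)| <= 2 * C * `|f s - f t|.
  move=> sab tab; have H1 := FF _ _ sab tab; have H2 := FF _ _ tab sab.
  have [->|fst] := eqVneq (f s) (f t); first by rewrite !subrr !normr0 mulr0.
  rewrite -(ler_pM2r (_ : 0 < `|f s - f t|)) ?normr_gt0 ?subr_eq0//.
  rewrite -normrM.
  have -> : (F' (f s) - F' (f t)) * (f s - f t) =
     (F (f t) - F (f s) - F' (f s) * (f t - f s)) +
     (F (f s) - F (f t) - F' (f t) * (f s - f t)) by ring.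
  apply: le_trans (ler_normD _ _) _.
  have -> : 2 * C * `|f s - f t| * `|f s - f t| =
     C * (f t - f s) ^+ 2 + C * (f s - f t) ^+ 2.
    by rewrite -mulrA -expr2 real_normK ?num_real//; ring.
  exact: lerD.
have cF' := within_continuous_lip cf F'lip.
have hi : L1on a b (fun x => F' (f x) * f' x) := L1onMC cF' fi.
split => // x /andP[ax xb].
pose N y := I[a, y] (fun t => `|f' t|).
pose D y := F (f y) - I[a, y] (fun t => F' (f t) * f' t).
have Ni : L1on a b (fun t => `|f' t|) by exact: L1on_norm.
suff : D a = D x.
  by rewrite /D I_itv1 subr0 => ->; rewrite subrK.
apply: (@quadratic_increments_eq R a x (C + 2 * C) N D ax).
- by apply: continuous_I => //; exact: L1on_sub Ni _ xb.
- by move=> s t a_s st tx; apply: (variation_mono fi) => //; exact: le_trans xb.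
move=> s t a_s st tx; have tb := le_trans tx xb; have sb := le_trans st tb.
have ata := le_trans a_s st.
have sub h : L1on a b h -> L1on s t h by move=> hi'; exact: L1on_sub hi' _ _.
set n := N t - N s.
have nE : n = I[s, t] (fun u => `|f' u|) by rewrite /n /N (I_split Ni a_s st tb).
have n0 : 0 <= n by rewrite subr_ge0; exact: variation_mono fi _ _ _.
have DE : D t - D s = (F (f t) - F (f s) - F' (f s) * (f t - f s)) +
     I[s, t] (fun u => (F' (f s) - F' (f u)) * f' u).
  have -> : I[s, t] (fun u => (F' (f s) - F' (f u)) * f' u) =
     F' (f s) * (f t - f s) - I[s, t] (fun u => F' (f u) * f' u).
    have -> : f t - f s = I[s, t] f' by rewrite (ac_onW Hf a_s st tb); ring.
    rewrite -I_Z; last exact: sub.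
    rewrite -I_B; [|exact: sub (L1onZ _ fi)|exact: sub].
    by apply: eq_I => u _; ring.
  by rewrite (I_split hi a_s st tb) /D; ring.
have [fst _] := ac_on_incr_le Hf a_s (lexx s) st tb.
rewrite DE mulrDl; apply: le_trans (ler_normD _ _) _; apply: lerD.
  apply: le_trans (FF s t _ _) _; rewrite ?a_s ?sb ?ata ?tb//.
  rewrite ler_wpM2l// -(real_normK (num_real (f t - f s))).
  by rewrite ler_pXn2r// nnegrE.
rewrite expr2 mulrA {2}nE -I_Z; last exact: sub.
apply: norm_I_le_dom.
- apply: eq_L1on (L1onB (L1onZ (F' (f s)) (sub _ fi)) (sub _ hi)) => u _; ring.
- by apply: sub; exact: L1onZ.
move=> u /andP[su ut].
rewrite normrM ler_wpM2r//.
have [_ fsu] := ac_on_incr_le Hf a_s su ut tb.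
apply: le_trans (F'lip s u _ _) _; rewrite ?a_s ?sb ?(le_trans a_s su)
    ?(le_trans ut tb)//.
by rewrite ler_wpM2l ?mulr_ge0// distrC.
Qed.

(** The order of [s] and [t] is free. The bound by [Num.max s t] is meant for [expR], whose
    derivative is Lipschitz only on half-lines bounded above. *)
Lemma MVT_between (F F' : R -> R) s t : (forall x, is_derive x 1 F (F' x)) ->
  exists c, [/\ F t - F s = F' c * (t - s), `|c - s| <= `|t - s| &
    c <= Num.max s t].
Proof.
move=> dF.
have cF x y : {within `[x, y], continuous F}%classic.
  by apply: derivable_within_continuous => z _; case: (dF z).
have [st|ts|->] := ltgtP s t.
- have [c] := @MVT R F F' s t st (fun x _ => dF x) (cF s t).
  rewrite in_itv /= => /andP[sc ct] E; exists c; split=> //.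
    by rewrite !ger0_norm ?subr_ge0 ?ltW//; lra.
  exact: ltW.
- have [c] := @MVT R F F' t s ts (fun x _ => dF x) (cF t s).
  rewrite in_itv /= => /andP[tc cs] E; exists c; split=> //.
  + by rewrite -opprB E; ring.
  + by rewrite !ler0_norm ?subr_le0 ?ltW//; lra.
  + exact: ltW.
- by exists t; rewrite !subrr mulr0 normr0; split => //; rewrite max_l.
Qed.

Lemma taylor1_le (F F' : R -> R) L s t : (forall x, is_derive x 1 F (F' x)) ->
  0 <= L ->
  (forall c, c <= Num.max s t -> `|F' c - F' s| <= L * `|c - s|) ->
  `|F t - F s - F' s * (t - s)| <= L * (t - s) ^+ 2.
Proof.
move=> dF L0 lip; have [c [-> cs cm]] := MVT_between s t dF.
rewrite -mulrBl normrM -(real_normK (num_real (t - s))) expr2 mulrA.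
rewrite ler_wpM2r//; apply: le_trans (lip c cm) _.
by rewrite ler_wpM2l.
Qed.

Lemma sin_lip (s t : R) : `|sin s - sin t| <= `|s - t|.
Proof.
have [c [-> _ _]] := MVT_between t s (@is_derive_sin R).
by rewrite normrM ler_piMl// ler_norml cos_geN1 cos_le1.
Qed.

Lemma cos_lip (s t : R) : `|cos s - cos t| <= `|s - t|.
Proof.
have [c [-> _ _]] := @MVT_between (@cos R) (fun x => - sin x) t s (@is_derive_cos R).
by rewrite normrM ler_piMl// normrN ler_norml sin_geN1 sin_le1.
Qed.

Lemma ac_on_sin a b f f' : ac_on a b f f' ->
  ac_on a b (fun x => sin (f x)) (fun x => cos (f x) * f' x).
Proof.
move=> Hf; apply: (ac_on_comp ler01 Hf) => s t _ _.
apply: (taylor1_le (@is_derive_sin R)) => // c _.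
by rewrite mul1r cos_lip.
Qed.

Lemma ac_on_cos a b f f' : ac_on a b f f' ->
  ac_on a b (fun x => cos (f x)) (fun x => - sin (f x) * f' x).
Proof.
move=> Hf; apply: (@ac_on_comp _ _ _ _ cos (fun x => - sin x) _ ler01 Hf) => s t _ _.
apply: (@taylor1_le _ (fun x => - sin x) _ _ _ (@is_derive_cos R)) => // c _.
by rewrite mul1r -opprD normrN sin_lip.
Qed.

Lemma ac_on_expR a b f f' C : (forall x, a <= x <= b -> f x <= C) ->
  ac_on a b f f' -> ac_on a b (fun x => expR (f x)) (fun x => expR (f x) * f' x).
Proof.
move=> fC Hf; apply: (ac_on_comp (expR_ge0 C) Hf) => s t sab tab.
apply: (taylor1_le (@is_derive_expR R)) => [|c cm]; first exact: expR_ge0.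
have [d [-> _ dm]] := MVT_between (f s) c (@is_derive_expR R).
rewrite normrM ler_wpM2r// ger0_norm ?expR_ge0// ler_expR.
apply: le_trans dm _; rewrite ge_max fC//=.
by apply: le_trans cm _; rewrite ge_max !fC.
Qed.

Lemma ac_on_inv a b f f' c : 0 < c -> (forall x, a <= x <= b -> c <= f x) ->
  ac_on a b f f' -> ac_on a b (fun x => (f x)^-1) (fun x => - (f x) ^- 2 * f' x).
Proof.
move=> c0 cf Hf.
apply: (@ac_on_comp _ _ _ _ (fun x => x^-1) (fun x => - x ^- 2) (c ^- 3) _ Hf) =>
    [|s t sab tab].
  by rewrite invr_ge0 exprn_ge0// ltW.
have cs := cf _ sab; have ct := cf _ tab.
have s0 : 0 < f s by apply: lt_le_trans cs.
have t0 : 0 < f t by apply: lt_le_trans ct.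
have -> : (f t)^-1 - (f s)^-1 - - f s ^- 2 * (f t - f s) =
  (f s ^+ 2 * f t)^-1 * (f t - f s) ^+ 2.
  by field; rewrite !gt_eqF.
rewrite ger0_norm; last by rewrite mulr_ge0 ?sqr_ge0// invr_ge0 mulr_ge0 ?sqr_ge0// ltW.
rewrite ler_wpM2r ?sqr_ge0// lef_pV2 ?posrE ?mulr_gt0 ?exprn_gt0//.
have c0' := ltW c0; rewrite exprSr; apply: ler_pM; rewrite ?exprn_ge0//.
by rewrite ler_pXn2r// nnegrE (le_trans c0').
Qed.

Lemma ac_on_sqrt a b f f' c : 0 < c -> (forall x, a <= x <= b -> c <= f x) ->
  ac_on a b f f' ->
  ac_on a b (fun x => Num.sqrt (f x)) (fun x => (2 * Num.sqrt (f x))^-1 * f' x).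
Proof.
move=> c0 cf Hf.
have sc0 : 0 < Num.sqrt c by rewrite sqrtr_gt0.
apply: (@ac_on_comp _ _ _ _ Num.sqrt (fun x => (2 * Num.sqrt x)^-1)
    (2 * Num.sqrt c ^+ 3)^-1 _ Hf) => [|s t sab tab].
  by rewrite invr_ge0 mulr_ge0// exprn_ge0// ltW.
have cs := cf _ sab; have ct := cf _ tab.
have s0 : 0 < f s by apply: lt_le_trans cs.
have t0 : 0 < f t by apply: lt_le_trans ct.
have := sqr_sqrtr (ltW s0); have := sqr_sqrtr (ltW t0).
have : Num.sqrt c <= Num.sqrt (f s) by rewrite ler_sqrt ?(ltW s0).
have : Num.sqrt c <= Num.sqrt (f t) by rewrite ler_sqrt ?(ltW t0).
set x := Num.sqrt (f s); set y := Num.sqrt (f t); set d := Num.sqrt c in sc0 *.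
move=> dy dx <- <-.
have x0 : 0 < x by apply: lt_le_trans dx.
have y0 : 0 < y by apply: lt_le_trans dy.
have -> : y - x - (2 * x)^-1 * (y ^+ 2 - x ^+ 2) = - ((2 * x)^-1 * (y - x) ^+ 2).
  by field; rewrite gt_eqF.
rewrite normrN ger0_norm; last by rewrite mulr_ge0 ?sqr_ge0// invr_ge0 mulr_ge0// ltW.
have -> : (2 * d ^+ 3)^-1 * (y ^+ 2 - x ^+ 2) ^+ 2 =
   (2 * d)^-1 * ((y - x) ^+ 2 * ((x + y) / d) ^+ 2).
  by field; rewrite gt_eqF.
apply: ler_pM; rewrite ?sqr_ge0 ?invr_ge0//; first by rewrite mulr_ge0// ltW.
  by rewrite lef_pV2 ?posrE ?mulr_gt0// ler_pM2l.
rewrite ler_peMr ?sqr_ge0// exprn_ege1// ler_pdivlMr// mul1r.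
by apply: le_trans dx _; rewrite lerDl ltW.
Qed.

Lemma ac_on_nonincreasing a b f f' : a <= b -> ac_on a b f f' ->
  (forall x, a <= x <= b -> f' x <= 0) -> f b <= f a.
Proof.
move=> ab Hf f'0; rewrite (ac_onW Hf (lexx a) ab (lexx b)) gerDl.
rewrite -oppr_ge0 -mulN1r -(I_Z _ Hf.1); apply: I_ge0 => t tab.
by rewrite mulN1r oppr_ge0 f'0.
Qed.

(** Integrating factor: f exp(-int m) - int g is nonincreasing, because exp(-int m) <= 1 absorbs the
    factor in front of [g]. *)
Lemma gronwall a b f f' m g : a <= b -> ac_on a b f f' ->
  L1on a b m -> L1on a b g ->
  (forall x, a <= x <= b -> 0 <= m x) ->
  (forall x, a <= x <= b -> 0 <= g x) ->
  (forall x, a <= x <= b -> f' x <= m x * f x + g x) ->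
  f b <= (f a + I[a, b] g) * expR (I[a, b] m).
Proof.
move=> ab Hf mi gi m0 g0 f'le.
pose M x := -1 * (0 + I[a, x] m).
have HM : ac_on a b M (fun x => -1 * m x) by apply: ac_onZ; exact: ac_on_int.
have M0 x : a <= x <= b -> M x <= 0.
  move=> /andP[ax xb]; rewrite /M add0r mulN1r oppr_le0;
      apply: I_ge0 => t /andP[at_ tx].
  by rewrite m0// at_ (le_trans tx xb).
have HE := ac_on_expR M0 HM.
have HfE := ac_onM Hf HE.
pose G x := 0 + I[a, x] g.
have HG : ac_on a b G g := ac_on_int 0 gi.
have Ga : G a = 0 by rewrite /G I_itv1 addr0.
have Gb : G b = I[a, b] g by rewrite /G add0r.
have Ma : M a = 0 by rewrite /M I_itv1 addr0 mulr0.
have Mb : M b = - I[a, b] m by rewrite /M add0r mulN1r.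
have H : f b * expR (M b) - G b <= f a * expR (M a) - G a.
  apply: (ac_on_nonincreasing ab (ac_onB HfE HG)) => x xab.
  have E0 := expR_gt0 (M x).
  have E1 : expR (M x) <= 1 by rewrite -expR0 ler_expR M0.
  have := f'le x xab; have := g0 x xab; nra.
move: H; rewrite Ga Gb Ma Mb expR0 mulr1 subr0 expRN.
by rewrite lerBlDr ler_pdivrMr ?expR_gt0.
Qed.

End AbsolutelyContinuous.

(** * Linear systems with integrable coefficients *)

Section LinearSystems.
Variable R : realType.
Implicit Types (a b x y : R) (f g : R -> R).

(** The intervals of radius 2 K / 2^n around [v n] are nested, so the supremum of their left ends
    lies in all of them. This yields the limit together with its rate. *)
Lemma geometric_increments_limit (v : nat -> R) K : 0 <= K ->
  (forall n, `|v n.+1 - v n| <= K / 2 ^+ n) ->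
  exists l, forall n, `|l - v n| <= 2 * K / 2 ^+ n.
Proof.
move=> K0 vK; pose r n := 2 * K / 2 ^+ n : R.
have rS n : r n.+1 = r n - K / 2 ^+ n.
  by rewrite /r exprS; field; rewrite expf_neq0// pnatr_eq0.
have r0 n : 0 <= r n by rewrite /r divr_ge0 ?mulr_ge0// exprn_ge0.
have up n m : v (n + m)%N - r (n + m)%N <= v n + r n /\ v n - r n <= v (n + m)%N - r
    (n + m)%N
    /\ v (n + m)%N + r (n + m)%N <= v n + r n.
  elim: m => [|m [IH1 [IH2 IH3]]]; first by rewrite addn0; have := r0 n; split;
      [|split]; lra.
  rewrite addnS rS; have := vK (n + m)%N; rewrite ler_norml => /andP[H1 H2].
  have rE : r (n + m)%N = 2 * (K / 2 ^+ (n + m)) by rewrite /r mulrA.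
  have := r0 (n + m)%N.
  by split; [|split]; lra.
have cross n m : v m - r m <= v n + r n.
  have [nm|mn] := leqP n m.
    by rewrite -(subnKC nm); case: (up n (m - n)%N).
  rewrite -(subnKC (ltnW mn)); case: (up m (n - m)%N) => _ [H _].
  by have := r0 (m + (n - m))%N; lra.
pose A := range (fun n => v n - r n)%classic.
have ub n : ubound A (v n + r n) by move=> _ [m _ <-].
have supA : has_sup A
    by split; [exists (v 0%N - r 0%N); exists 0%N|exists (v 0%N + r 0%N); exact: ub].
exists (sup A) => n; rewrite ler_norml; apply/andP; split.
  have : v n - r n <= sup A by apply: (ub_le_sup supA.2); exists n.
  by rewrite /r; lra.
have : sup A <= v n + r n by apply: ge_sup => //; exact: supA.1.
by rewrite /r; lra.
Qed.

Lemma eq0_geometric_bound (z C : R) : (forall n, `|z| <= C / 2 ^+ n) -> z = 0.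
Proof.
move=> zC; apply/eqP; rewrite -normr_le0 leNgt; apply/negP => z0.
have [n nP] : exists n : nat, C / `|z| < n%:R.
  have := archi_boundP (normr_ge0 (C / `|z|)).
  by move=> H; eexists; apply: le_lt_trans (ler_norm _) H.
have := zC n; rewrite ler_pdivlMr ?exprn_gt0// leNgt => /negP; apply.
rewrite ltr_pdivrMr// in nP; apply: lt_le_trans nP _.
rewrite mulrC ler_pM2l// -natrX ler_nat; exact/ltnW/ltn_expl.
Qed.

Lemma within_continuous_approx a b f :
  (forall e, 0 < e -> exists2 h : R -> R, {within `[a, b], continuous h}%classic &
     forall x, a <= x <= b -> `|f x - h x| <= e) ->
  {within `[a, b], continuous f}%classic.
Proof.
move=> H; apply/subspace_continuousP => x xab; apply/cvgrPdist_lt => e e0.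
have e3 : 0 < e / 3 by rewrite divr_gt0.
have [h /subspace_continuousP ch fh] := H _ e3.
have /cvgrPdist_lt hx := ch x xab.
have /= := hx _ e3; rewrite !near_withinE; apply: filterS => y yf yab.
have {}yf := yf yab; move: xab yab; rewrite /= !in_itv /= => xab yab.
have H1 := fh _ xab; have H2 := fh _ yab; rewrite distrC in H2.
have -> : f x - f y = (f x - h x) + (h x - h y) + (h y - f y) by ring.
apply: le_lt_trans (ler_normD _ _) _.
have := ler_normD (f x - h x) (h x - h y); lra.
Qed.

(** Starting from zero makes the first increment equal to the initial data, so that [|u0| + |w0|] is
    the constant of the geometric bound. *)
Fixpoint picard a (g m : R -> R) u0 w0 n : (R -> R) * (R -> R) :=
  if n is n'.+1 then
    let: (u, w) := picard a g m u0 w0 n' in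
    (fun x => u0 + I[a, x] (fun t => w t * g t),
     fun x => w0 + I[a, x] (fun t => m t * u t))
  else (fun=> 0, fun=> 0).

Lemma linear_ivp_exists a b g m u0 w0 : a <= b -> L1on a b g -> L1on a b m ->
  exists u w, [/\ u a = u0, w a = w0, ac_on a b u (fun x => w x * g x) &
    ac_on a b w (fun x => m x * u x)].
Proof.
move=> ab gi mi.
pose un n := (picard a g m u0 w0 n).1; pose wn n := (picard a g m u0 w0 n).2.
have unS n : un n.+1 = fun x => u0 + I[a, x] (fun t => wn n t * g t).
  by rewrite /un /wn /=; case: (picard _ _ _ _ _ n).
have wnS n : wn n.+1 = fun x => w0 + I[a, x] (fun t => m t * un n t).
  by rewrite /un /wn /=; case: (picard _ _ _ _ _ n).
have cst_cont (c : R) : {within `[a, b], continuous (fun=> c)}%classic.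
  exact: ac_on_continuous ab (ac_on_cst a b c).
have L1mu u : {within `[a, b], continuous u}%classic -> L1on a b (fun t => m t * u t).
  by move=> cu; apply: eq_L1on (L1onMC cu mi) => x _; rewrite mulrC.
have cont n : {within `[a, b], continuous (un n)}%classic /\
    {within `[a, b], continuous (wn n)}%classic.
  elim: n => [|n [cu cw]]; first by split; exact: cst_cont.
  rewrite unS wnS; split; apply: ac_on_continuous ab _; apply: ac_on_int.
    exact: L1onMC.
  exact: L1mu.
pose k t := `|g t| + `|m t|.
have ki : L1on a b k by apply: L1onD; exact: L1on_norm.
have k0 t : 0 <= k t by rewrite addr_ge0.
(* Bielecki weight: the factor 2 in the exponent gives int E k <= E / 2, so each Picard step halves
   the weighted distance on all of [a, b], however large int k is. *)
pose E x := expR (2 * (0 + I[a, x] k)).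
have Nle x : a <= x <= b -> 2 * (0 + I[a, x] k) <= 2 * I[a, b] k.
  move=> /andP[ax xb]; rewrite add0r ler_wpM2l// (I_chasles ki ax xb) lerDl.
  exact: I_ge0.
have HE : ac_on a b E (fun x => E x * (2 * k x)).
  by apply: ac_on_expR; [exact: Nle|apply: ac_onZ; exact: ac_on_int].
have E1 x : a <= x <= b -> 1 <= E x.
  move=> /andP[ax xb]; rewrite -expR0 ler_expR add0r mulr_ge0//.
  exact: I_ge0.
have EB x : a <= x <= b -> E x <= E b.
  by move=> xab; rewrite ler_expR [X in _ <= 2 * X]add0r Nle.
have cE := ac_on_continuous ab HE.
have kEi := L1onMC cE ki.
have IE x : a <= x -> x <= b -> I[a, x] (fun t => E t * k t) <= E x / 2.
  move=> ax xb; have := ac_onW HE (lexx a) ax xb.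
  have -> : I[a, x] (fun t => E t * (2 * k t)) = 2 * I[a, x] (fun t => E t * k t).
    by rewrite -I_Z; [apply: eq_I => t _; ring|exact: L1on_sub kEi _ _].
  have -> : E a = 1 by rewrite /E I_itv1 addr0 mulr0 expR0.
  move=> ->; lra.
clearbody E; pose K := `|u0| + `|w0|.
have K0 : 0 <= K by rewrite addr_ge0.
have incr n x : a <= x <= b -> `|un n.+1 x - un n x| <= K / 2 ^+ n * E x /\
    `|wn n.+1 x - wn n x| <= K / 2 ^+ n * E x.
  elim: n x => [|n IH] x xab.
    rewrite unS wnS /un /wn /=.
    have [ax _] := andP xab.
    have -> : I[a, x] (fun t => 0 * g t) = 0.
      have -> : (fun t => 0 * g t) = (fun=> 0) by apply: funext => t; rewrite mul0r.
      by rewrite I_cst// mul0r.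
    have -> : I[a, x] (fun t => m t * 0) = 0.
      have -> : (fun t => m t * 0) = (fun=> 0) by apply: funext => t; rewrite mulr0.
      by rewrite I_cst// mul0r.
    have := E1 x xab; rewrite expr0 !addr0 !subr0 divr1 => E1x.
    have := normr_ge0 u0; have := normr_ge0 w0; rewrite /K => *; split; nra.
  have [ax xb] := andP xab.
  have sub h : L1on a b h -> L1on a x h by move=> hi'; exact: L1on_sub hi' _ _.
  have [cu cw] := cont n; have [cu1 cw1] := cont n.+1.
  have aux (d h : R -> R) : L1on a b (fun t => d t * h t) ->
      (forall t, a <= t <= b -> `|d t| <= K / 2 ^+ n * E t) ->
      (forall t, `|h t| <= k t) ->
      `|I[a, x] (fun t => d t * h t)| <= K / 2 ^+ n.+1 * E x.
    move=> dhi dK hk.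
    apply: (@le_trans _ _ (I[a, x] (fun t => K / 2 ^+ n * (E t * k t)))).
      apply: norm_I_le_dom; [exact: sub|exact: sub (L1onZ _ kEi)|].
      move=> t /andP[at_ tx]; rewrite normrM mulrA ler_pM//.
      by rewrite dK// at_ (le_trans tx xb).
    rewrite I_Z; last exact: sub.
    have := IE x ax xb; rewrite exprS => H.
    have -> : K / (2 * 2 ^+ n) * E x = K / 2 ^+ n * (E x / 2).
      by field; rewrite expf_neq0// pnatr_eq0.
    by rewrite ler_wpM2l// divr_ge0// exprn_ge0.
  split.
    rewrite [un n.+2]unS [un n.+1]unS opprD addrACA subrr add0r -I_B;
        [|exact: sub (L1onMC cw1 gi)|exact: sub (L1onMC cw gi)].
    have -> : I[a, x] (fun t => wn n.+1 t * g t - wn n t * g t) =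
       I[a, x] (fun t => (wn n.+1 t - wn n t) * g t) by apply: eq_I => t _; ring.
    apply: aux => [|t tab|t].
    - by apply: eq_L1on (L1onB (L1onMC cw1 gi) (L1onMC cw gi)) => t _; ring.
    - by case: (IH t tab).
    - by rewrite /k lerDl.
  rewrite [wn n.+2]wnS [wn n.+1]wnS opprD addrACA subrr add0r -I_B;
      [|exact: sub (L1mu _ cu1)|exact: sub (L1mu _ cu)].
  have -> : I[a, x] (fun t => m t * un n.+1 t - m t * un n t) =
     I[a, x] (fun t => (un n.+1 t - un n t) * m t) by apply: eq_I => t _; ring.
  apply: aux => [|t tab|t].
  - by apply: eq_L1on (L1onB (L1mu _ cu1) (L1mu _ cu)) => t _; ring.
  - by case: (IH t tab).
  - by rewrite /k lerDr.
have KE0 : 0 <= K * E b.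
  by rewrite mulr_ge0// (le_trans ler01)// E1// ab lexx.
clearbody K.
have limx (v : nat -> R -> R) : (forall n x, a <= x <= b -> `|v n.+1 x - v n x| <= K /
    2 ^+ n * E x) ->
    exists u, forall n x, a <= x <= b -> `|u x - v n x| <= 2 * (K * E b) / 2 ^+ n.
  move=> vK.
  have /choice[u uP] : forall x, exists l, a <= x <= b -> forall n, `|l - v n x| <= 2
      * (K * E b) / 2 ^+ n.
    move=> x; have [xab|] := boolP (a <= x <= b); last by exists 0.
    have [|l lP] := @geometric_increments_limit (fun n => v n x) _ KE0.
      move=> n; apply: le_trans (vK n x xab) _.
      by rewrite mulrAC ler_wpM2r ?invr_ge0 ?exprn_ge0// ler_wpM2l// EB.
    by exists l.
  by exists u => n x xab; exact: uP.
have limcont u (v : nat -> R -> R) :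
    (forall n, {within `[a, b], continuous (v n)}%classic) ->
    (forall n x, a <= x <= b -> `|u x - v n x| <= 2 * (K * E b) / 2 ^+ n) ->
    {within `[a, b], continuous u}%classic.
  move=> cv uv; apply: within_continuous_approx => e e0.
  have [n nP] : exists n : nat, 2 * (K * E b) / 2 ^+ n <= e.
    apply: contrapT => /forallNP H.
    have /eq0_geometric_bound H0 : forall n, `|e| <= 2 * (K * E b) / 2 ^+ n.
      by move=> n; rewrite gtr0_norm// ltW// ltNge; exact/negP.
    by rewrite H0 ltxx in e0.
  by exists (v n) => // x xab; exact: le_trans (uv n x xab) nP.
have [u uP] := limx un (fun n x xab => (incr n x xab).1).
have [w wP] := limx wn (fun n x xab => (incr n x xab).2).
have cu := limcont u un (fun n => (cont n).1) uP.
have cw := limcont w wn (fun n => (cont n).2) wP.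
have limeq (c : R) (f v' h : R -> R) (fn vn' : nat -> R -> R) :
    (forall n, fn n.+1 = fun x => c + I[a, x] (fun t => vn' n t * h t)) ->
    L1on a b h -> (forall n, {within `[a, b], continuous (vn' n)}%classic) ->
    {within `[a, b], continuous v'}%classic ->
    (forall n x, a <= x <= b -> `|f x - fn n x| <= 2 * (K * E b) / 2 ^+ n) ->
    (forall n x, a <= x <= b -> `|v' x - vn' n x| <= 2 * (K * E b) / 2 ^+ n) ->
    forall x, a <= x <= b -> f x = c + I[a, x] (fun t => v' t * h t).
  move=> fnS hi cvn cv' ffn vvn x xab; have [ax xb] := andP xab.
  have sub h' : L1on a b h' -> L1on a x h' by move=> hi'; exact: L1on_sub hi' _ _.
  apply/eqP; rewrite -subr_eq0; apply/eqP.
  apply: (@eq0_geometric_bound _ (2 * (K * E b) * (1 + I[a, x] (fun t => `|h t|)))) =>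
      n.
  have -> : f x - (c + I[a, x] (fun t => v' t * h t)) = (f x - fn n.+1 x) -
      I[a, x] (fun t => (v' t - vn' n t) * h t).
    have -> : I[a, x] (fun t => (v' t - vn' n t) * h t) =
       I[a, x] (fun t => v' t * h t) - I[a, x] (fun t => vn' n t * h t).
      rewrite -I_B; [|exact: sub (L1onMC cv' hi)|exact: sub (L1onMC (cvn n) hi)].
      by apply: eq_I => t _; ring.
    by rewrite fnS; ring.
  have n2 : 0 < (2 : R) ^+ n by rewrite exprn_gt0.
  apply: le_trans (ler_normB _ _) _.
  rewrite mulrAC mulrDr mulr1; apply: lerD.
    apply: le_trans (ffn n.+1 x xab) _.
    apply: ler_wpM2l; first exact: mulr_ge0.
    rewrite lef_pV2 ?posrE ?exprn_gt0// exprS.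
    by rewrite ler_pMl// ler1n.
  rewrite -I_Z; last exact: sub (L1on_norm hi).
  apply: norm_I_le_dom.
  - apply: sub; apply: eq_L1on (L1onB (L1onMC cv' hi) (L1onMC (cvn n) hi)) => t _; ring.
  - exact: sub (L1onZ _ (L1on_norm hi)).
  move=> t /andP[at_ tx]; rewrite normrM ler_wpM2r//.
  by apply: vvn; rewrite at_ (le_trans tx xb).
have uE := limeq u0 u w g un wn unS gi (fun n => (cont n).2) cw uP wP.
have wnS' n : wn n.+1 = fun x => w0 + I[a, x] (fun t => un n t * m t).
  rewrite wnS; apply: funext => x; congr (_ + _); apply: eq_I => t _; exact: mulrC.
have wE := limeq w0 w u m wn un wnS' mi (fun n => (cont n).1) cu wP uP.
have aab : a <= a <= b by rewrite lexx.
have ua : u a = u0 by rewrite uE// I_itv1 addr0.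
have wa : w a = w0 by rewrite wE// I_itv1 addr0.
exists u, w; split=> //.
  by split; [exact: L1onMC|move=> x xab; rewrite uE// ua].
split; [exact: L1mu|move=> x xab; rewrite wE// wa].
by congr (_ + _); apply: eq_I => t _; exact: mulrC.
Qed.

Lemma SL_sol_ac a b sigma rho q lam u w : SL_sol a b sigma rho q lam u w <->
  ac_on a b u (fun x => w x / sigma x) /\
  ac_on a b w (fun x => (q x - lam * rho x) * u x).
Proof. by split => [[? ? ? ?]|[[? ?] [? ?]]]; split. Qed.

Lemma SL_sol_exists a b sigma rho q lam u0 w0 : a <= b ->
  L1on a b (fun x => (sigma x)^-1) -> L1on a b rho -> L1on a b q ->
  exists u w, [/\ SL_sol a b sigma rho q lam u w, u a = u0 & w a = w0].
Proof.
move=> ab si ri qi.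
have [u [w [ua wa Hu Hw]]] := @linear_ivp_exists a b _ _ u0 w0 ab si
    (L1onB qi (L1onZ lam ri)).
by exists u, w; split=> //; apply/SL_sol_ac.
Qed.

(** Gronwall applied to the squared distance of the two solutions, with a forcing term proportional
    to (lam - lam0)^2; the square root is then linear in lam - lam0. Any solution at [lam] is
    allowed, so the result applies to solutions obtained by choice. *)
Lemma SL_sol_lipschitz a b sigma rho q lam0 u0 w0 : a <= b ->
  L1on a b (fun x => (sigma x)^-1) -> L1on a b rho -> L1on a b q ->
  SL_sol a b sigma rho q lam0 u0 w0 ->
  exists2 C, 0 <= C & forall lam u w, `|lam - lam0| <= 1 ->
    SL_sol a b sigma rho q lam u w -> u a = u0 a -> w a = w0 a ->
    `|u b - u0 b| <= C * `|lam - lam0| /\ `|w b - w0 b| <= C * `|lam - lam0|.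
Proof.
move=> ab si ri qi /SL_sol_ac[Hu0 Hw0].
have cu0 := ac_on_continuous ab Hu0.
(* In [|lam0| + 2], the part [|lam0| + 1] bounds [|lam|], and the last unit absorbs the cross term
   with [(lam - lam0) * rho x * u0 x]. *)
pose m x := `|(sigma x)^-1| + `|q x| + (`|lam0| + 2) * `|rho x|.
have mi : L1on a b m.
  by apply: L1onD; [apply: L1onD; exact: L1on_norm|apply: L1onZ; exact: L1on_norm].
pose g x := `|rho x| * u0 x ^+ 2.
have gi : L1on a b g.
  apply: eq_L1on (L1onMC cu0 (L1onMC cu0 (L1on_norm ri))) => x _.
  by rewrite /g; ring.
have g0 x : 0 <= g x by rewrite mulr_ge0// sqr_ge0.
pose B := I[a, b] g * expR (I[a, b] m).
have B0 : 0 <= B by rewrite mulr_ge0 ?expR_ge0//; exact: I_ge0.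
exists (Num.sqrt B); first exact: sqrtr_ge0.
move=> lam u w lam1 /SL_sol_ac[Hu Hw] ua wa.
pose d x := u x - u0 x; pose e x := w x - w0 x.
have Hd := ac_onB Hu Hu0; have He := ac_onB Hw Hw0.
have HF := ac_onD (ac_onM Hd Hd) (ac_onM He He).
have F_le : d b ^+ 2 + e b ^+ 2 <= (Num.sqrt B * `|lam - lam0|) ^+ 2.
  have := gronwall ab HF mi (L1onZ ((lam - lam0) ^+ 2) gi).
  rewrite ua wa !subrr !mulr0 !addr0 add0r I_Z// exprMn sqr_sqrtr// real_normK
      ?num_real//.
  rewrite -!expr2 /B => H; rewrite (mulrC (_ * expR _)) mulrA; apply: H => x xab.
  - by rewrite /m addr_ge0 ?addr_ge0// mulr_ge0 ?addr_ge0.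
  - by rewrite mulr_ge0// sqr_ge0.
  rewrite /m /g -/(d x) -/(e x).
  set D := d x; set E := e x; set s := (sigma x)^-1.
  have -> : w x / sigma x - w0 x / sigma x = E * s by rewrite /E /e /s; ring.
  have -> : (q x - lam * rho x) * u x - (q x - lam0 * rho x) * u0 x =
     (q x - lam * rho x) * D - (lam - lam0) * rho x * u0 x.
    by rewrite /D /d; ring.
  have lle : `|lam| <= `|lam0| + 1.
    by have := ler_normD (lam - lam0) lam0; rewrite subrK => H'; lra.
  set dl := lam - lam0; set r := rho x; set U := u0 x; set Q := q x.
  have DE2 z : 2 * (D * E) * z <= `|z| * (D ^+ 2 + E ^+ 2).
    have H1 : 2 * (D * E) <= D ^+ 2 + E ^+ 2 by have := sqr_ge0 (D - E); nra.
    have H2 : - (2 * (D * E)) <= D ^+ 2 + E ^+ 2 by have := sqr_ge0 (D + E); nra.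
    by have [z0|z0] := leP 0 z; [rewrite (ger0_norm z0)|rewrite (ltr0_norm z0)]; nra.
  have H1 := DE2 s; have H2 := DE2 Q; have H3 := DE2 (- lam * r).
  rewrite normrM normrN in H3.
  have H4 : `|lam| * `|r| * (D ^+ 2 + E ^+ 2) <= (`|lam0| + 1) * `|r| *
      (D ^+ 2 + E ^+ 2).
    by rewrite ler_wpM2r ?addr_ge0 ?sqr_ge0// ler_wpM2r.
  have H5 : - (2 * E * (dl * r * U)) <= `|r| * (D ^+ 2 + E ^+ 2) + dl ^+ 2 *
      (`|r| * U ^+ 2).
    have h1 : 0 <= (E - dl * U) ^+ 2 := sqr_ge0 _.
    have h2 : 0 <= (E + dl * U) ^+ 2 := sqr_ge0 _.
    have h3 : 0 <= D ^+ 2 := sqr_ge0 _.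
    have [r0|r0] := leP 0 r; [rewrite (ger0_norm r0)|rewrite (ltr0_norm r0)].
      have h4 := mulr_ge0 r0 h2; have h5 := mulr_ge0 r0 h3; nra.
    have nr0 : 0 <= - r by lra.
    have h4 := mulr_ge0 nr0 h1; have h5 := mulr_ge0 nr0 h3; nra.
  nra.
split.
  rewrite -[leRHS]ger0_norm ?mulr_ge0 ?sqrtr_ge0// -ler_sqr ?nnegrE//.
  rewrite !real_normK ?num_real//; have := sqr_ge0 (e b); rewrite /d in F_le *; lra.
rewrite -[leRHS]ger0_norm ?mulr_ge0 ?sqrtr_ge0// -ler_sqr ?nnegrE//.
rewrite !real_normK ?num_real//; have := sqr_ge0 (d b); rewrite /e in F_le *; lra.
Qed.

End LinearSystems.

(** * Liouville-Green asymptotics *)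

Section LiouvilleGreen.
Variable R : realType.
Implicit Types (a b x y : R) (f g : R -> R).

Lemma dist_chain (z zc z' zc' A B : R) : `|z - zc| <= A -> `|z' - zc'| <= A ->
  `|zc - zc'| <= B -> `|z - z'| <= B + 2 * A.
Proof.
move=> h1 h2 h3; have -> : z - z' = (z - zc) + (zc - zc') + (zc' - z') by ring.
apply: le_trans (ler_normD _ _) _; rewrite (distrC zc').
by have := ler_normD (z - zc) (zc - zc'); lra.
Qed.

(* r = (rho sigma)^(1/4), p = sqrt (rho / sigma), h = r' / r, kap = h / (2 p). *)
Record liouville a b (rho sigma r h p kap kap' : R -> R) : Prop := Liouville {
  liouville_sigma : forall x, a <= x <= b -> 0 < sigma x;
  liouville_r_lb : exists2 c, 0 < c & forall x, a <= x <= b -> c <= r x;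
  liouville_r_ac : ac_on a b r (fun x => h x * r x);
  liouville_h_cont : {within `[a, b], continuous h}%classic;
  liouville_p_cont : {within `[a, b], continuous p}%classic;
  liouville_p_sigma : forall x, a <= x <= b -> p x * sigma x = r x ^+ 2;
  liouville_p_rho : forall x, a <= x <= b -> p x * r x ^+ 2 = rho x;
  liouville_kap : forall x, a <= x <= b -> h x = 2 * p x * kap x;
  liouville_kap_ac : ac_on a b kap kap' }.

Lemma H2on_ac a b f : H2on a b f ->
  exists f1 f2, ac_on a b f f1 /\ ac_on a b f1 f2.
Proof.
move=> [f1 [f2 [f2i f1i Hf1 Hf]]]; exists f1, f2; split; split => //.
exact: L2on_L1on.
Qed.

(** H^2 enters here: h = (rho sigma)' / (4 rho sigma) involves the first derivatives of the
    coefficients, which are absolutely continuous, and so [h] and [kap] are absolutely continuous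
    too. *)
Lemma liouville_exists a b rho sigma : a <= b -> H2on a b rho -> H2on a b sigma ->
  unif_pos a b rho -> unif_pos a b sigma ->
  exists r h p kap kap', liouville a b rho sigma r h p kap kap'.
Proof.
move=> ab /H2on_ac[rho1 [rho2 [Hr Hr1]]] /H2on_ac[sig1 [sig2 [Hs Hs1]]].
move=> [cr [cr0 rlb]] [cs [cs0 slb]].
pose m x := rho x * sigma x.
have Hm := ac_onM Hr Hs.
have r_gt0 x : a <= x <= b -> 0 < rho x by move=> /rlb; exact: lt_le_trans.
have s_gt0 x : a <= x <= b -> 0 < sigma x by move=> /slb; exact: lt_le_trans.
have mlb x : a <= x <= b -> cr * cs <= rho x * sigma x.
  by move=> xab; exact: ler_pM (ltW cr0) (ltW cs0) (rlb _ xab) (slb _ xab).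
have crs0 : 0 < cr * cs by rewrite mulr_gt0.
have Hsm := ac_on_sqrt crs0 mlb Hm.
have crs0' : 0 < Num.sqrt (cr * cs) by rewrite sqrtr_gt0.
have smlb x : a <= x <= b -> Num.sqrt (cr * cs) <= Num.sqrt (rho x * sigma x).
  by move=> xab; rewrite ler_sqrt ?mlb// mulr_ge0// ltW// ?r_gt0 ?s_gt0.
have Hrr := ac_on_sqrt crs0' smlb Hsm.
pose r x := Num.sqrt (Num.sqrt (rho x * sigma x)).
have r2 x : r x ^+ 2 = Num.sqrt (rho x * sigma x) by rewrite sqr_sqrtr// sqrtr_ge0.
have r4 x : a <= x <= b -> r x ^+ 4 = rho x * sigma x.
  move=> xab; rewrite (exprM _ 2 2) r2 sqr_sqrtr// mulr_ge0// ltW ?r_gt0 ?s_gt0//.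
have rlb' x : a <= x <= b -> Num.sqrt (Num.sqrt (cr * cs)) <= r x.
  by move=> xab; rewrite ler_sqrt ?smlb// sqrtr_ge0.
have cc0 : 0 < Num.sqrt (Num.sqrt (cr * cs)) by rewrite !sqrtr_gt0.
have rgt0 x : a <= x <= b -> 0 < r x by move=> /rlb'; exact: lt_le_trans.
pose h x := 4^-1 * ((rho1 x * sigma x + rho x * sig1 x) * (rho x * sigma x)^-1).
have [h' Hh] : exists h', ac_on a b h h'.
  have Hd := ac_onD (ac_onM Hr1 Hs) (ac_onM Hr Hs1).
  by eexists; apply: ac_onZ; exact: ac_onM Hd (ac_on_inv crs0 mlb Hm).
pose p x := r x ^+ 2 * (sigma x)^-1.
have [p' Hp] : exists p', ac_on a b p p'.
  by eexists; apply: ac_onM (ac_onM Hrr Hrr) (ac_on_inv cs0 slb Hs).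
pose kap x := 2^-1 * (h x * (sigma x * (Num.sqrt (rho x * sigma x))^-1)).
have [kap' Hkap] : exists kap', ac_on a b kap kap'.
  by eexists; apply: ac_onZ; apply: ac_onM Hh (ac_onM Hs (ac_on_inv crs0' smlb Hsm)).
exists r, h, p, kap, kap'; split => //.
- by exists (Num.sqrt (Num.sqrt (cr * cs))).
- apply: eq_ac_on Hrr => // x xab; rewrite -/(r x) -r2 /h.
  rewrite -(r4 _ xab); field; by rewrite gt_eqF ?rgt0.
- exact: ac_on_continuous Hh.
- exact: ac_on_continuous Hp.
- by move=> x xab; rewrite /p mulfVK// gt_eqF// s_gt0.
- move=> x xab; rewrite /p mulrAC -exprD r4//; field.
  by rewrite gt_eqF// s_gt0.
- move=> x xab; rewrite /kap /p -r2; field.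
  by rewrite !gt_eqF ?s_gt0 ?rgt0.
Qed.

(** * Rotation of the scaled solution and its O(1/k) error *)

Section Asymptotics.
Variables (a b : R) (rho sigma q r h p kap kap' : R -> R).
Hypotheses (ab : a <= b) (L : liouville a b rho sigma r h p kap kap')
  (qi : L1on a b q).

Let r_gt0 x : a <= x <= b -> 0 < r x.
Proof. by move=> xab; have [c c0 cr] := liouville_r_lb L;
    exact: lt_le_trans (cr x xab). Qed.

Let rinv_ac : ac_on a b (fun x => (r x)^-1) (fun x => - (h x / r x)).
Proof.
have [c c0 cr] := liouville_r_lb L.
apply: eq_ac_on (ac_on_inv c0 cr (liouville_r_ac L)) => // x xab.
by field; rewrite gt_eqF// r_gt0.
Qed.

Lemma liouville_p_ac : ac_on a b (fun x => I[a, x] p) p.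
Proof.
apply: eq_ac_on (ac_on_int 0 (L1on_continuous (liouville_p_cont L))) => // x _.
by rewrite add0r.
Qed.

Definition potential x := q x / r x ^+ 2.

Lemma potential_L1 : L1on a b potential.
Proof.
have cr := ac_on_continuous ab rinv_ac.
apply: eq_L1on (L1onMC cr (L1onMC cr qi)) => x xab.
by rewrite /potential; field; rewrite gt_eqF// r_gt0.
Qed.

Section Solution.
Variables (k : R) (u w : R -> R).
Hypotheses (k_ge1 : 1 <= k) (sol : SL_sol a b sigma rho q (k ^+ 2) u w).

Let k_gt0 : 0 < k. Proof. exact: lt_le_trans k_ge1. Qed.
Let U x := k * r x * u x.
Let W x := w x / r x.

(** The scaling by [r] is the one for which r^2 / sigma = rho / r^2. The common value [p] makes the
    two off-diagonal coefficients k p and - k p, that is, a rotation. *)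
Lemma liouville_U_ac : ac_on a b U (fun x => h x * U x + k * p x * W x).
Proof.
have [Hu Hw] := (SL_sol_ac _ _ _ _ _ _ _ _).1 sol.
apply: eq_ac_on (ac_onZ k (ac_onM (liouville_r_ac L) Hu)) => x xab.
  by rewrite /U mulrA.
have r0 := r_gt0 xab; have s0 := liouville_sigma L xab.
have -> : p x = r x ^+ 2 / sigma x.
  by rewrite -(liouville_p_sigma L xab) mulfK// gt_eqF.
by rewrite /U /W; field; rewrite !gt_eqF.
Qed.

Lemma liouville_W_ac : ac_on a b W
  (fun x => - (h x * W x) - k * p x * U x + potential x / k * U x).
Proof.
have [Hu Hw] := (SL_sol_ac _ _ _ _ _ _ _ _).1 sol.
apply: eq_ac_on (ac_onM Hw rinv_ac) => // x xab.
have r0 := r_gt0 xab.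
rewrite /U /W /potential -(liouville_p_rho L xab); field.
by rewrite !gt_eqF.
Qed.

Let gro := expR (I[a, b] (fun x => 2 * `|h x| + `|potential x|)).
Let E0 := `|U a| + `|W a|.

(** The rotation terms cancel in the derivative of U^2 + W^2. What remains is bounded by
    [2 * |h| + |potential|] as soon as k >= 1, so the growth factor [gro] does not depend on [k]. *)
Lemma liouville_energy x : a <= x <= b -> `|U x| <= gro * E0 /\ `|W x| <= gro * E0.
Proof.
move=> /andP[ax xb].
have hi := L1on_continuous (liouville_h_cont L).
pose m y := 2 * `|h y| + `|potential y|.
have mi : L1on a b m.
  by apply: L1onD; [apply: L1onZ|]; apply: L1on_norm => //; exact: potential_L1.
have m0 y : 0 <= m y by rewrite addr_ge0// mulr_ge0.
have sub f f' : ac_on a b f f' -> ac_on a x f f'.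
  by move=> Hf; exact: ac_on_sub Hf _ _.
have HU := sub _ _ liouville_U_ac; have HW := sub _ _ liouville_W_ac.
have := gronwall ax (ac_onD (ac_onM HU HU) (ac_onM HW HW))
  (L1on_sub mi (lexx a) xb) (L1on_cst a x 0).
rewrite I_cst// mul0r addr0 => H.
have {}H : U x * U x + W x * W x <= (U a * U a + W a * W a) * expR (I[a, x] m).
  apply: H => // y /andP[ay yx].
  have DE2 (D E z : R) : 2 * (D * E) * z <= `|z| * (D ^+ 2 + E ^+ 2).
    have H1 : 2 * (D * E) <= D ^+ 2 + E ^+ 2 by have := sqr_ge0 (D - E); nra.
    have H2 : - (2 * (D * E)) <= D ^+ 2 + E ^+ 2 by have := sqr_ge0 (D + E); nra.
    by have [z0|z0] := leP 0 z; [rewrite (ger0_norm z0)|rewrite (ltr0_norm z0)]; nra.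
  have H1 := DE2 (U y) (W y) (potential y / k).
  have H2 : `|potential y / k| <= `|potential y|.
    rewrite normrM normfV (gtr0_norm k_gt0) ler_piMr// invf_le1//.
  have H3 : 2 * h y * (U y ^+ 2 - W y ^+ 2) <= 2 * `|h y| * (U y ^+ 2 + W y ^+ 2).
    have := sqr_ge0 (U y); have := sqr_ge0 (W y).
    by have [z0|z0] := leP 0 (h y); [rewrite (ger0_norm z0)|rewrite (ltr0_norm z0)];
        nra.
  have H4 : `|potential y / k| * (U y ^+ 2 + W y ^+ 2) <= `|potential y| *
      (U y ^+ 2 + W y ^+ 2).
    by rewrite ler_wpM2r// addr_ge0// sqr_ge0.
  by rewrite /m; lra.
have gE : expR (I[a, x] m) <= gro.
  by rewrite ler_expR (I_chasles mi ax xb) lerDl; exact: I_ge0.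
have g1 : 1 <= gro by rewrite -expR0 ler_expR; exact: I_ge0.
have E00 : 0 <= E0 by rewrite addr_ge0.
have H2 : U a * U a + W a * W a <= E0 ^+ 2.
  rewrite -!expr2 -(real_normK (num_real (U a))) -(real_normK (num_real (W a))) /E0.
  have := normr_ge0 (U a); have := normr_ge0 (W a); nra.
have H3 : U x * U x + W x * W x <= (gro * E0) ^+ 2.
  apply: le_trans H _; apply: (@le_trans _ _ (E0 ^+ 2 * gro)).
    apply: ler_pM H2 gE; last exact: expR_ge0.
    by rewrite -!expr2 addr_ge0 ?sqr_ge0.
  by rewrite exprMn mulrC ler_wpM2r ?sqr_ge0// expr2 ler_peMl// (le_trans ler01).
have gE0 : 0 <= gro * E0 by rewrite mulr_ge0// (le_trans ler01).
split; rewrite -ler_sqr ?nnegrE// real_normK ?num_real//;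
  [have := sqr_ge0 (W x)|have := sqr_ge0 (U x)]; lra.
Qed.

Let P x := I[a, x] p.
Let c x := cos (k * P x).
Let s x := sin (k * P x).

Let c_ac : ac_on a b c (fun x => - (k * p x * s x)).
Proof.
apply: eq_ac_on (ac_on_cos (ac_onZ k liouville_p_ac)) => // x _.
by rewrite /s; ring.
Qed.

Let s_ac : ac_on a b s (fun x => k * p x * c x).
Proof.
apply: eq_ac_on (ac_on_sin (ac_onZ k liouville_p_ac)) => // x _.
by rewrite /c; ring.
Qed.

(** Coordinates of (U, W) in the frame turning at speed k p: they would be constant if [h] and
    [potential] vanished. *)
Let X x := U x * c x - W x * s x.
Let Y x := U x * s x + W x * c x.

(* The oscillating terms h (U c + W s) in X' and h (U s - W c) in Y' are, up to
   O(1/k), the derivatives of the corrections added here. *)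
Let Xc x := X x - k^-1 * (kap x * (U x * s x - W x * c x)).
Let Yc x := Y x + k^-1 * (kap x * (U x * c x + W x * s x)).

(** U s - W c turns at the doubled speed: its derivative contains 2 k p (U c + W s). Since h = 2 p
    kap, the correction removes exactly the term of order 1, and all other terms carry [k^-1]. *)
Let Xc_ac : ac_on a b Xc (fun x => k^-1 * (- (potential x * (U x * s x))
  - kap' x * (U x * s x - W x * c x) - kap x * h x * (U x * s x + W x * c x)
  + kap x * potential x / k * (U x * c x))).
Proof.
have HU := liouville_U_ac; have HW := liouville_W_ac.
have Hk := liouville_kap_ac L.
apply: eq_ac_on (ac_onB (ac_onB (ac_onM HU c_ac) (ac_onM HW s_ac))
  (ac_onZ k^-1 (ac_onM Hk (ac_onB (ac_onM HU s_ac) (ac_onM HW c_ac))))) => // x xab.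
by rewrite (liouville_kap L xab); field; rewrite gt_eqF.
Qed.

Let Yc_ac : ac_on a b Yc (fun x => k^-1 * (potential x * (U x * c x)
  + kap' x * (U x * c x + W x * s x) + kap x * h x * (U x * c x - W x * s x)
  + kap x * potential x / k * (U x * s x))).
Proof.
have HU := liouville_U_ac; have HW := liouville_W_ac.
have Hk := liouville_kap_ac L.
apply: eq_ac_on (ac_onD (ac_onD (ac_onM HU s_ac) (ac_onM HW c_ac))
  (ac_onZ k^-1 (ac_onM Hk (ac_onD (ac_onM HU c_ac) (ac_onM HW s_ac))))) => // x xab.
by rewrite (liouville_kap L xab); field; rewrite gt_eqF.
Qed.

Let S := gro * E0.
Let G x := `|potential x| + 2 * `|kap' x| + 2 * `|kap x * h x| + `|kap x * potential x|.

Let osc_bound (A B : R -> R) x : a <= x <= b -> `|A x| <= 1 -> `|B x| <= 1 ->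
  `|U x * A x + W x * B x| <= 2 * S /\ `|U x * A x| <= S.
Proof.
move=> xab A1 B1; have [HU HW] := liouville_energy xab.
have S0 : 0 <= S by apply: le_trans HU.
have HA : `|U x * A x| <= S.
  by rewrite normrM -[leRHS]mulr1; apply: ler_pM.
have HB : `|W x * B x| <= S.
  by rewrite normrM -[leRHS]mulr1; apply: ler_pM.
by split => //; apply: le_trans (ler_normD _ _) _; lra.
Qed.

Let rhs_bound (x A B C D : R) : `|A| <= S -> `|B| <= 2 * S -> `|C| <= 2 * S ->
  `|D| <= S ->
  `|k^-1 * (potential x * A + kap' x * B + kap x * h x * C
     + kap x * potential x / k * D)| <= k^-1 * S * G x.
Proof.
move=> HA HB HC HD.
have ki0 : 0 <= k^-1 by rewrite invr_ge0 ltW.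
rewrite normrM (ger0_norm ki0) -[leRHS]mulrA ler_wpM2l//.
have aux (z t m : R) : `|t| <= m -> `|z * t| <= `|z| * m.
  by move=> tm; rewrite normrM ler_wpM2l.
have H1 := aux (potential x) _ _ HA; have H2 := aux (kap' x) _ _ HB.
have H3 := aux (kap x * h x) _ _ HC.
have H4 : `|kap x * potential x / k * D| <= `|kap x * potential x| * S.
  apply: le_trans (aux _ _ _ HD) _.
  rewrite ler_wpM2r ?(le_trans (normr_ge0 D))//.
  by rewrite [leLHS]normrM normfV (gtr0_norm k_gt0) ler_piMr// invf_le1.
apply: le_trans (ler_normD _ _) _; apply: le_trans (lerD (ler_normD _ _) (lexx _)) _.
apply: le_trans (lerD (lerD (ler_normD _ _) (lexx _)) (lexx _)) _.
rewrite /G; lra.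
Qed.

Let G_L1 : L1on a b G.
Proof.
have ck := ac_on_continuous ab (liouville_kap_ac L).
have hi := L1on_continuous (liouville_h_cont L).
have pi' := potential_L1.
apply: L1onD; last by apply: L1on_norm; exact: L1onMC.
apply: L1onD; last by apply: L1onZ; apply: L1on_norm; exact: L1onMC.
apply: L1onD; first exact: L1on_norm.
by apply: L1onZ; apply: L1on_norm; exact: (liouville_kap_ac L).1.
Qed.

Let incr_bound (f f' : R -> R) x : a <= x <= b -> ac_on a b f f' ->
  (forall y, a <= y <= b -> `|f' y| <= k^-1 * S * G y) ->
  `|f x - f a| <= k^-1 * S * I[a, b] G.
Proof.
move=> /andP[ax xb] Hf f'le.
rewrite (ac_onW Hf (lexx a) ax xb) addrAC subrr add0r.
have S0 : 0 <= k^-1 * S.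
  have [HU _] : `|U a| <= S /\ `|W a| <= S by apply: liouville_energy; rewrite lexx.
  by rewrite mulr_ge0 ?invr_ge0 ?(ltW k_gt0)// (le_trans _ HU).
apply: (@le_trans _ _ (k^-1 * S * I[a, x] G)); last first.
  rewrite ler_wpM2l// (I_chasles G_L1 ax xb) lerDl; apply: I_ge0 => t _.
  by rewrite /G !addr_ge0// mulr_ge0.
rewrite -I_Z; last exact: L1on_sub G_L1 _ _.
apply: norm_I_le_dom.
- exact: L1on_sub Hf.1 _ _.
- by apply: L1onZ; exact: L1on_sub G_L1 _ _.
by move=> t /andP[at_ tx]; apply: f'le; rewrite at_ (le_trans tx xb).
Qed.

(** The corrected coordinates move by at most the integral of their O(1/k) derivative. The summand
    [4 * K] pays for undoing the correction, at [x] and at [a]. *)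
Lemma phase_increment_le (K : R) x : a <= x <= b ->
  (forall y, a <= y <= b -> `|kap y| <= K) ->
  `|X x - U a| <= k^-1 * S * (I[a, b] G + 4 * K) /\
  `|Y x - W a| <= k^-1 * S * (I[a, b] G + 4 * K).
Proof.
move=> xab kK.
have aab : a <= a <= b by rewrite lexx.
have c1 y : `|c y| <= 1 by rewrite ler_norml cos_geN1 cos_le1.
have s1 y : `|s y| <= 1 by rewrite ler_norml sin_geN1 sin_le1.
have nc1 y : `|- c y| <= 1 by rewrite normrN.
have ns1 y : `|- s y| <= 1 by rewrite normrN.
have Pa : P a = 0 by rewrite /P I_itv1.
have Xa : X a = U a by rewrite /X /c /s Pa mulr0 cos0 sin0; ring.
have Ya : Y a = W a by rewrite /Y /c /s Pa mulr0 cos0 sin0; ring.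
have ki0 : 0 <= k^-1 by rewrite invr_ge0 ltW.
have corr y A B : a <= y <= b -> `|U y * A + W y * B| <= 2 * S ->
    `|k^-1 * (kap y * (U y * A + W y * B))| <= k^-1 * S * (2 * K).
  move=> yab H; rewrite normrM (ger0_norm ki0) -[leRHS]mulrA ler_wpM2l// normrM.
  have -> : S * (2 * K) = K * (2 * S) by ring.
  by apply: ler_pM => //; exact: kK.
have b1 y (yab : a <= y <= b) : `|U y * s y + W y * (- c y)| <= 2 * S.
  exact: (@osc_bound s (fun y => - c y) y yab (s1 y) (nc1 y)).1.
have b2 y (yab : a <= y <= b) : `|U y * c y + W y * s y| <= 2 * S.
  exact: (@osc_bound c s y yab (c1 y) (s1 y)).1.
have b3 y (yab : a <= y <= b) : `|U y * s y + W y * c y| <= 2 * S.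
  exact: (@osc_bound s c y yab (s1 y) (c1 y)).1.
have b4 y (yab : a <= y <= b) : `|U y * c y + W y * (- s y)| <= 2 * S.
  exact: (@osc_bound c (fun y => - s y) y yab (c1 y) (ns1 y)).1.
have b5 y (yab : a <= y <= b) : `|U y * s y| <= S.
  exact: (@osc_bound s s y yab (s1 y) (s1 y)).2.
have b6 y (yab : a <= y <= b) : `|U y * c y| <= S.
  exact: (@osc_bound c c y yab (c1 y) (c1 y)).2.
have HX : `|Xc x - Xc a| <= k^-1 * S * I[a, b] G.
  apply: (incr_bound xab Xc_ac) => y yab.
  have -> : - (potential y * (U y * s y)) - kap' y * (U y * s y - W y * c y) -
     kap y * h y * (U y * s y + W y * c y) + kap y * potential y / k * (U y * c y) =
     potential y * (- (U y * s y)) + kap' y * (- (U y * s y + W y * - c y)) +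
     kap y * h y * (- (U y * s y + W y * c y)) + kap y * potential y / k * (U y * c y)
         by ring.
  by apply: rhs_bound; rewrite ?normrN; [exact: b5|exact: b1|exact: b3|exact: b6].
have HY : `|Yc x - Yc a| <= k^-1 * S * I[a, b] G.
  apply: (incr_bound xab Yc_ac) => y yab.
  rewrite -[U y * c y - W y * s y]/(U y * c y + - (W y * s y)) -mulrN.
  by apply: rhs_bound; [exact: b6|exact: b2|exact: b4|exact: b5].
have HX1 y (yab : a <= y <= b) : `|X y - Xc y| <= k^-1 * S * (2 * K).
  have -> : X y - Xc y = k^-1 * (kap y * (U y * s y + W y * - c y))
      by rewrite /Xc; ring.
  by apply: corr => //; exact: b1.
have HY1 y (yab : a <= y <= b) : `|Y y - Yc y| <= k^-1 * S * (2 * K).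
  have -> : Y y - Yc y = - (k^-1 * (kap y * (U y * c y + W y * s y)))
      by rewrite /Yc; ring.
  by rewrite normrN; apply: corr => //; exact: b2.
have -> : k^-1 * S * (I[a, b] G + 4 * K) =
  k^-1 * S * I[a, b] G + 2 * (k^-1 * S * (2 * K)) by ring.
rewrite -Xa -Ya; split.
  exact: dist_chain (HX1 _ xab) (HX1 _ aab) HX.
exact: dist_chain (HY1 _ xab) (HY1 _ aab) HY.
Qed.

End Solution.

Lemma phase_asymptotics : exists2 C, 0 <= C & forall k u w, 1 <= k ->
  SL_sol a b sigma rho q (k ^+ 2) u w -> forall x, a <= x <= b ->
  let U x := k * r x * u x in let W x := w x / r x in
  let t := k * I[a, x] p in let E := C / k * (`|U a| + `|W a|) in
  `|U x * cos t - W x * sin t - U a| <= E /\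
  `|U x * sin t + W x * cos t - W a| <= E.
Proof.
have [K K0 kK] := within_continuous_bounded (ac_on_continuous ab (liouville_kap_ac L)).
pose e := expR (I[a, b] (fun x => 2 * `|h x| + `|potential x|)).
pose g := I[a, b] (fun x => `|potential x| + 2 * `|kap' x| + 2 * `|kap x * h x| +
  `|kap x * potential x|).
exists (e * (g + 4 * K)).
  rewrite mulr_ge0 ?expR_ge0// addr_ge0//; last by rewrite mulr_ge0// ltW.
  by apply: I_ge0 => t _; rewrite !addr_ge0// mulr_ge0.
move=> k u w k1 sol x xab /=.
have := phase_increment_le k1 sol xab kK.
rewrite -/e -/g; set n := `|_| + `|_|.
by have -> : k^-1 * (e * n) * (g + 4 * K) = e * (g + 4 * K) / k * n by ring.
Qed.

Lemma liouville_green : exists2 C, 0 <= C & forall k u w, 1 <= k ->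
  SL_sol a b sigma rho q (k ^+ 2) u w -> forall x, a <= x <= b ->
  let U x := k * r x * u x in let W x := w x / r x in
  let t := k * I[a, x] p in let E := C / k * (`|U a| + `|W a|) in
  `|U x - (U a * cos t + W a * sin t)| <= E /\
  `|W x - (W a * cos t - U a * sin t)| <= E.
Proof.
have [C C0 HC] := phase_asymptotics; exists (2 * C); first by rewrite mulr_ge0.
move=> k u w k1 sol x xab /=; have [] := HC k u w k1 sol x xab.
set t := k * I[a, x] p; set U := k * r x * u x; set W := w x / r x.
set U0 := k * r a * u a; set W0 := w a / r a; set E := C / k * _ => H1 H2.
have -> : 2 * C / k * (`|U0| + `|W0|) = E + E by rewrite /E; ring.
have cs := cos2Dsin2 t.
have c1 : `|cos t| <= 1 by rewrite ler_norml cos_geN1 cos_le1.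
have s1 : `|sin t| <= 1 by rewrite ler_norml sin_geN1 sin_le1.
have aux (z y : R) : `|z| <= 1 -> `|y| <= E -> `|y * z| <= E.
  by move=> z1 yE; rewrite normrM -[leRHS]mulr1; apply: ler_pM.
have -> : U - (U0 * cos t + W0 * sin t) =
  (U * cos t - W * sin t - U0) * cos t + (U * sin t + W * cos t - W0) * sin t.
  by rewrite -[U in LHS]mulr1 -cs; ring.
have -> : W - (W0 * cos t - U0 * sin t) =
  (U * sin t + W * cos t - W0) * cos t - (U * cos t - W * sin t - U0) * sin t.
  by rewrite -[W in LHS]mulr1 -cs; ring.
split; [apply: le_trans (ler_normD _ _) _|apply: le_trans (ler_normB _ _) _];
  apply: lerD; exact: aux.
Qed.

(** The reference point is a zero [e] of [u] instead of the left end, so that the right-hand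
    interval can be treated from its Dirichlet end 1. The error is relative to the single amplitude
    [W e]. *)
Lemma liouville_green_dirichlet : exists K C, [/\ 1 <= K, 0 <= C & forall k u w e, K
    <= k ->
  SL_sol a b sigma rho q (k ^+ 2) u w -> a <= e <= b -> u e = 0 ->
  forall x, a <= x <= b ->
  let W x := w x / r x in
  let t := k * (I[a, x] p - I[a, e] p) in let E := C / k * `|W e| in
  `|k * r x * u x - W e * sin t| <= E /\ `|W x - W e * cos t| <= E].
Proof.
(* Beyond 4 C + 1 the error [E] is at most a quarter of |U0| + |W0|. Since each of |U0|, |W0| is at
   most |We| + E, their sum is at most 4 |We|, so E <= 4 C / k |We|; four errors of size [E] add up
   in the end. *)
have [C C0 HC] := phase_asymptotics; exists (4 * C + 1), (16 * C).
split; [lra|lra|].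
move=> k u w e Kk sol eab ue x xab /=.
have k1 : 1 <= k by lra.
have k0 : 0 < k by lra.
have [] := HC k u w k1 sol x xab; have [] := HC k u w k1 sol e eab.
rewrite ue mulr0 !mul0r sub0r add0r.
set t := k * I[a, x] p; set te := k * I[a, e] p.
have -> : k * (I[a, x] p - I[a, e] p) = t - te by rewrite /t /te; ring.
set U := k * r x * u x; set W := w x / r x; set We := w e / r e.
set U0 := k * r a * u a; set W0 := w a / r a; set E := C / k * _ => H1 H2 H3 H4.
have c1 (z : R) : `|cos z| <= 1 by rewrite ler_norml cos_geN1 cos_le1.
have s1 (z : R) : `|sin z| <= 1 by rewrite ler_norml sin_geN1 sin_le1.
have E4 : E <= (`|U0| + `|W0|) / 4.
  rewrite /E mulrC ler_wpM2l ?addr_ge0// ler_pdivrMr//; lra.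
have le1 (z y m : R) : `|z| <= 1 -> `|y| <= m -> `|y * z| <= m.
  by move=> z1 yE; rewrite normrM -[leRHS]mulr1; apply: ler_pM.
have h1 := le1 _ _ _ (s1 te) (lexx `|We|); have h2 := le1 _ _ _ (c1 te) (lexx `|We|).
have U0le : `|U0| <= `|We| + E.
  have := ler_normB (- (We * sin te)) (- (We * sin te) - U0).
  by rewrite opprB addrCA subrr addr0 normrN => h'; lra.
have W0le : `|W0| <= `|We| + E.
  have := ler_normB (We * cos te) (We * cos te - W0).
  by rewrite opprB addrCA subrr addr0 => h'; lra.
have EE : E <= 4 * C / k * `|We|.
  have -> : 4 * C / k * `|We| = C / k * (4 * `|We|) by ring.
  by rewrite /E ler_wpM2l ?divr_ge0 ?(ltW k0)//; lra.
have -> : 16 * C / k * `|We| = 4 * (4 * C / k * `|We|) by ring.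
have cs := cos2Dsin2 t.
have HX : `|U * cos t - W * sin t + We * sin te| <= 2 * E.
  have -> : U * cos t - W * sin t + We * sin te = (U * cos t - W * sin t - U0) -
      (- (We * sin te) - U0) by ring.
  by apply: le_trans (ler_normB _ _) _; lra.
have HY : `|U * sin t + W * cos t - We * cos te| <= 2 * E.
  have -> : U * sin t + W * cos t - We * cos te = (U * sin t + W * cos t - W0) -
      (We * cos te - W0) by ring.
  by apply: le_trans (ler_normB _ _) _; lra.
have -> : U - We * sin (t - te) = (U * cos t - W * sin t + We * sin te) * cos t +
   (U * sin t + W * cos t - We * cos te) * sin t.
  by rewrite sinB -[U in LHS]mulr1 -cs; ring.
have -> : W - We * cos (t - te) = (U * sin t + W * cos t - We * cos te) * cos t -
   (U * cos t - W * sin t + We * sin te) * sin t.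
  by rewrite cosB -[W in LHS]mulr1 -cs; ring.
have hh1 := le1 _ _ _ (c1 t) HX; have hh2 := le1 _ _ _ (s1 t) HX.
have hh3 := le1 _ _ _ (c1 t) HY; have hh4 := le1 _ _ _ (s1 t) HY.
split; [apply: le_trans (ler_normD _ _) _|apply: le_trans (ler_normB _ _) _]; lra.
Qed.

End Asymptotics.
End LiouvilleGreen.

(** * Zeros of continuous functions and Diophantine approximation *)

Section RealLemmas.
Variable R : realType.
Implicit Types (l r x y : R) (f : R -> R).

(** The point is the supremum of { f <= 0 }: continuity gives f <= 0 there, and a negative value
    would produce a further zero to its right. *)
Lemma last_zero l r f : l < r -> {within `[l, r], continuous f}%classic ->
  f l < 0 -> 0 < f r ->
  exists p, [/\ l <= p, p < r, f p = 0 & forall x, p < x <= r -> 0 < f x].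
Proof.
move=> lr cf fl fr.
pose A := [set x | l <= x <= r /\ f x <= 0]%classic.
have Al : A l by rewrite /A /=; split; [rewrite lexx ltW|exact: ltW].
have ubA : ubound A r by move=> x [/andP[]].
have supA : has_sup A by split; [exists l|exists r].
set p := sup A.
have lp : l <= p by apply: ub_le_sup Al; exact: supA.2.
have pr : p <= r by apply: ge_sup => //; exact: supA.1.
have pos x : p < x <= r -> 0 < f x.
  move=> /andP[px xr]; rewrite ltNge; apply/negP => fx.
  have Ax : A x by split => //; rewrite (le_trans lp (ltW px)).
  have : x <= p by apply: ub_le_sup Ax; exact: supA.2.
  by rewrite leNgt px.
have fp0 : f p <= 0.
  rewrite leNgt; apply/negP => fp.
  have /subspace_continuousP/(_ p) cp := cf.
  have plr : (`[l, r]%classic) p by rewrite /= in_itv /= lp.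
  have /cvgrPdist_lt/(_ _ fp) := cp plr.
  rewrite near_withinE => -[d /= d0 dP].
  have [x [/andP[lx xr] fx]] : exists2 x, A x & p - d < x.
    by apply: sup_adherent.
  move=> px.
  have xp : x <= p by apply: ub_le_sup; [exact: supA.2|split => //; rewrite lx].
  have : `|f p - f x| < f p.
    apply: dP; last by rewrite in_itv /= lx.
    by rewrite /ball /= ger0_norm ?subr_ge0//; lra.
  by rewrite ltNge; apply/negP; rewrite negbK ger0_norm; lra.
have pltr : p < r.
  by rewrite lt_neqAle pr andbT; apply/eqP => E; move: fp0; rewrite E leNgt fr.
exists p; split => //; apply/eqP; rewrite eq_le fp0 /= leNgt; apply/negP => fp.
have cf' : {within `[p, r], continuous f}%classic.
  by apply: continuous_subspaceW cf; apply: subset_itv; rewrite bnd_simp.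
have [|z] := @IVT R f p r 0 pr cf'.
  by rewrite ge_min fp0 /= le_max (ltW fr) orbT.
rewrite in_itv /= => /andP[pz zr] fz.
have : 0 < f z.
  apply: pos; rewrite zr andbT lt_neqAle pz andbT.
  by apply/eqP => E; move: fp; rewrite E fz ltxx.
by rewrite fz ltxx.
Qed.

Lemma IVT0 l r f : l <= r -> {within `[l, r], continuous f}%classic ->
  f l * f r <= 0 -> exists2 x, l <= x <= r & f x = 0.
Proof.
move=> lr cf flr; have [|z] := @IVT R f l r 0 lr cf.
  rewrite ge_min le_max; have [fl|fl] := leP (f l) 0; have [fr|fr] :=
      leP (f r) 0 => //=.
  - have [->|] := eqVneq (f l) 0; first by rewrite lexx.
    by move=> fln; have : f l < 0 by [rewrite lt_neqAle fln]; nra.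
  - by rewrite (ltW fr) orbT.
  - by rewrite (ltW fl).
  - by nra.
by rewrite in_itv /= => zlr fz; exists z.
Qed.

(** At [p2] only a s1 c2 >= 0 survives, so [G] has a zero in [l, p2]. It may be [p2] itself when p1
    = p2, so a point with G > 0 is needed strictly to the right. Write G = s1 H + b c1 s2 with H = a
    c2 - m s2: right of [p2], H > 0 forces G > 0. As G r < 0, [H] falls from H p2 > 0 to a value <=
    0, and the point where it equals half of [H p2] separates the two zeros. *)
Lemma two_zeros_ordered l r a b p1 p2 (s1 s2 c1 c2 m : R -> R) :
  {within `[l, r], continuous (fun k => a * c2 k - m k * s2 k)}%classic ->
  let G k := a * s1 k * c2 k + b * c1 k * s2 k - m k * s1 k * s2 k in
  {within `[l, r], continuous G}%classic ->
  0 < a -> 0 < b ->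
  (forall k, l <= k <= r -> 0 < c1 k /\ 0 < c2 k) ->
  G l < 0 -> G r < 0 ->
  s1 p1 = 0 -> (forall x, p1 < x <= r -> 0 < s1 x) ->
  l <= p2 -> p2 < r -> s2 p2 = 0 -> (forall x, p2 < x <= r -> 0 < s2 x) ->
  p1 <= p2 ->
  exists x y, [/\ l <= x, x < y, y <= r, G x = 0 & G y = 0].
Proof.
move=> cH1 G cG a0 b0 c0 Gl Gr s1p1 s1pos lp2 p2r s2p2 s2pos p12.
have [c1p c2p] : 0 < c1 p2 /\ 0 < c2 p2 by apply: c0; rewrite lp2 ltW.
have s1p2 : 0 <= s1 p2.
  have [E|p12'] := eqVneq p1 p2; first by rewrite -E s1p1.
  by apply/ltW/s1pos; rewrite lt_neqAle p12' p12 ltW.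
have Gp2 : 0 <= G p2.
  by rewrite /G s2p2 !mulr0 addr0 subr0 !mulr_ge0// ltW.
have sub x y : l <= x -> y <= r -> forall f, {within `[l, r], continuous f}%classic ->
    {within `[x, y], continuous f}%classic.
  move=> lx yr f cf.
  by apply: continuous_subspaceW cf; apply: subset_itv; rewrite bnd_simp.
have [x /andP[lx xp] Gx] : exists2 x, l <= x <= p2 & G x = 0.
  by apply: IVT0 => //; [apply: sub => //; exact: ltW|nra].
pose H k := a * c2 k - m k * s2 k.
have Hp2 : 0 < H p2 by rewrite /H s2p2 mulr0 subr0 mulr_gt0.
have GH k : p2 < k <= r -> 0 < H k -> 0 < G k.
  move=> /andP[pk kr] Hk.
  have h1 : 0 < s1 k by apply: s1pos; rewrite (le_lt_trans p12 pk).
  have h2 : 0 < s2 k by apply: s2pos; rewrite pk.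
  have [h3 h4] : 0 < c1 k /\ 0 < c2 k by apply: c0; rewrite kr (le_trans lp2)// ltW.
  have -> : G k = s1 k * H k + b * c1 k * s2 k by rewrite /G /H; ring.
  by rewrite addr_gt0// !mulr_gt0.
have Hr : H r <= 0.
  rewrite leNgt; apply/negP => Hr; have := GH r; rewrite p2r lexx => /(_ isT Hr).
  by rewrite ltNge (ltW Gr).
have [|z] := @IVT R H p2 r (H p2 / 2) (ltW p2r) (sub _ _ lp2 (lexx r) _ cH1).
  have -> : Num.min (H p2) (H r) = H r by apply/min_idPr; lra.
  have -> : Num.max (H p2) (H r) = H p2 by apply/max_idPl; lra.
  by apply/andP; split; lra.
rewrite in_itv /= => /andP[pz zr] Hz.
have pz' : p2 < z.
  rewrite lt_neqAle pz andbT; apply/eqP => E; move: Hz; rewrite -E => Hz; lra.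
have Gz : 0 < G z by apply: GH; [rewrite pz'|rewrite Hz; lra].
have [y /andP[zy yr] Gy] : exists2 y, z <= y <= r & G y = 0.
  apply: IVT0 => //; last by nra.
  by apply: sub => //; exact: le_trans pz.
exists x, y; split => //; first exact: le_lt_trans (lt_le_trans pz' zy).
Qed.

Lemma two_zeros l r a b (s1 s2 c1 c2 m : R -> R) : l < r ->
  {within `[l, r], continuous s1}%classic -> {within `[l, r], continuous s2}%classic ->
  {within `[l, r], continuous (fun k => a * c2 k - m k * s2 k)}%classic ->
  {within `[l, r], continuous (fun k => b * c1 k - m k * s1 k)}%classic ->
  let G k := a * s1 k * c2 k + b * c1 k * s2 k - m k * s1 k * s2 k in
  {within `[l, r], continuous G}%classic ->
  0 < a -> 0 < b ->
  (forall k, l <= k <= r -> 0 < c1 k /\ 0 < c2 k) ->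
  s1 l < 0 -> s2 l < 0 -> 0 < s1 r -> 0 < s2 r -> G l < 0 -> G r < 0 ->
  exists x y, [/\ l <= x, x < y, y <= r, G x = 0 & G y = 0].
Proof.
move=> lr cs1 cs2 cH1 cH2 G cG a0 b0 c0 s1l s2l s1r s2r Gl Gr.
have [p1 [lp1 p1r s1p1 s1pos]] := last_zero lr cs1 s1l s1r.
have [p2 [lp2 p2r s2p2 s2pos]] := last_zero lr cs2 s2l s2r.
have [p12|p21] := leP p1 p2; first exact: (@two_zeros_ordered l r a b p1 p2).
have GE k : b * s2 k * c1 k + a * c2 k * s1 k - m k * s2 k * s1 k = G k
    by rewrite /G; ring.
have [|||k /c0[]||||||||||x [y]] // := @two_zeros_ordered l r b a p2 p1 s2 s1 c2 c1 m
    cH2.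
- by rewrite (funext GE).
- by rewrite GE.
- by rewrite GE.
- exact: ltW.
by rewrite !GE => H; exists x, y.
Qed.

(* Pigeonhole on the fractional parts of j * L * alpha, 0 <= j <= N. *)
Lemma simultaneous_approx (alpha eta : R) (L : nat) : 0 < alpha -> 0 < eta
    -> (0 < L)%N ->
  exists n m : nat, (L <= n)%N /\ `|n%:R * alpha - m%:R| <= eta.
Proof.
move=> al0 eta0 L0.
have [N nP] : exists N : nat, eta^-1 < N%:R.
  have := archi_boundP (normr_ge0 (eta^-1)).
  by move=> H; eexists; apply: le_lt_trans (ler_norm _) H.
have N0 : (0 < N)%N by rewrite -(ltr_nat R) (lt_trans _ nP)// invr_gt0.
pose t (j : nat) : R := j%:R * L%:R * alpha.
have t0 j : 0 <= t j by rewrite /t !mulr_ge0// ltW.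
pose fr j := t j - (Num.truncn (t j))%:R.
have fr01 j : 0 <= fr j < 1.
  have /andP[h1 h2] := truncn_itv (t0 j).
  rewrite /fr; rewrite -natr1 in h2; apply/andP; split; lra.
have boxlt j : (Num.truncn (fr j * N%:R) < N)%N.
  have /andP[h1 h2] := fr01 j.
  have f0 : 0 <= fr j * N%:R by rewrite mulr_ge0.
  have /andP[h3 h4] := truncn_itv f0.
  rewrite -(ltr_nat R); apply: le_lt_trans h3 _.
  by rewrite gtr_pMl ?ltr0n.
pose box (j : 'I_N.+1) : 'I_N := Ordinal (boxlt j).
have : ~~ injectiveb box.
  apply/negP => /injectiveP /leq_card; rewrite !card_ord; by rewrite ltnn.
case/injectivePn => i [j ij bij].
wlog lij : i j ij bij / (i < j)%N.
  move=> W; have [lt|gt|E] := ltngtP i j.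
  - exact: (W i j).
  - by apply: (W j i) => //; rewrite eq_sym.
  - by move: ij; rewrite -(inj_eq val_inj) /= E eqxx.
have frd : `|fr j - fr i| <= eta.
  have bE : Num.truncn (fr i * N%:R) = Num.truncn (fr j * N%:R)
      by move: bij => /(congr1 val).
  have fi0 : 0 <= fr i * N%:R by rewrite mulr_ge0//; case/andP: (fr01 i).
  have fj0 : 0 <= fr j * N%:R by rewrite mulr_ge0//; case/andP: (fr01 j).
  have /andP[h1 h2] := truncn_itv fi0; have /andP[h3 h4] := truncn_itv fj0.
  rewrite bE in h1 h2; rewrite -natr1 in h2 h4.
  have NR : 0 < (N%:R : R) by rewrite ltr0n.
  have H : `|fr j - fr i| * N%:R <= 1.
    rewrite -(ger0_norm (ltW NR)) -normrM ler_norml mulrBl; apply/andP; split; lra.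
  have H1 : 1 <= eta * N%:R.
    by rewrite mulrC -ler_pdivrMr// mul1r ltW.
  by rewrite -(ler_pM2r NR) (le_trans H).
have tij : (Num.truncn (t i) <= Num.truncn (t j))%N.
  apply: le_truncn; rewrite /t -!mulrA ler_wpM2r ?mulr_ge0//; first exact: ltW.
  by rewrite ler_nat ltnW.
exists ((j - i) * L)%N, (Num.truncn (t j) - Num.truncn (t i))%N; split.
  by rewrite leq_pmull// subn_gt0.
rewrite natrM !natrB//; last exact: ltnW.
have -> : (j%:R - i%:R) * L%:R * alpha - ((Num.truncn (t j))%:R -
    (Num.truncn (t i))%:R) =
  fr j - fr i by rewrite /fr /t; ring.
exact: frd.
Qed.

End RealLemmas.

(** * Close zeros from sine and cosine asymptotics *)

Section AsymptoticZeros.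
Variable R : realType.

Lemma trig_window (theta x : R) (n : nat) : theta = x + (pi *+ 2) *+ n
    -> `|x| <= 2^-1 ->
  [/\ 2^-1 <= cos theta, 0 <= x -> x / 2 <= sin theta & x <= 0 -> sin theta <= x / 2].
Proof.
move=> -> x1; rewrite (periodicn (@cosD2pi R)) (periodicn (@sinD2pi R)).
have cosge (z : R) : `|z| <= 2^-1 -> 2^-1 <= cos z.
  move=> z1; have := cos_lip z 0; rewrite cos0 subr0 ler_norml => /andP[h _]; lra.
have [c [E cx _]] := MVT_between 0 x (@is_derive_sin R).
rewrite sin0 !subr0 in E cx; have cc := cosge c (le_trans cx x1).
by split; [exact: cosge|move=> x0; rewrite E; nra|move=> x0; rewrite E; nra].
Qed.

Lemma trig_approx_window (theta x s c e d : R) (n : nat) :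
  theta = x + (pi *+ 2) *+ n -> `|x| <= 2^-1 -> 0 <= e -> e <= d / 4 -> d <= 2^-1 ->
  `|s - sin theta| <= e -> `|c - cos theta| <= e ->
  [/\ 0 < c, `|s| <= 3 / 2 /\ `|c| <= 3 / 2, d <= x -> d / 4 <= s & x <= - d
      -> s <= - (d / 4)].
Proof.
move=> tE x1 e0 ed d1 se ce; have [h1 h2 h3] := trig_window tE x1.
have := sin_geN1 theta; have := sin_le1 theta; have := cos_le1 theta.
move: se ce; rewrite !ler_norml => /andP[? ?] /andP[? ?] ? ? ?.
split; first lra.
- by split; apply/andP; split; lra.
- by move=> dx; have := h2 _; lra.
- by move=> dx; have := h3 _; lra.
Qed.

(** The first two terms are at most A and B times 9 / 4 = (3 / 2)^2, and the third outweighs them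
    once s1 s2 is bounded below and [m] is large. *)
Lemma quadratic_form_lt0 (A B m t s1 s2 c1 c2 : R) : 0 < A -> 0 < B -> 0 < m ->
  `|s1| <= 3 / 2 /\ `|c1| <= 3 / 2 -> `|s2| <= 3 / 2 /\ `|c2| <= 3 / 2 ->
  t <= s1 * s2 -> (A + B) * (9 / 4) < m * t ->
  A * s1 * c2 + B * c1 * s2 - m * s1 * s2 < 0.
Proof.
move=> A0 B0 m0 [b1 b3] [b2 b4] ts mt.
have pr (z y : R) : `|z| <= 3 / 2 -> `|y| <= 3 / 2 -> z * y <= 9 / 4.
  move=> h1 h2; apply: le_trans (ler_norm _) _; rewrite normrM.
  have -> : 9 / 4 = 3 / 2 * (3 / 2) :> R by field.
  exact: ler_pM.
have h1 : A * (s1 * c2) <= A * (9 / 4) by rewrite ler_wpM2l ?pr// ltW.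
have h2 : B * (c1 * s2) <= B * (9 / 4) by rewrite ler_wpM2l ?pr// ltW.
have h3 : m * t <= m * (s1 * s2) by rewrite ler_wpM2l// ltW.
rewrite -!mulrA; lra.
Qed.

Lemma two_zeros_asymptotic (g1 g2 A B M C : R) (s1 s2 c1 c2 : R -> R) :
  0 < g1 -> 0 < g2 -> 0 < A -> 0 < B -> 0 < M -> 0 <= C ->
  continuous s1 -> continuous s2 -> continuous c1 -> continuous c2 ->
  (forall k, 1 <= k -> [/\ `|s1 k - sin (k * g1)| <= C / k, `|s2 k - sin (k * g2)| <=
      C / k,
     `|c1 k - cos (k * g1)| <= C / k & `|c2 k - cos (k * g2)| <= C / k]) ->
  let G k := A * s1 k * c2 k + B * c1 k * s2 k - k * M * s1 k * s2 k in
  forall eps K, 0 < eps -> exists x y, [/\ K <= x, 1 <= x, x < y, y - x <= eps &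
    G x = 0 /\ G y = 0].
Proof.
move=> g10 g20 A0 B0 M0 C0 cs1 cs2 cc1 cc2 asy G eps K eps0.
(* [tau] is the half-width of the window. Both phases must stay within 1/2 of a multiple of 2 pi;
   the second is already off by up to tau g2 / 2 at the centre, and 3/2 times 1/3 is 1/2. *)
have [tau [tau0 tau_eps tau1 tau2]] : exists tau, [/\ 0 < tau, 2 * tau <= eps,
    tau * g1 <= 2^-1 & tau * g2 <= 3^-1].
  exists (Num.min (eps / 2) (Num.min ((2 * g1)^-1) ((3 * g2)^-1))).
  rewrite !lt_min divr_gt0 ?invr_gt0 ?mulr_gt0//; split => //.
  - by rewrite mulrC -ler_pdivlMr// ge_min lexx.
  - by rewrite -ler_pdivlMr// -invfM !ge_min lexx orbT.
  - by rewrite -ler_pdivlMr// -invfM !ge_min lexx !orbT.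
have tg1 : 0 < tau * g1 by rewrite mulr_gt0.
have tg2 : 0 < tau * g2 by rewrite mulr_gt0.
(* [d] bounds from below the distance of both phases from the multiples of 2 pi at the two ends of
   the window; on the second side the offset of the centre may cost half of tau g2. *)
have [d [d0 d1 d2]] : exists d, [/\ 0 < d, d <= tau * g1 & d <= tau * g2 / 2].
  exists (Num.min (tau * g1) (tau * g2 / 2)).
  by rewrite lt_min tg1 divr_gt0// !ge_min !lexx orbT.
have d3 : d <= 2^-1 by exact: le_trans tau1.
have dd : 0 < M * (d ^+ 2 / 16) by rewrite mulr_gt0// divr_gt0// exprn_gt0.
(* Beyond [Kb] an error of d / 4 leaves |s_i| >= d / 4 with the right sign at the ends, hence s1 s2
   >= d^2 / 16, and k M times this dominates the other two terms. *)
have [Kb [KbK big]] : exists Kb, K <= Kb /\ forall k, Kb <= k -> [/\ 1 <= k, 0 < k,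
    0 <= C / k, C / k <= d / 4 & (A + B) * (9 / 4) < k * M * (d ^+ 2 / 16)].
  pose D := (A + B) * (9 / 4) / (M * (d ^+ 2 / 16)).
  have D0 : 0 <= D.
    by rewrite divr_ge0 ?(ltW dd)// mulr_ge0 ?divr_ge0// addr_ge0// ltW.
  have C4 : 0 <= 4 * C / d by rewrite divr_ge0 ?mulr_ge0// ltW.
  exists (`|K| + 1 + 4 * C / d + D); split.
    by apply: le_trans (ler_norm K) _; rewrite -!addrA lerDl !addr_ge0.
  move=> k Kk; have nK := normr_ge0 K.
  have [k1 k2 k3] : [/\ 1 <= k, 4 * C / d <= k & D < k].
    by move: Kk D0 C4 nK; clear; move: D (_ / d) => x y; split; lra.
  have k0 : 0 < k by exact: lt_le_trans k1.
  split => //; first by rewrite divr_ge0// ltW.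
    rewrite ler_pdivrMr//; move: k2; rewrite ler_pdivrMr//; clear; lra.
  by rewrite -mulrA -ltr_pdivrMr.
(* The centre is 2 pi n / g1, an exact zero of the first phase. Approximating n g2 / g1 by an
   integer makes the second phase small, and the lower bound [L] on [n] pushes the whole window
   beyond [Kb]. *)
have [ks [n [m [ksb ks1 ks2]]]] : exists ks, exists n m : nat, [/\ Kb + tau <= ks,
    ks * g1 = (pi *+ 2) *+ n & `|ks * g2 - (pi *+ 2) *+ m| <= tau * g2 / 2].
  have tp0 : 0 < pi *+ 2 :> R by rewrite mulrn_wgt0// pi_gt0.
  move: (pi *+ 2) tp0 => tp tp0.
  have Kt0 : 0 <= Kb + tau.
    by have [h _ _ _ _] := big Kb (lexx _); rewrite addr_ge0// ?(le_trans ler01 h) ?ltW.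
  have [L LP] : exists L : nat, (Kb + tau) * g1 / tp < L%:R.
    have := archi_boundP (normr_ge0 ((Kb + tau) * g1 / tp)).
    by move=> H; eexists; apply: le_lt_trans (ler_norm _) H.
  have L0 : (0 < L)%N.
    rewrite -(ltr_nat R); apply: le_lt_trans LP.
    by apply: divr_ge0; [apply: mulr_ge0; [exact: Kt0|exact: ltW]|exact: ltW].
  have eta0 : 0 < tau * g2 / 2 / tp by rewrite !divr_gt0.
  have [n [m [nL nm]]] := simultaneous_approx (divr_gt0 g20 g10) eta0 L0.
  exists (tp *+ n / g1), n, m; split.
  - rewrite ler_pdivlMr// -(mulr_natr tp) [tp * _]mulrC -ler_pdivrMr//.
    by apply: (le_trans (ltW LP)); rewrite ler_nat.
  - by rewrite mulfVK// gt_eqF.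
  - have -> : tp *+ n / g1 * g2 - tp *+ m = (n%:R * (g2 / g1) - m%:R) * tp.
      by rewrite -!(mulr_natr tp); ring.
    by rewrite normrM (gtr0_norm tp0) -ler_pdivlMr.
pose l := ks - tau; pose r := ks + tau; pose y0 := ks * g2 - (pi *+ 2) *+ m.
have Kl : Kb <= l by rewrite lerBrDr.
have lks : l <= ks by rewrite gerBl ltW.
have ksr : ks <= r by rewrite lerDl ltW.
have lr : l < r by rewrite ltrD2l gtrN.
have win k : l <= k <= r -> [/\ [/\ 0 < c1 k, `|s1 k| <= 3 / 2 /\ `|c1 k| <= 3 / 2,
      d <= (k - ks) * g1 -> d / 4 <= s1 k & (k - ks) * g1 <= - d -> s1 k <= - (d / 4)],
    [/\ 0 < c2 k, `|s2 k| <= 3 / 2 /\ `|c2 k| <= 3 / 2,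
      d <= y0 + (k - ks) * g2 -> d / 4 <= s2 k &
      y0 + (k - ks) * g2 <= - d -> s2 k <= - (d / 4)] &
    (A + B) * (9 / 4) < k * M * (d ^+ 2 / 16) /\ 0 < k * M].
  move=> /andP[lk kr]; have [k1 k0 e0 ed kM] := big k (le_trans Kl lk).
  have [a1 a2 a3 a4] := asy k k1.
  have kt : `|k - ks| <= tau by rewrite ler_distl lk kr.
  split; last by rewrite mulr_gt0.
    apply: (trig_approx_window (n := n) _ _ e0 ed d3 a1 a3).
      by rewrite -ks1; ring.
    by rewrite normrM (gtr0_norm g10); apply: le_trans tau1; rewrite ler_wpM2r// ltW.
  apply: (trig_approx_window (n := m) _ _ e0 ed d3 a2 a4).
    by rewrite /y0; ring.
  apply: le_trans (ler_normD _ _) _; rewrite normrM (gtr0_norm g20).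
  have : `|k - ks| * g2 <= tau * g2 by rewrite ler_wpM2r// ltW.
  by move: ks2 tau2; rewrite -/y0; clear; lra.
have [y01 y02] : - (tau * g2 / 2) <= y0 /\ y0 <= tau * g2 / 2.
  by apply/andP; rewrite -ler_norml.
have llr : l <= l <= r by rewrite lexx ltW.
have rlr : l <= r <= r by rewrite lexx andbT ltW.
have [[_ bl1 _ h1] [_ bl2 _ h2] [kMl kMl0]] := win l llr.
have [[_ br1 h3 _] [_ br2 h4 _] [kMr kMr0]] := win r rlr.
have lE : l - ks = - tau by rewrite /l; ring.
have rE : r - ks = tau by rewrite /r; ring.
rewrite lE mulNr in h1 h2; rewrite rE in h3 h4.
have {}h1 : s1 l <= - (d / 4) by apply: h1; rewrite lerN2.
have {}h2 : s2 l <= - (d / 4) by apply: h2; move: d2 y02; clear; lra.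
have {}h3 := h3 d1.
have {}h4 : d / 4 <= s2 r by apply: h4; move: d2 y01; clear; lra.
have d40 : 0 < d / 4 by rewrite divr_gt0.
have Gl : G l < 0.
  apply: (quadratic_form_lt0 A0 B0 kMl0 bl1 bl2 _ kMl).
  by move: h1 h2 d40; clear; nra.
have Gr : G r < 0.
  apply: (quadratic_form_lt0 A0 B0 kMr0 br1 br2 _ kMr).
  by move: h3 h4 d40; clear; nra.
have cM (f g : R -> R) : continuous f -> continuous g
    -> continuous (fun k => f k * g k).
  by move=> cf cg k; apply: cvgM; [exact: cf|exact: cg].
have cB (f g : R -> R) : continuous f -> continuous g
    -> continuous (fun k => f k - g k).
  by move=> cf cg k; apply: cvgB; [exact: cf|exact: cg].
have cD (f g : R -> R) : continuous f -> continuous g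
    -> continuous (fun k => f k + g k).
  by move=> cf cg k; apply: cvgD; [exact: cf|exact: cg].
have cc (z : R) : continuous (fun _ : R => z) by move=> k; exact: cvg_cst.
pose m' k := k * M.
have cm : continuous m' by apply: (cM id) => // k; exact: cvg_id.
have cs1' := @continuous_subspaceT _ _ `[l, r]%classic _ cs1.
have cs2' := @continuous_subspaceT _ _ `[l, r]%classic _ cs2.
have cH1 := continuous_subspaceT (A := `[l, r]%classic) (cB _ _ (cM _ _ (cc A) cc2)
    (cM _ _ cm cs2)).
have cH2 := continuous_subspaceT (A := `[l, r]%classic) (cB _ _ (cM _ _ (cc B) cc1)
    (cM _ _ cm cs1)).
have cG := continuous_subspaceT (A := `[l, r]%classic) (cB _ _
  (cD _ _ (cM _ _ (cM _ _ (cc A) cs1) cc2) (cM _ _ (cM _ _ (cc B) cc1) cs2))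
  (cM _ _ (cM _ _ cm cs1) cs2)).
have cpos k : l <= k <= r -> 0 < c1 k /\ 0 < c2 k by move=> /win[[? _ _ _] [? _ _ _] _].
have nd0 : - (d / 4) < 0 by rewrite oppr_lt0.
have [x [y [lx xy yr Gx Gy]]] := two_zeros lr cs1' cs2' cH1 cH2 cG A0 B0 cpos
  (le_lt_trans h1 nd0) (le_lt_trans h2 nd0) (lt_le_trans d40 h3) (lt_le_trans d40 h4)
      Gl Gr.
have Kx := le_trans Kl lx; have [x1 _ _ _ _] := big x Kx.
exists x, y; split => //; first exact: le_trans KbK Kx.
by apply: le_trans tau_eps; move: lx yr; rewrite /l /r; clear; lra.
Qed.

End AsymptoticZeros.

(** * Shooting: close pairs of eigenvalues *)

Section Shooting.
Variable R : realType.
Implicit Types (a b x y : R) (f g : R -> R).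

Lemma SL_solD a b sigma rho q lam al be (u1 w1 u2 w2 : R -> R) :
  SL_sol a b sigma rho q lam u1 w1 -> SL_sol a b sigma rho q lam u2 w2 ->
  SL_sol a b sigma rho q lam (fun x => al * u1 x + be * u2 x)
    (fun x => al * w1 x + be * w2 x).
Proof.
move=> /SL_sol_ac[Hu1 Hw1] /SL_sol_ac[Hu2 Hw2]; apply/SL_sol_ac; split.
  by apply: eq_ac_on (ac_onD (ac_onZ al Hu1) (ac_onZ be Hu2)) => // x _; ring.
by apply: eq_ac_on (ac_onD (ac_onZ al Hw1) (ac_onZ be Hw2)) => // x _; ring.
Qed.

Lemma H2on_continuous a b f : a <= b -> H2on a b f
    -> {within `[a, b], continuous f}%classic.
Proof. by move=> ab /H2on_ac[f1 [f2 [Hf _]]]; exact: ac_on_continuous Hf. Qed.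

Lemma H2on_inv_L1on a b f : a <= b -> H2on a b f -> unif_pos a b f ->
  L1on a b (fun x => (f x)^-1).
Proof.
move=> ab /H2on_ac[f1 [f2 [Hf _]]] [c [c0 fc]].
apply: L1on_continuous; exact: ac_on_continuous ab (ac_on_inv c0 fc Hf).
Qed.

(** If [u] vanished, the flux would be constant and 0 = u b - u a would equal w a times int 1 /
    sigma, which is positive. *)
Lemma SL_sol_nontrivial a b sigma rho q lam u w : a < b -> H2on a b sigma ->
  unif_pos a b sigma -> SL_sol a b sigma rho q lam u w -> w a != 0 ->
  exists x, a <= x <= b /\ u x != 0.
Proof.
move=> ab Hs sp /SL_sol_ac[Hu Hw] wa.
apply: contrapT => /forallNP H.
have u0 x : a <= x <= b -> u x = 0.
  by move=> xab; apply/eqP/negP => /negP ux; apply: (H x).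
have w_cst x : a <= x <= b -> w x = w a.
  move=> /andP[ax xb]; rewrite (ac_onW Hw (lexx a) ax xb) -[RHS]addr0; congr (_ + _).
  rewrite -(mul0r (x - a)) -I_cst//; apply: eq_I => t /andP[at_ tx].
  by rewrite u0 ?mulr0// at_ (le_trans tx xb).
have := ac_onW Hu (lexx a) (ltW ab) (lexx b).
rewrite !u0 ?lexx ?ltW// add0r.
have -> : I[a, b] (fun x => w x / sigma x) = I[a, b] (fun x => w a * (sigma x)^-1).
  by apply: eq_I => x xab; rewrite w_cst.
have si := H2on_inv_L1on (ltW ab) Hs sp.
rewrite (I_Z _ si) => /esym/eqP; rewrite mulf_eq0 (negbTE wa) /= => /eqP I0.
have [K K0 sK] := within_continuous_bounded (H2on_continuous (ltW ab) Hs).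
have [c [c0 sc]] := sp.
have : I[a, b] (fun=> K^-1) <= I[a, b] (fun x => (sigma x)^-1).
  apply: le_I => //; first exact: L1on_cst.
  move=> t tab; have st : 0 < sigma t by apply: lt_le_trans (sc t tab).
  by rewrite lef_pV2 ?posrE// (le_trans (ler_norm _))// sK.
by rewrite I0 (I_cst _ (ltW ab)) leNgt mulr_gt0 ?invr_gt0 ?subr_gt0.
Qed.

(** The solutions are picked independently for each [k]. Their end values are nevertheless
    continuous in [k], because [SL_sol_lipschitz] compares any two solutions with the same initial
    data. *)
Lemma SL_sol_family a b sigma rho q u0 w0 : a <= b ->
  H2on a b sigma -> unif_pos a b sigma -> H2on a b rho -> L1on a b q ->
  exists u w : R -> R -> R, [/\
    forall k, [/\ SL_sol a b sigma rho q (k ^+ 2) (u k) (w k), u k a = u0 & w k a = w0],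
    continuous (fun k => u k b) & continuous (fun k => w k b)].
Proof.
move=> ab Hs sp Hr qi.
have si := H2on_inv_L1on ab Hs sp.
have ri := L1on_continuous (H2on_continuous ab Hr).
have /choice[uw uwP] : forall k : R, exists uw : (R -> R) * (R -> R),
    [/\ SL_sol a b sigma rho q (k ^+ 2) uw.1 uw.2, uw.1 a = u0 & uw.2 a = w0].
  move=> k; have [u [w H]] := SL_sol_exists (k ^+ 2) u0 w0 ab si ri qi.
  by exists (u, w).
exists (fun k => (uw k).1), (fun k => (uw k).2).
have lip k0 : exists2 C, 0 <= C & forall k, `|k ^+ 2 - k0 ^+ 2| <= 1 ->
    `|(uw k).1 b - (uw k0).1 b| <= C * `|k ^+ 2 - k0 ^+ 2| /\
    `|(uw k).2 b - (uw k0).2 b| <= C * `|k ^+ 2 - k0 ^+ 2|.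
  have [s0 ua0 wa0] := uwP k0.
  have [C C0 HC] := SL_sol_lipschitz ab si ri qi s0.
  exists C => // k k1; have [s ua wa] := uwP k.
  by apply: HC => //; rewrite ?ua ?wa.
have cont (f : R -> R) : (forall k0, exists2 C, 0 <= C & forall k, `|k ^+ 2 - k0 ^+ 2|
    <= 1 ->
     `|f k - f k0| <= C * `|k ^+ 2 - k0 ^+ 2|) -> continuous f.
  move=> H k0; have [C C0 HC] := H k0.
  have c2 : {for k0, continuous (fun k : R => k ^+ 2)} by apply: exprn_continuous.
  apply/cvgrPdist_lt => e e0.
  have d0 : 0 < Num.min 1 (e / (C + 1)) by rewrite lt_min ltr01 divr_gt0// ltr_pwDr.
  have /cvgrPdist_lt/(_ _ d0) := c2; apply: filterS => k.
  rewrite lt_min => /andP[h1 h2]; rewrite distrC; rewrite distrC in h1;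
      rewrite distrC in h2.
  apply: le_lt_trans (HC k (ltW h1)) _.
  rewrite ltr_pdivlMr ?ltr_pwDr// in h2; have := normr_ge0 (k ^+ 2 - k0 ^+ 2).
  have : C * `|k ^+ 2 - k0 ^+ 2| <= `|k ^+ 2 - k0 ^+ 2| * (C + 1).
    by rewrite mulrC ler_wpM2l// lerDl.
  by move=> h3 _; exact: le_lt_trans h3 h2.
split=> //; apply: cont => k0; have [C C0 HC] := lip k0; exists C => // k /HC[] //.
Qed.

End Shooting.

Section CloseEigenvalues.
Variable R : realType.
Implicit Types (a b x y : R) (f g : R -> R).

Lemma liouville_phase_gt0 a b (rho sigma r h p kap kap' : R -> R) : a < b ->
  H2on a b sigma -> liouville a b rho sigma r h p kap kap' -> 0 < I[a, b] p.
Proof.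
move=> ab Hs L.
have [K K0 sK] := within_continuous_bounded (H2on_continuous (ltW ab) Hs).
have [c c0 rc] := liouville_r_lb L.
have : I[a, b] (fun=> c ^+ 2 / K) <= I[a, b] p.
  apply: le_I; [exact: L1on_cst|exact: L1on_continuous (liouville_p_cont L)|].
  move=> t tab; have st := liouville_sigma L tab.
  rewrite ler_pdivrMr//; apply: (@le_trans _ _ (r t ^+ 2)).
    by rewrite ler_pXn2r ?nnegrE ?rc// ?ltW// (lt_le_trans c0)// rc.
  rewrite -(liouville_p_sigma L tab) ler_wpM2l//; last first.
    by rewrite (le_trans (ler_norm _))// sK.
  by rewrite -(pmulr_lge0 _ st) (liouville_p_sigma L tab) sqr_ge0.
by apply: lt_le_trans; rewrite (I_cst _ (ltW ab)) mulr_gt0 ?subr_gt0// divr_gt0//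
    exprn_gt0.
Qed.

Lemma near_divr (x y e z : R) : 0 < z -> `|x - z * y| <= e * z -> `|x / z - y| <= e.
Proof.
move=> z0; have -> : x / z - y = (x - z * y) / z by field; rewrite gt_eqF.
by rewrite normrM normfV (gtr0_norm z0) ler_pdivrMr.
Qed.

Lemma close_eigenvalues (rho1 sigma1 q1 rho2 sigma2 q2 : R -> R) (M : R) :
  H2on (-1) 0 rho1 -> H2on (-1) 0 sigma1 -> H2on 0 1 rho2 -> H2on 0 1 sigma2 ->
  unif_pos (-1) 0 rho1 -> unif_pos (-1) 0 sigma1 ->
  unif_pos 0 1 rho2 -> unif_pos 0 1 sigma2 ->
  L1on (-1) 0 q1 -> L1on 0 1 q2 -> 0 < M ->
  forall eps K, 0 < eps -> exists x y, [/\ K <= x, 1 <= x, x < y, y - x <= eps &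
    is_eigenvalue rho1 sigma1 q1 rho2 sigma2 q2 M (x ^+ 2) /\
    is_eigenvalue rho1 sigma1 q1 rho2 sigma2 q2 M (y ^+ 2)].
Proof.
move=> Hr1 Hs1 Hr2 Hs2 pr1 ps1 pr2 ps2 qi1 qi2 M0.
have lt1 : (-1 : R) < 0 by rewrite ltrN10.
have lt2 : (0 : R) < 1 by exact: ltr01.
have [r1 [h1 [p1 [kap1 [kap1' L1]]]]] := liouville_exists (ltW lt1) Hr1 Hs1 pr1 ps1.
have [r2 [h2 [p2 [kap2 [kap2' L2]]]]] := liouville_exists (ltW lt2) Hr2 Hs2 pr2 ps2.
have r1_gt0 x : -1 <= x <= 0 -> 0 < r1 x.
  by move=> xab; have [c c0 cr] := liouville_r_lb L1; exact: lt_le_trans (cr x xab).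
have r2_gt0 x : 0 <= x <= 1 -> 0 < r2 x.
  by move=> xab; have [c c0 cr] := liouville_r_lb L2; exact: lt_le_trans (cr x xab).
have ra0 : 0 < r1 (-1) by rewrite r1_gt0// lexx ltW.
have rb0 : 0 < r1 0 by rewrite r1_gt0// lexx ltW.
have rc0 : 0 < r2 0 by rewrite r2_gt0// lexx ltW.
have rd0 : 0 < r2 1 by rewrite r2_gt0// lexx ltW.
(* [u] leaves -1 with value 0 and flux 1; [f] and [g] form the basis of solutions on the right with
   data (1, 0) and (0, 1) at 0. *)
have [u [w [uP cu cw]]] := SL_sol_family 0 1 (ltW lt1) Hs1 ps1 Hr1 qi1.
have [f [f' [fP cf _]]] := SL_sol_family 1 0 (ltW lt2) Hs2 ps2 Hr2 qi2.
have [g [g' [gP cg _]]] := SL_sol_family 0 1 (ltW lt2) Hs2 ps2 Hr2 qi2.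
have [C1 C10 LG1] := liouville_green (ltW lt1) L1 qi1.
have [C2 C20 LG2] := liouville_green (ltW lt2) L2 qi2.
set ra := r1 (-1) in ra0 *; set rb := r1 0 in rb0 *.
set rc := r2 0 in rc0 *; set rd := r2 1 in rd0 *.
(* The factors normalise the Liouville-Green formulas: [s1], [s2] are sines and [c1], [c2] cosines
   of k g1, k g2 up to O(1/k). *)
pose s1 k := k * (u k 0 * (rb * ra)); pose c1 k := w k 0 * (ra / rb).
pose s2 k := k * (g k 1 * (rd * rc)); pose c2 k := f k 1 * (rd / rc).
pose g1 := I[-1, 0] p1; pose g2 := I[0, 1] p2.
have g10 : 0 < g1 := liouville_phase_gt0 lt1 Hs1 L1.
have g20 : 0 < g2 := liouville_phase_gt0 lt2 Hs2 L2.
have asy k : 1 <= k -> [/\ `|s1 k - sin (k * g1)| <= (C1 + C2) / k,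
    `|s2 k - sin (k * g2)| <= (C1 + C2) / k,
    `|c1 k - cos (k * g1)| <= (C1 + C2) / k & `|c2 k - cos (k * g2)| <= (C1 + C2) / k].
  move=> k1; have k0 : 0 < k by exact: lt_le_trans k1.
  have C1k : C1 / k <= (C1 + C2) / k by rewrite ler_wpM2r ?invr_ge0 ?(ltW k0)// lerDl.
  have C2k : C2 / k <= (C1 + C2) / k by rewrite ler_wpM2r ?invr_ge0 ?(ltW k0)// lerDr.
  have [us ua wa] := uP k; have [fs fa f'a] := fP k; have [gs ga g'a] := gP k.
  have [] := LG1 k _ _ k1 us 0 _; first by rewrite lexx ltW.
  rewrite ua wa !mulr0 !mul0r !add0r subr0 normr0 add0r -/ra -/rb -/g1 => e1 e2.
  have [] := LG2 k _ _ k1 fs 1 _; first by rewrite lexx ltW.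
  rewrite fa f'a !mul0r !addr0 normr0 addr0 -/rc -/rd -/g2 mulr1 => e3 _.
  have [] := LG2 k _ _ k1 gs 1 _; first by rewrite lexx ltW.
  rewrite ga g'a !mulr0 !mul0r !add0r normr0 add0r -/rc -/rd -/g2 => e4 _.
  have nra : `|1 / ra| = ra^-1 by rewrite div1r gtr0_norm// invr_gt0.
  have nrc : `|1 / rc| = rc^-1 by rewrite div1r gtr0_norm// invr_gt0.
  have nkrc : `|k * rc| = k * rc by rewrite gtr0_norm// mulr_gt0.
  rewrite nra in e1 e2; rewrite nrc in e4; rewrite nkrc in e3.
  have ira : 0 < ra^-1 by rewrite invr_gt0.
  have irc : 0 < rc^-1 by rewrite invr_gt0.
  rewrite !div1r in e1 e2 e4.
  split.
  - apply: le_trans C1k; have -> : s1 k = k * rb * u k 0 / ra^-1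
      by rewrite /s1 invrK; ring.
    exact: near_divr.
  - apply: le_trans C2k; have -> : s2 k = k * rd * g k 1 / rc^-1
      by rewrite /s2 invrK; ring.
    exact: near_divr.
  - apply: le_trans C1k; have -> : c1 k = w k 0 / rb / ra^-1 by rewrite /c1 invrK; ring.
    exact: near_divr.
  - apply: le_trans C2k; have -> : c2 k = k * rd * f k 1 / (k * rc).
      by rewrite /c2; field; rewrite !gt_eqF.
    by apply: near_divr => //; rewrite mulr_gt0.
have cM (z t : R -> R) : continuous z -> continuous t
    -> continuous (fun k => z k * t k).
  by move=> cz ct k; apply: cvgM; [exact: cz|exact: ct].
have cc (z : R) : continuous (fun _ : R => z) by move=> k; exact: cvg_cst.
have cid : continuous (fun k : R => k) by move=> k; exact: cvg_id.
have cs1 : continuous s1 := cM _ _ cid (cM _ _ cu (cc _)).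
have cs2 : continuous s2 := cM _ _ cid (cM _ _ cg (cc _)).
have cc1 : continuous c1 := cM _ _ cw (cc _).
have cc2 : continuous c2 := cM _ _ cf (cc _).
have eig k : 1 <= k ->
    rc ^+ 2 * s1 k * c2 k + rb ^+ 2 * c1 k * s2 k - k * M * s1 k * s2 k = 0 ->
    is_eigenvalue rho1 sigma1 q1 rho2 sigma2 q2 M (k ^+ 2).
  move=> k1 Gk; have k0 : 0 < k by exact: lt_le_trans k1.
  have [us ua wa] := uP k; have [fs fa f'a] := fP k; have [gs ga g'a] := gP k.
  (* [al] and [be] are the value and the flux that the interface conditions impose on the right of
     0. The only condition left is v 1 = 0, and k ra rb rc rd times v 1 is the function in [Gk];
     this is the origin of the coefficients rc^2 and rb^2. *)
  pose al := u k 0; pose be := w k 0 - k ^+ 2 * M * u k 0.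
  have S0 : al * f k 1 + be * g k 1 = 0.
    have : (k * ra * rb * rc * rd) * (al * f k 1 + be * g k 1) = 0.
      rewrite -Gk /s1 /s2 /c1 /c2 /al /be; field; by rewrite !gt_eqF.
    by move/eqP; rewrite mulf_eq0 gt_eqF/= ?mulr_gt0// => /eqP.
  exists (u k), (w k), (fun x => al * f k x + be * g k x), (fun x => al * f' k x + be
      * g' k x).
  split => //.
  - exact: SL_solD.
  - by split => //; rewrite fa ga mulr1 mulr0 addr0.
  - by rewrite f'a g'a mulr0 mulr1 add0r /be; ring.
  - by left; apply: SL_sol_nontrivial us _ => //; rewrite wa oner_neq0.
move=> eps K eps0.
have [x [y [Kx x1 xy yx [Gx Gy]]]] := two_zeros_asymptotic g10 g20
  (exprn_gt0 2 rc0) (exprn_gt0 2 rb0) M0 (addr_ge0 C10 C20) cs1 cs2 cc1 cc2 asy K eps0.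
exists x, y; split => //; split; apply: eig => //.
by rewrite (le_trans x1)// ltW.
Qed.

End CloseEigenvalues.

(** * Orthogonality of eigenfunctions *)

Section EigenvalueGaps.
Variable R : realType.
Implicit Types (a b x y : R) (f g : R -> R).

Lemma SL_sol_uw_mono a b sigma rho q lam (u w : R -> R) x y : lam <= 0 ->
  (forall t, a <= t <= b -> 0 <= sigma t) -> (forall t, a <= t <= b -> 0 <= rho t) ->
  (forall t, a <= t <= b -> 0 <= q t) -> SL_sol a b sigma rho q lam u w ->
  a <= x -> x <= y -> y <= b -> u x * w x <= u y * w y.
Proof.
move=> lam0 s0 r0 q0 /SL_sol_ac[Hu Hw] ax xy yb.
have H := ac_onZ (-1) (ac_on_sub (ac_onM Hu Hw) ax yb).
have := ac_on_nonincreasing xy H; rewrite !mulN1r lerN2; apply => t /andP[xt ty].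
have tab : a <= t <= b by rewrite (le_trans ax xt) (le_trans ty yb).
rewrite mulN1r oppr_le0 addr_ge0//.
  by rewrite mulrAC -expr2 divr_ge0 ?sqr_ge0 ?s0.
have -> : u t * ((q t - lam * rho t) * u t) = (q t - lam * rho t) * u t ^+ 2 by ring.
rewrite mulr_ge0 ?sqr_ge0// subr_ge0 (le_trans _ (q0 t tab))//.
by rewrite mulr_le0_ge0// r0.
Qed.

Lemma SL_sol_uw_eq0 a b sigma rho q lam (u w : R -> R) x : SL_sol a b sigma rho q lam
    u w ->
  (forall t, a <= t <= b -> u t * w t = 0) -> a <= x <= b -> u x ^+ 2 = u a ^+ 2.
Proof.
move=> /SL_sol_ac[Hu _] uw0 /andP[ax xb].
rewrite !expr2 (ac_onW (ac_onM Hu Hu) (lexx a) ax xb).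
rewrite -[RHS]addr0; congr (_ + _).
rewrite -(mul0r (x - a)) -I_cst//; apply: eq_I => t /andP[at_ tx].
have -> : w t / sigma t * u t + u t * (w t / sigma t) = 2 * (u t * w t) / sigma t
    by ring.
by rewrite uw0 ?mulr0 ?mul0r// at_ (le_trans tx xb).
Qed.

(** If lam <= 0, value times flux is nondecreasing on each side and vanishes at -1 and at 1, so u w
    >= 0 >= v z at 0, whereas the jump gives u w - v z = lam M u^2 <= 0. Both products then vanish
    identically, the squares of [u] and [v] are constant, and the eigenfunction is 0. Positivity is
    what lets [Num.sqrt] turn an eigenvalue into a frequency: on negative numbers it is 0. *)
Lemma eigenvalue_gt0 (rho1 sigma1 q1 rho2 sigma2 q2 : R -> R) (M lam : R) :
  unif_pos (-1) 0 rho1 -> unif_pos (-1) 0 sigma1 ->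
  unif_pos 0 1 rho2 -> unif_pos 0 1 sigma2 ->
  (forall x, -1 <= x <= 0 -> 0 <= q1 x) -> (forall x, 0 <= x <= 1 -> 0 <= q2 x) ->
  0 < M -> is_eigenvalue rho1 sigma1 q1 rho2 sigma2 q2 M lam -> 0 < lam.
Proof.
have pos a b (f : R -> R) : unif_pos a b f -> forall t, a <= t <= b -> 0 <= f t.
  by move=> [c [c0 cf]] t /cf; apply: le_trans; exact: ltW.
move=> /pos pr1 /pos ps1 /pos pr2 /pos ps2 q1p q2p M0.
move=> [u [w [v [z [su sv [u0 v1 uv] jump nontriv]]]]].
rewrite ltNge; apply/negP => lam0.
have n10 : (-1 : R) <= 0 by rewrite lerN10.
have mono1 := SL_sol_uw_mono lam0 ps1 pr1 q1p su.
have mono2 := SL_sol_uw_mono lam0 ps2 pr2 q2p sv.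
have h1 : 0 <= u 0 * w 0.
  by have := mono1 _ _ (lexx _) n10 (lexx _); rewrite u0 mul0r.
have h2 : v 0 * z 0 <= 0.
  by have := mono2 _ _ (lexx _) ler01 (lexx _); rewrite v1 mul0r.
have h3 : u 0 * w 0 - v 0 * z 0 <= 0.
  rewrite -uv -mulrBr jump mulrCA mulr_le0_ge0 -?expr2 ?sqr_ge0//.
  by rewrite mulr_le0_ge0// ltW.
have E1 : u 0 * w 0 = 0 by lra.
have E2 : v 0 * z 0 = 0 by lra.
have uw0 t : -1 <= t <= 0 -> u t * w t = 0.
  move=> /andP[t1 t0]; apply/eqP; rewrite eq_le.
  have := mono1 _ _ (lexx _) t1 t0; have := mono1 _ _ t1 t0 (lexx _).
  by rewrite E1 u0 mul0r => -> ->.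
have vz0 t : 0 <= t <= 1 -> v t * z t = 0.
  move=> /andP[t0 t1]; apply/eqP; rewrite eq_le.
  have := mono2 _ _ (lexx _) t0 t1; have := mono2 _ _ t0 t1 (lexx _).
  by rewrite E2 v1 mul0r => -> ->.
have u00 x : -1 <= x <= 0 -> u x = 0.
  move=> xab; apply/eqP; rewrite -sqrf_eq0 (SL_sol_uw_eq0 su uw0 xab) u0.
  by rewrite expr0n.
have v00 x : 0 <= x <= 1 -> v x = 0.
  move=> xab; apply/eqP; rewrite -sqrf_eq0 (SL_sol_uw_eq0 sv vz0 xab).
  by rewrite -(SL_sol_uw_eq0 sv vz0 (_ : 0 <= 1 <= 1)) ?ler01 ?lexx// v1 expr0n.
by case: nontriv => -[x [xab]]; rewrite ?u00 ?v00 ?eqxx.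
Qed.

Lemma lagrange_identity a b sigma rho q lam lam' (u w v z : R -> R) : a <= b ->
  {within `[a, b], continuous rho}%classic ->
  SL_sol a b sigma rho q lam u w -> SL_sol a b sigma rho q lam' v z ->
  (u b * z b - v b * w b) - (u a * z a - v a * w a) =
  (lam - lam') * I[a, b] (fun x => rho x * (u x * v x)).
Proof.
move=> ab cr /SL_sol_ac[Hu Hw] /SL_sol_ac[Hv Hz].
have cu := ac_on_continuous ab Hu; have cv := ac_on_continuous ab Hv.
have ri : L1on a b (fun x => rho x * (u x * v x)).
  by apply: (L1onMC cr); apply: (L1onMC cu); exact: L1on_continuous.
have H := ac_onB (ac_onM Hu Hz) (ac_onM Hv Hw).
rewrite (ac_onW H (lexx a) ab (lexx b)) addrAC subrr add0r -I_Z//.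
by apply: eq_I => x _; ring.
Qed.

(** The Lagrange identities of the two sides are added. Their boundary terms at 0 combine through
    the jumps into (lam' - lam) M u(0) u'(0), so the interface acts as a point mass [M]. *)
Lemma eigenfunctions_orthogonal (rho1 sigma1 q1 rho2 sigma2 q2 : R -> R)
    (M lam lam' : R)
    (u w v z u' w' v' z' : R -> R) :
  {within `[-1, 0], continuous rho1}%classic
      -> {within `[0, 1], continuous rho2}%classic ->
  lam != lam' ->
  SL_sol (-1) 0 sigma1 rho1 q1 lam u w -> SL_sol 0 1 sigma2 rho2 q2 lam v z ->
  SL_sol (-1) 0 sigma1 rho1 q1 lam' u' w' -> SL_sol 0 1 sigma2 rho2 q2 lam' v' z' ->
  u (-1) = 0 -> v 1 = 0 -> u 0 = v 0 -> u' (-1) = 0 -> v' 1 = 0 -> u' 0 = v' 0 ->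
  w 0 - z 0 = lam * M * u 0 -> w' 0 - z' 0 = lam' * M * u' 0 ->
  I[-1, 0] (fun x => rho1 x * (u x * u' x)) + I[0, 1] (fun x => rho2 x * (v x * v' x)) +
  M * u 0 * u' 0 = 0.
Proof.
move=> cr1 cr2 ll su sv su' sv' u0 v1 uv u0' v1' uv' j j'.
have E1 := lagrange_identity (lerN10 R) cr1 su su'.
have E2 := lagrange_identity ler01 cr2 sv sv'.
apply: (@mulfI _ (lam - lam')); first by rewrite subr_eq0.
rewrite mulr0 !mulrDr -E1 -E2 u0 u0' v1 v1' -uv -uv'.
have -> : w 0 = z 0 + lam * M * u 0 by rewrite -j; ring.
have -> : w' 0 = z' 0 + lam' * M * u' 0 by rewrite -j'; ring.
ring.
Qed.

(* The Gram matrix of three vectors of a plane is singular. *)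
Lemma no_three_almost_orthogonal (g1 g2 A1 B1 A2 B2 A3 B3 : R) :
  let N A B := g1 * A ^+ 2 + g2 * B ^+ 2 in
  let g A B A' B' := g1 * (A * A') + g2 * (B * B') in
  0 < N A1 B1 -> 0 < N A2 B2 -> 0 < N A3 B3 ->
  g A1 B1 A2 B2 ^+ 2 <= N A1 B1 * N A2 B2 / 16 ->
  g A1 B1 A3 B3 ^+ 2 <= N A1 B1 * N A3 B3 / 16 ->
  g A2 B2 A3 B3 ^+ 2 <= N A2 B2 * N A3 B3 / 16 -> False.
Proof.
move=> N g N1 N2 N3 h12 h13 h23.
have gram : N A1 B1 * N A2 B2 * N A3 B3 + 2 * (g A1 B1 A2 B2 * g A1 B1 A3 B3 * g A2 B2
    A3 B3)
  = N A1 B1 * g A2 B2 A3 B3 ^+ 2 + N A2 B2 * g A1 B1 A3 B3 ^+ 2 + N A3 B3 * g A1 B1 A2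
      B2 ^+ 2.
  by rewrite /N /g; ring.
move: gram N1 N2 N3 h12 h13 h23.
move: (N A1 B1) (N A2 B2) (N A3 B3) (g A1 B1 A2 B2) (g A1 B1 A3 B3) (g A2 B2 A3 B3).
move=> {N g} n1 n2 n3 x y z gram n10 n20 n30 h12 h13 h23.
have n123 : 0 < n1 * n2 * n3 by rewrite !mulr_gt0.
(* Write n = n1 n2 n3. Each of the three squared terms is at most n / 16 and |x y z| is at most n /
   64, so the Gram identity would give n <= 3 n / 16 + n / 32. *)
have k1 : n1 * z ^+ 2 <= n1 * n2 * n3 / 16.
  have -> : n1 * n2 * n3 / 16 = n1 * (n2 * n3 / 16) by ring.
  by rewrite ler_wpM2l// ltW.
have k2 : n2 * y ^+ 2 <= n1 * n2 * n3 / 16.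
  have -> : n1 * n2 * n3 / 16 = n2 * (n1 * n3 / 16) by ring.
  by rewrite ler_wpM2l// ltW.
have k3 : n3 * x ^+ 2 <= n1 * n2 * n3 / 16.
  have -> : n1 * n2 * n3 / 16 = n3 * (n1 * n2 / 16) by ring.
  by rewrite ler_wpM2l// ltW.
have xyz2 : (x * y * z) ^+ 2 <= (n1 * n2 * n3 / 64) ^+ 2.
  have -> : (n1 * n2 * n3 / 64) ^+ 2 = (n1 * n2 / 16) * (n1 * n3 / 16) *
      (n2 * n3 / 16) by field.
  rewrite !exprMn; apply: (ler_pM _ (sqr_ge0 _) _ h23).
    by rewrite mulr_ge0 ?sqr_ge0.
  exact: ler_pM (sqr_ge0 _) (sqr_ge0 _) h12 h13.
have : `|x * y * z| <= n1 * n2 * n3 / 64.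
  by rewrite -ler_sqr ?nnegrE// ?real_normK ?num_real// divr_ge0// ltW.
rewrite ler_norml => /andP[xyz _].
by move: gram xyz k1 k2 k3 n123; clear; move: (n1 * n2 * n3) (x * y * z) => *; lra.
Qed.

(** * Inner products of solutions with a common zero *)

Section InnerProduct.
Variables (a b : R) (rho sigma q r h p kap kap' : R -> R).
Hypotheses (ab : a <= b) (L : liouville a b rho sigma r h p kap kap')
  (qi : L1on a b q).

Let r_gt0 x : a <= x <= b -> 0 < r x.
Proof. by move=> xab; have [c c0 cr] := liouville_r_lb L;
    exact: lt_le_trans (cr x xab). Qed.

Let p_ge0 x : a <= x <= b -> 0 <= p x.
Proof.
move=> xab; have st := liouville_sigma L xab.
by rewrite -(pmulr_lge0 _ st) (liouville_p_sigma L xab) sqr_ge0.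
Qed.

Let gam := I[a, b] p.

Let phase_le e x : a <= e <= b -> a <= x <= b -> `|I[a, x] p - I[a, e] p| <= gam.
Proof.
move=> /andP[ae eb] /andP[ax xb].
have pi' := L1on_continuous (liouville_p_cont L).
have bnd y : a <= y -> y <= b -> 0 <= I[a, y] p <= gam.
  move=> ay yb; rewrite /gam (I_chasles pi' ay yb) lerDl; apply/andP; split;
      apply: I_ge0 => t /andP[t1 t2].
    by rewrite p_ge0// t1 (le_trans t2).
  by rewrite p_ge0// t2 andbT (le_trans ay).
have /andP[? ?] := bnd x ax xb; have /andP[? ?] := bnd e ae eb.
by rewrite ler_norml; apply/andP; split; lra.
Qed.

Let phase_ac c e : ac_on a b (fun x => c * (I[a, x] p - I[a, e] p)) (fun x => c * p x).
Proof.
apply: eq_ac_on (ac_onZ c (ac_onB (liouville_p_ac L) (ac_on_cst a b (I[a, e] p)))) =>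
    // x _.
by rewrite subr0.
Qed.

(** The product of sines is half of cos((k - k') th) - cos((k + k') th). The first cosine is close
    to 1 when k and k' are close. The second integrates exactly, since [p] is the density of the
    phase [th], and gives at most 2 / (k + k'). *)
Lemma sine_inner_product k k' e : a <= e <= b -> 0 < k -> 0 < k' ->
  `|I[a, b] (fun x => p x * (sin (k * (I[a, x] p - I[a, e] p)) *
      sin (k' * (I[a, x] p - I[a, e] p)))) - gam / 2| <=
  gam ^+ 2 * `|k - k'| / 2 + (k + k')^-1.
Proof.
move=> eab k0 k'0; pose th x := I[a, x] p - I[a, e] p.
have pc := liouville_p_cont L; have pi' := L1on_continuous pc.
have cosi c : L1on a b (fun x => cos (c * th x) * p x).
  by apply: L1onMC pi'; exact: ac_on_continuous (ac_on_cos (phase_ac c e)).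
have kk0 : 0 < k + k' by rewrite addr_gt0.
have -> : I[a, b] (fun x => p x * (sin (k * th x) * sin (k' * th x))) =
   2^-1 * (I[a, b] (fun x => cos ((k - k') * th x) * p x) -
           I[a, b] (fun x => cos ((k + k') * th x) * p x)).
  rewrite -I_B// -I_Z; last exact: L1onB.
  by apply: eq_I => x _; rewrite mulrBl mulrDl cosB cosD; field.
have H1 : `|I[a, b] (fun x => cos ((k - k') * th x) * p x) - gam| <= gam ^+ 2 * `|k -
    k'|.
  rewrite -I_B//.
  have -> : gam ^+ 2 * `|k - k'| = I[a, b] (fun x => `|k - k'| * gam * p x).
    by rewrite I_Z// -/gam; ring.
  apply: norm_I_le_dom; [exact: L1onB|exact: L1onZ|] => x xab.
  rewrite -[X in _ - X]mul1r -mulrBl normrM (ger0_norm (p_ge0 xab)) ler_wpM2r ?p_ge0//.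
  rewrite -(cos0 R); apply: le_trans (cos_lip _ _) _.
  by rewrite subr0 normrM ler_wpM2l// phase_le.
have H2 : `|I[a, b] (fun x => cos ((k + k') * th x) * p x)| <= 2 / (k + k').
  have HS := ac_on_sin (phase_ac (k + k') e).
  have : (k + k') * I[a, b] (fun x => cos ((k + k') * th x) * p x) =
     sin ((k + k') * th b) - sin ((k + k') * th a).
    rewrite (ac_onW HS (lexx a) ab (lexx b)) addrAC subrr add0r -I_Z//.
    by apply: eq_I => x _; rewrite /th; ring.
  move=> E; rewrite ler_pdivlMr// mulrC -{1}(gtr0_norm kk0) -normrM E.
  apply: le_trans (ler_normB _ _) _.
  have -> : 2 = 1 + 1 :> R by ring.
  by apply: lerD; rewrite ler_norml sin_geN1 sin_le1.
move: H1 H2; set X := I[a, b] (fun x => cos ((k - k') * th x) * p x).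
set Y := I[a, b] (fun x => cos ((k + k') * th x) * p x) => H1 H2.
have -> : 2^-1 * (X - Y) - gam / 2 = 2^-1 * ((X - gam) - Y) by ring.
rewrite normrM gtr0_norm ?invr_gt0//.
have := ler_normB (X - gam) Y; lra.
Qed.

Lemma product_near (U U' B B' s s' e : R) : 0 <= e -> e <= 1 -> `|s| <= 1
    -> `|s'| <= 1 ->
  `|U - B * s| <= e * `|B| -> `|U' - B' * s'| <= e * `|B'| ->
  `|U * U' - B * B' * (s * s')| <= 3 * e * (`|B| * `|B'|).
Proof.
move=> e0 e1 s1 s1' HU HU'.
have -> : U * U' - B * B' * (s * s') = (U - B * s) * (U' - B' * s') +
  (U - B * s) * (B' * s') + (B * s) * (U' - B' * s') by ring.
have Bs : `|B * s| <= `|B| by rewrite normrM ler_piMr.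
have Bs' : `|B' * s'| <= `|B'| by rewrite normrM ler_piMr.
have eB' : e * `|B'| <= `|B'| by rewrite ler_piMl.
apply: le_trans (ler_normD _ _) _; apply: le_trans (lerD (ler_normD _ _) (lexx _)) _.
rewrite !normrM -/(`|B * s|).
have h1 : `|U - B * s| * `|U' - B' * s'| <= e * `|B| * `|B'|.
  by apply: ler_pM => //; exact: le_trans eB'.
have h2 : `|U - B * s| * `|B' * s'| <= e * `|B| * `|B'| by exact: ler_pM.
have h3 : `|B * s| * `|U' - B' * s'| <= `|B| * (e * `|B'|) by exact: ler_pM.
rewrite !normrM in h2 h3; lra.
Qed.

(** Since rho = p r^2, the integrand k k' rho u u' is [p] times a product of two scaled solutions,
    that is, of two sines up to relative errors. The second conclusion controls the jump of the flux
    at 0; the third shows that an eigenfunction has a nonzero amplitude on some side. *)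
Lemma weighted_inner_product : exists K C, [/\ 1 <= K, 0 <= C &
  forall kp eta k k' (u w u' w' : R -> R) e, K <= kp -> kp <= k -> kp <= k'
      -> `|k - k'| <= eta ->
  SL_sol a b sigma rho q (k ^+ 2) u w -> SL_sol a b sigma rho q (k' ^+ 2) u' w' ->
  a <= e <= b -> u e = 0 -> u' e = 0 ->
  let B := w e / r e in let B' := w' e / r e in
  [/\ `|k * k' * I[a, b] (fun x => rho x * (u x * u' x)) - gam / 2 * (B * B')| <=
      C * (kp^-1 + eta) * (`|B| * `|B'|),
    forall x, a <= x <= b -> `|w x| <= C * r x * `|B| &
    B = 0 -> forall x, a <= x <= b -> u x = 0]].
Proof.
have [K [C [K1 C0 LG]]] := liouville_green_dirichlet ab L qi.
have pi' := L1on_continuous (liouville_p_cont L).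
have gam0 : 0 <= gam by exact: I_ge0.
(* Adding [C] to the threshold gives C / kp <= 1, as [product_near] requires. In the constant, 3 C
   gam comes from [product_near], gam^2 from the slow cosine, and 2 from the flux bound |w| <= r (1
   + C / k) |B|. *)
exists (K + C), (3 * C * gam + gam ^+ 2 + 2); split.
- by rewrite (le_trans K1)// lerDl.
- by rewrite !addr_ge0// ?mulr_ge0// sqr_ge0.
move=> kp eta k k' u w u' w' e Kkp kpk kpk' kk su su' eab ue ue' B B'.
have kp0 : 0 < kp by rewrite (lt_le_trans _ Kkp)// ltr_wpDr// (lt_le_trans ltr01).
have k0 := lt_le_trans kp0 kpk; have k'0 := lt_le_trans kp0 kpk'.
have Kk z : kp <= z -> K <= z
    by move=> h'; rewrite (le_trans _ h')// (le_trans _ Kkp)// lerDl.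
have Ckp : C / kp <= 1
    by rewrite ler_pdivrMr// mul1r (le_trans _ Kkp)// lerDr (le_trans ler01).
have Ckp0 : 0 <= C / kp by rewrite divr_ge0// ltW.
have Ck z : kp <= z -> C / z <= C / kp.
  by move=> h'; rewrite ler_wpM2l// lef_pV2 ?posrE// (lt_le_trans kp0).
have near z (f f' : R -> R) : kp <= z -> SL_sol a b sigma rho q (z ^+ 2) f f'
    -> f e = 0 ->
    forall x, a <= x <= b ->
    `|z * r x * f x - f' e / r e * sin (z * (I[a, x] p - I[a, e] p))| <= C / kp * `|f'
        e / r e| /\
    `|f' x / r x - f' e / r e * cos (z * (I[a, x] p - I[a, e] p))| <= C / z * `|f' e /
        r e|.
  move=> kz sf fe x xab; have [] := LG z f f' e (Kk z kz) sf eab fe x xab; split => //.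
  by apply: le_trans (_ : _ <= C / z * `|f' e / r e|) _ => //; rewrite ler_wpM2r// Ck.
have nu := near k u w kpk su ue; have nu' := near k' u' w' kpk' su' ue'.
have [Hu _] := (SL_sol_ac _ _ _ _ _ _ _ _).1 su.
have [Hu' _] := (SL_sol_ac _ _ _ _ _ _ _ _).1 su'.
have sin1 (z : R) : `|sin z| <= 1 by rewrite ler_norml sin_geN1 sin_le1.
have cos1 (z : R) : `|cos z| <= 1 by rewrite ler_norml cos_geN1 cos_le1.
split.
- pose ss x := sin (k * (I[a, x] p - I[a, e] p)) * sin (k' * (I[a, x] p - I[a, e] p)).
  have ssc : ac_on a b ss _ := ac_onM (ac_on_sin (phase_ac k e))
      (ac_on_sin (phase_ac k' e)).
  have HUU := ac_onM (ac_onZ k (ac_onM (liouville_r_ac L) Hu))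
      (ac_onZ k' (ac_onM (liouville_r_ac L) Hu')).
  have UUi := L1onMC (ac_on_continuous ab HUU) pi'.
  have ssi := L1onMC (ac_on_continuous ab ssc) pi'.
  have rE : k * k' * I[a, b] (fun x => rho x * (u x * u' x)) =
      I[a, b] (fun x => (k * (r x * u x)) * (k' * (r x * u' x)) * p x).
    have ri : L1on a b (fun x => rho x * (u x * u' x)).
      have kk0 : (k * k')^-1 * (k * k') = 1 by rewrite mulVf// mulf_neq0// gt_eqF.
      apply: eq_L1on (L1onZ (k * k')^-1 UUi) => x xab.
      rewrite -(liouville_p_rho L xab) -[RHS]mul1r -kk0; ring.
    rewrite -I_Z//; apply: eq_I => x xab.
    by rewrite -(liouville_p_rho L xab); ring.
  have D1 : `|I[a, b] (fun x => (k * (r x * u x)) * (k' * (r x * u' x)) * p x) -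
       B * B' * I[a, b] (fun x => ss x * p x)| <= 3 * (C / kp) * (`|B| * `|B'|) * gam.
    rewrite -I_Z// -I_B; [|exact: UUi|exact: L1onZ].
    rewrite -I_Z//; apply: norm_I_le_dom;
        [exact: L1onB UUi (L1onZ _ ssi)|exact: L1onZ|].
    move=> x xab; rewrite [B * B' * _]mulrA -mulrBl normrM (ger0_norm (p_ge0 xab))
        ler_wpM2r ?p_ge0//.
    rewrite (mulrA k) (mulrA k').
    by apply: product_near => //; [case: (nu x xab)|case: (nu' x xab)].
  have D2 := sine_inner_product eab k0 k'0.
  have ssE : I[a, b] (fun x => ss x * p x) = I[a, b]
      (fun x => p x * (sin (k * (I[a, x] p - I[a, e] p)) *
      sin (k' * (I[a, x] p - I[a, e] p)))).
    by apply: eq_I => x _; rewrite mulrC.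
  rewrite rE; rewrite -ssE in D2.
  move: D1 D2; set X := I[a, b] (fun x => k * (r x * u x) * (k' * (r x * u' x)) * p x).
  set Y := I[a, b] (fun x => ss x * p x) => D1 D2.
  have -> : X - gam / 2 * (B * B') = (X - B * B' * Y) + (B * B') * (Y - gam / 2)
      by ring.
  apply: le_trans (ler_normD _ _) _; rewrite (normrM (B * B')) (normrM B).
  set n := `|B| * `|B'|; have n0 : 0 <= n by rewrite mulr_ge0.
  have eta0 : 0 <= eta by exact: le_trans kk.
  have D3 : n * `|Y - gam / 2| <= n * (gam ^+ 2 * eta + kp^-1).
    rewrite ler_wpM2l//; apply: le_trans D2 _; apply: lerD.
      rewrite -mulrA ler_wpM2l ?sqr_ge0// ler_pdivrMr//.
      by apply: le_trans kk _; rewrite ler_peMr// ler1n.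
    by rewrite lef_pV2 ?posrE ?addr_gt0// (le_trans kpk)// lerDl ltW.
  apply: le_trans (lerD D1 D3) _.
  have kpi : 0 <= kp^-1 by rewrite invr_ge0 ltW.
  have -> : 3 * (C / kp) * n * gam + n * (gam ^+ 2 * eta + kp^-1) =
     n * (3 * C * gam * kp^-1 + gam ^+ 2 * eta + kp^-1) by ring.
  rewrite mulrC ler_wpM2r//.
  have g0 : 0 <= 3 * C * gam by rewrite !mulr_ge0.
  have g2 : 0 <= gam ^+ 2 by rewrite sqr_ge0.
  have h1 := mulr_ge0 g0 eta0; have h2 := mulr_ge0 g2 kpi.
  have -> : (3 * C * gam + gam ^+ 2 + 2) * (kp^-1 + eta) = (3 * C * gam * kp^-1 + gam
      ^+ 2 * eta + kp^-1)
    + (3 * C * gam * eta + gam ^+ 2 * kp^-1 + kp^-1 + 2 * eta) by ring.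
  by rewrite lerDl !addr_ge0// mulr_ge0.
- move=> x xab; have [_ h1] := nu x xab; have rx := r_gt0 xab.
  have -> : w x = w x / r x * r x by rewrite mulfVK// gt_eqF.
  rewrite normrM (gtr0_norm rx) mulrAC ler_wpM2r ?(ltW rx)//.
  have := ler_normD (w x / r x - B * cos (k * (I[a, x] p - I[a, e] p)))
      (B * cos (k * (I[a, x] p - I[a, e] p))).
  rewrite subrK => /le_trans; apply.
  have h2 : `|B * cos (k * (I[a, x] p - I[a, e] p))| <= `|B| by rewrite normrM ler_piMr.
  have h3 : C / k * `|B| <= `|B| by rewrite ler_piMl// (le_trans (Ck k kpk)).
  have h4 : 0 <= 3 * C * gam + gam ^+ 2 by rewrite addr_ge0 ?sqr_ge0// !mulr_ge0.
  have h5 := mulr_ge0 h4 (normr_ge0 B).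
  have -> : (3 * C * gam + gam ^+ 2 + 2) * `|B| = `|B| + `|B| +
      (3 * C * gam + gam ^+ 2) * `|B| by ring.
  by rewrite -[leLHS]addr0 !lerD// (le_trans h1).
- move=> B0 x xab; have [h1 _] := nu x xab; move: h1.
  rewrite -/B B0 normr0 mulr0 mul0r subr0 normr_le0 !mulf_eq0.
  by rewrite (gt_eqF k0) (gt_eqF (r_gt0 xab)) /= => /eqP.
Qed.

End InnerProduct.
End EigenvalueGaps.

(** * Gaps between eigenvalues *)

Section SpectralGap.
Variable R : realType.

Lemma dist_itv_le (l r x y : R) : l <= x <= r -> l <= y <= r -> `|x - y| <= r - l.
Proof.
by move=> /andP[? ?] /andP[? ?]; rewrite ler_distl; apply/andP; split; lra.
Qed.

Lemma positive_lower_bound (f : nat -> R) N : (forall n, 0 < f n) ->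
  exists2 d, 0 < d & forall n, (n < N)%N -> d <= f n.
Proof.
move=> f0; elim: N => [|N [d d0 dP]]; first by exists 1.
exists (Num.min d (f N)); first by rewrite lt_min d0 f0.
move=> n; rewrite ltnS leq_eqVlt => /predU1P[->|nN]; first by rewrite ge_min lexx orbT.
by rewrite ge_min dP.
Qed.

(** Turns an error in sums of absolute values into one in the norms of the plane: 8 t (|x| + |y|)^2
    <= 16 t (x^2 + y^2) <= g1 x^2 + g2 y^2. The square of the error is thus at most 1/64 of the
    product of the norms, and undoing the halves multiplies by 4. *)
Lemma weighted_gram_bound (g1 g2 t A B A' B' : R) : 0 < g1 -> 0 < g2 ->
  16 * t <= g1 -> 16 * t <= g2 -> 0 <= t ->
  `|g1 / 2 * (A * A') + g2 / 2 * (B * B')| <= t * ((`|A| + `|B|) * (`|A'| + `|B'|)) ->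
  (g1 * (A * A') + g2 * (B * B')) ^+ 2 <=
    (g1 * A ^+ 2 + g2 * B ^+ 2) * (g1 * A' ^+ 2 + g2 * B' ^+ 2) / 16.
Proof.
move=> g10 g20 tg1 tg2 t0 h.
have S (x y : R) : 8 * t * (`|x| + `|y|) ^+ 2 <= g1 * x ^+ 2 + g2 * y ^+ 2.
  rewrite -(real_normK (num_real x)) -(real_normK (num_real y)).
  move: (`|x|) (`|y|) (normr_ge0 x) (normr_ge0 y) => {}x {}y x0 y0.
  have h1 : 16 * t * x ^+ 2 <= g1 * x ^+ 2 by rewrite ler_wpM2r ?sqr_ge0.
  have h2 : 16 * t * y ^+ 2 <= g2 * y ^+ 2 by rewrite ler_wpM2r ?sqr_ge0.
  have h3 : 0 <= t * (x - y) ^+ 2 by rewrite mulr_ge0 ?sqr_ge0.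
  lra.
have -> : g1 * (A * A') + g2 * (B * B') = 2 * (g1 / 2 * (A * A') + g2 / 2 * (B * B'))
    by field.
rewrite exprMn -(real_normK (num_real (g1 / 2 * (A * A') + _))).
set s := `|A| + `|B| in h *; set s' := `|A'| + `|B'| in h *.
have h' : `|g1 / 2 * (A * A') + g2 / 2 * (B * B')| ^+ 2 <= (t * (s * s')) ^+ 2.
  by rewrite ler_pXn2r// nnegrE// mulr_ge0// mulr_ge0// addr_ge0.
have H : (8 * t * s ^+ 2) * (8 * t * s' ^+ 2) <=
    (g1 * A ^+ 2 + g2 * B ^+ 2) * (g1 * A' ^+ 2 + g2 * B' ^+ 2).
  have S0 (x : R) : 0 <= 8 * t * x ^+ 2 by apply: mulr_ge0 (sqr_ge0 _); exact: mulr_ge0.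
  exact: ler_pM (S0 _) (S0 _) (S _ _) (S _ _).
have E : (t * (s * s')) ^+ 2 = (8 * t * s ^+ 2) * (8 * t * s' ^+ 2) / 64 by field.
by rewrite E in h'; lra.
Qed.

Lemma weighted_norm_gt0 (g1 g2 A B : R) : 0 < g1 -> 0 < g2 -> A != 0 \/ B != 0 ->
  0 < g1 * A ^+ 2 + g2 * B ^+ 2.
Proof.
move=> g10 g20 [A0|B0].
  apply: ltr_wpDr (mulr_ge0 (ltW g20) (sqr_ge0 B)) _.
  by rewrite mulr_gt0// exprn_even_gt0.
apply: ltr_wpDl (mulr_ge0 (ltW g10) (sqr_ge0 A)) _.
by rewrite mulr_gt0// exprn_even_gt0.
Qed.

Lemma three_eigenvalues_gap (rho1 sigma1 q1 rho2 sigma2 q2 : R -> R) (M : R) :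
  H2on (-1) 0 rho1 -> H2on (-1) 0 sigma1 -> H2on 0 1 rho2 -> H2on 0 1 sigma2 ->
  unif_pos (-1) 0 rho1 -> unif_pos (-1) 0 sigma1 ->
  unif_pos 0 1 rho2 -> unif_pos 0 1 sigma2 ->
  L1on (-1) 0 q1 -> L1on 0 1 q2 -> 0 < M ->
  exists delta K, 0 < delta /\ forall k1 k2 k3, K <= k1 -> k1 < k2 -> k2 < k3 ->
    is_eigenvalue rho1 sigma1 q1 rho2 sigma2 q2 M (k1 ^+ 2) ->
    is_eigenvalue rho1 sigma1 q1 rho2 sigma2 q2 M (k2 ^+ 2) ->
    is_eigenvalue rho1 sigma1 q1 rho2 sigma2 q2 M (k3 ^+ 2) -> delta < k3 - k1.
Proof.
move=> Hr1 Hs1 Hr2 Hs2 pr1 ps1 pr2 ps2 qi1 qi2 M0.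
have lt1 : (-1 : R) < 0 by rewrite ltrN10.
have lt2 : (0 : R) < 1 by exact: ltr01.
have [r1 [h1 [p1 [kap1 [kap1' L1]]]]] := liouville_exists (ltW lt1) Hr1 Hs1 pr1 ps1.
have [r2 [h2 [p2 [kap2 [kap2' L2]]]]] := liouville_exists (ltW lt2) Hr2 Hs2 pr2 ps2.
have r1_gt0 x : -1 <= x <= 0 -> 0 < r1 x.
  by move=> xab; have [c c0 cr] := liouville_r_lb L1; exact: lt_le_trans (cr x xab).
have r2_gt0 x : 0 <= x <= 1 -> 0 < r2 x.
  by move=> xab; have [c c0 cr] := liouville_r_lb L2; exact: lt_le_trans (cr x xab).
have [K1 [C1 [K11 C10 W1]]] := weighted_inner_product (ltW lt1) L1 qi1.
have [K2 [C2 [K21 C20 W2]]] := weighted_inner_product (ltW lt2) L2 qi2.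
have g10 := liouville_phase_gt0 lt1 Hs1 L1; have g20 := liouville_phase_gt0 lt2 Hs2 L2.
set g1 := I[-1, 0] p1 in g10 W1; set g2 := I[0, 1] p2 in g20 W2.
have e1 : -1 <= (-1 : R) <= 0 by rewrite lexx (ltW lt1).
have e0l : -1 <= (0 : R) <= 0 by rewrite lexx (ltW lt1).
have e0r : 0 <= (0 : R) <= 1 by rewrite lexx (ltW lt2).
have e2 : 0 <= (1 : R) <= 1 by rewrite lexx (ltW lt2).
pose D := C1 * r1 0 + C2 * r2 0.
have r1z : 0 <= r1 0 by rewrite ltW// r1_gt0.
have r2z : 0 <= r2 0 by rewrite ltW// r2_gt0.
have D0 : 0 <= D by apply: addr_ge0; exact: mulr_ge0.
pose mode k (u w v z : R -> R) := [/\ SL_sol (-1) 0 sigma1 rho1 q1 (k ^+ 2) u w,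
  SL_sol 0 1 sigma2 rho2 q2 (k ^+ 2) v z, [/\ u (-1) = 0, v 1 = 0 & u 0 = v 0] &
  w 0 - z 0 = k ^+ 2 * M * u 0].
(* Amplitudes of an eigenfunction, read at the outer ends where its Dirichlet conditions hold: the
   vectors of the plane. *)
pose A (w : R -> R) := w (-1) / r1 (-1); pose B (z : R -> R) := z 1 / r2 1.
have eigP k : is_eigenvalue rho1 sigma1 q1 rho2 sigma2 q2 M (k ^+ 2) ->
    Num.max K1 K2 <= k -> exists u w v z, mode k u w v z /\ (A w != 0 \/ B z != 0).
  move=> [u [w [v [z [su sv [u0 v1 uv] jump nontriv]]]]].
  rewrite ge_max => /andP[K1k K2k].
  exists u, w, v, z; split => //; apply: contrapT => /not_orP[/negP An /negP Bn].
  have A0 : A w = 0 by move: An; rewrite negbK => /eqP.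
  have B0 : B z = 0 by move: Bn; rewrite negbK => /eqP.
  have kk0 : `|k - k| <= 0 by rewrite subrr normr0.
  have [_ _ /(_ A0) uz] := W1 k 0 k k u w u w (-1) K1k (lexx _) (lexx _) kk0 su su e1
      u0 u0.
  have [_ _ /(_ B0) vz] := W2 k 0 k k v z v z 1 K2k (lexx _) (lexx _) kk0 sv sv e2 v1
      v1.
  by case: nontriv => -[x [xab]]; rewrite ?uz ?vz ?eqxx.
pose E := C1 + C2 + D ^+ 2 / M.
have DM0 : 0 <= D ^+ 2 / M by rewrite divr_ge0 ?sqr_ge0// ltW.
have E0 : 0 <= E by rewrite !addr_ge0.
(* The jump condition turns k^2 M u(0) into a difference of fluxes, so u(0) is smaller by 1/k^2 than
   the amplitudes. *)
have flux kp k u w v z : Num.max K1 K2 <= kp -> kp <= k -> mode k u w v z ->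
    `|k ^+ 2 * M * u 0| <= D * (`|A w| + `|B z|).
  rewrite ge_max => /andP[K1k K2k] kpk [su sv [u0 v1 uv] <-].
  have kk0 : `|k - k| <= 0 by rewrite subrr normr0.
  have [_ /(_ 0 e0l) w0 _] := W1 kp 0 k k u w u w (-1) K1k kpk kpk kk0 su su e1 u0 u0.
  have [_ /(_ 0 e0r) z0 _] := W2 kp 0 k k v z v z 1 K2k kpk kpk kk0 sv sv e2 v1 v1.
  apply: le_trans (ler_normB _ _) _; apply: le_trans (lerD w0 z0) _.
  rewrite -/(A w) -/(B z) mulrDr; apply: lerD; rewrite ler_wpM2r//.
    by rewrite /D lerDl mulr_ge0.
  by rewrite /D lerDr mulr_ge0.
have pair kp eta k k' u w v z u' w' v' z' : Num.max K1 K2 <= kp -> kp <= k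
    -> kp <= k' ->
    `|k - k'| <= eta -> (k == k') = false -> mode k u w v z -> mode k' u' w' v' z' ->
    `|g1 / 2 * (A w * A w') + g2 / 2 * (B z * B z')| <=
      E * (kp^-1 + eta) * ((`|A w| + `|B z|) * (`|A w'| + `|B z'|)).
  move=> Kkp kpk kpk' kk nkk m m'.
  have f1 := flux kp k u w v z Kkp kpk m; have f2 := flux kp k' u' w' v' z' Kkp kpk' m'.
  move: Kkp m m'; rewrite ge_max => /andP[K1k K2k] [su sv [u0 v1 uv] j]
      [su' sv' [u0' v1' uv'] j'].
  have [w1 _ _] := W1 kp eta k k' u w u' w' (-1) K1k kpk kpk' kk su su' e1 u0 u0'.
  have [w2 _ _] := W2 kp eta k k' v z v' z' 1 K2k kpk kpk' kk sv sv' e2 v1 v1'.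
  have kp1 : 1 <= kp by exact: le_trans K1k.
  have kp0 : 0 < kp by exact: lt_le_trans kp1.
  have k0 := lt_le_trans kp0 kpk; have k0' := lt_le_trans kp0 kpk'.
  have k2 : k ^+ 2 != k' ^+ 2 by rewrite eqrXn2 ?nkk// ltW.
  have orth := eigenfunctions_orthogonal (H2on_continuous (ltW lt1) Hr1)
    (H2on_continuous (ltW lt2) Hr2) k2 su sv su' sv' u0 v1 uv u0' v1' uv' j j'.
  move: w1 w2 orth; rewrite -/(A w) -/(A w') -/(B z) -/(B z').
  set X := I[-1, 0] (fun x => rho1 x * (u x * u' x)).
  set Y := I[0, 1] (fun x => rho2 x * (v x * v' x)).
  move: (A w) (A w') (B z) (B z') f1 f2 => a a' b b' f1 f2 w1 w2 orth.
  set T := k * k' * (M * u 0 * u' 0).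
  (* The interface term is rewritten as a product of two flux jumps divided by M k k', and k k' >=
     kp. *)
  have Tle : `|T| <= D ^+ 2 / M * kp^-1 * ((`|a| + `|b|) * (`|a'| + `|b'|)).
    have -> : T = (M * k * k')^-1 * ((k ^+ 2 * M * u 0) * (k' ^+ 2 * M * u' 0)).
      by rewrite /T; field; rewrite !gt_eqF.
    rewrite normrM gtr0_norm; last by rewrite invr_gt0 !mulr_gt0.
    have -> : D ^+ 2 / M * kp^-1 * ((`|a| + `|b|) * (`|a'| + `|b'|)) =
      (M * kp)^-1 * ((D * (`|a| + `|b|)) * (D * (`|a'| + `|b'|))).
      by field; rewrite !gt_eqF.
    rewrite (normrM (_ * u 0)); apply: ler_pM; rewrite ?invr_ge0 ?mulr_ge0 ?(ltW M0)
        ?(ltW k0) ?(ltW k0')//.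
      rewrite lef_pV2 ?posrE ?mulr_gt0// -mulrA ler_wpM2l ?(ltW M0)//.
      by rewrite -[kp]mulr1 ler_pM ?(ltW kp0)// (le_trans kp1).
    exact: ler_pM.
  have -> : g1 / 2 * (a * a') + g2 / 2 * (b * b') = - (k * k' * X - g1 / 2 * (a * a')) -
     (k * k' * Y - g2 / 2 * (b * b')) - T.
    have o (x : R) : x = x - k * k' * (X + Y + M * u 0 * u' 0).
      by rewrite orth mulr0 subr0.
    by rewrite [LHS]o /T; ring.
  have eta0 : 0 <= eta by exact: le_trans kk.
  have kpi : 0 <= kp^-1 by rewrite invr_ge0 ltW.
  have ke0 : 0 <= kp^-1 + eta by rewrite addr_ge0.
  set s := (`|a| + `|b|) * (`|a'| + `|b'|) in Tle *.
  have sa : `|a| * `|a'| <= s by apply: ler_pM => //; rewrite lerDl.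
  have sb : `|b| * `|b'| <= s by apply: ler_pM => //; rewrite lerDr.
  have s0 : 0 <= s by rewrite mulr_ge0// addr_ge0.
  apply: le_trans (ler_normB _ _) _; apply: le_trans (lerD (ler_normB _ _) Tle) _.
  rewrite normrN.
  have -> : E * (kp^-1 + eta) * s = C1 * (kp^-1 + eta) * s + C2 * (kp^-1 + eta) * s +
    D ^+ 2 / M * (kp^-1 + eta) * s by rewrite /E; ring.
  apply: lerD; first apply: lerD.
  - by apply: le_trans w1 _; rewrite ler_wpM2l// mulr_ge0.
  - by apply: le_trans w2 _; rewrite ler_wpM2l// mulr_ge0.
  - by rewrite ler_wpM2r// ler_wpM2l// lerDl.
pose gm := Num.min g1 g2.
have gm0 : 0 < gm by rewrite lt_min g10.
(* Sized so that E tau <= gm / 16. With gaps at most tau / 2 and K >= 2 / tau, the error factor E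
   (1/K + tau / 2) stays below E tau, as [weighted_gram_bound] requires. *)
pose tau := gm / (16 * (E + 1)).
have E1 : 0 < E + 1 by rewrite ltr_wpDl.
have tau0 : 0 < tau by rewrite divr_gt0// mulr_gt0.
pose K := Num.max (Num.max K1 K2) (2 / tau).
exists (tau / 2), K; split; first by rewrite divr_gt0.
move=> k1 k2 k3 Kk k12 k23 E1' E2' E3'.
rewrite ltNge; apply/negP => d13.
have KK : Num.max K1 K2 <= K by rewrite /K le_max lexx.
have Kk2 := le_trans Kk (ltW k12); have Kk3 := le_trans Kk2 (ltW k23).
have K0 : 0 < K by rewrite /K lt_max divr_gt0// orbT.
have dist (x y : R) : k1 <= x <= k3 -> k1 <= y <= k3 -> `|x - y| <= tau / 2.
  by move=> xk yk; exact: le_trans (dist_itv_le xk yk) d13.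
have i1 : k1 <= k1 <= k3 by rewrite lexx ltW// (lt_trans k12).
have i2 : k1 <= k2 <= k3 by rewrite !ltW.
have i3 : k1 <= k3 <= k3 by rewrite lexx ltW// (lt_trans k12).
have [u1 [w1 [v1 [z1 [m1 n1]]]]] := eigP k1 E1' (le_trans KK Kk).
have [u2 [w2 [v2 [z2 [m2 n2]]]]] := eigP k2 E2' (le_trans KK Kk2).
have [u3 [w3 [v3 [z3 [m3 n3]]]]] := eigP k3 E3' (le_trans KK Kk3).
have P12 := pair K (tau / 2) k1 k2 _ _ _ _ _ _ _ _ KK Kk Kk2 (dist _ _ i1 i2)
    (lt_eqF k12) m1 m2.
have P13 := pair K (tau / 2) k1 k3 _ _ _ _ _ _ _ _ KK Kk Kk3 (dist _ _ i1 i3)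
    (lt_eqF (lt_trans k12 k23)) m1 m3.
have P23 := pair K (tau / 2) k2 k3 _ _ _ _ _ _ _ _ KK Kk2 Kk3 (dist _ _ i2 i3)
    (lt_eqF k23) m2 m3.
set t := E * (K^-1 + tau / 2) in P12 P13 P23.
have Ki : K^-1 <= tau / 2.
  have half_gt0 : 0 < tau / 2 by rewrite divr_gt0.
  rewrite -[tau / 2]invrK lef_pV2 ?posrE ?invr_gt0//.
  by rewrite invf_div /K le_max lexx orbT.
have t0 : 0 <= t by rewrite mulr_ge0// addr_ge0 ?invr_ge0 ?(ltW K0)// divr_ge0// ltW.
have tle : 16 * t <= gm.
  have le1 : t <= E * tau by rewrite /t ler_wpM2l// [leRHS]splitr lerD2r.
  have le2 : E * tau <= (E + 1) * tau by rewrite ler_wpM2r ?(ltW tau0)// lerDl.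
  have gmE : gm = 16 * ((E + 1) * tau) by rewrite /tau; field; rewrite gt_eqF.
  by rewrite gmE ler_wpM2l// (le_trans le1).
have tg1 : 16 * t <= g1 by rewrite (le_trans tle)// ge_min lexx.
have tg2 : 16 * t <= g2 by rewrite (le_trans tle)// ge_min lexx orbT.
have G := weighted_gram_bound g10 g20 tg1 tg2 t0.
have N := weighted_norm_gt0 g10 g20.
exact: no_three_almost_orthogonal (N _ _ n1) (N _ _ n2) (N _ _ n3) (G _ _ _ _ P12)
    (G _ _ _ _ P13) (G _ _ _ _ P23).
Qed.

End SpectralGap.

(** * The subsequence of small gaps and the uniform gap *)

Theorem theorem3p1 (R : realType)
    (rho1 sigma1 q1 rho2 sigma2 q2 : R -> R) (M : R) (lam : nat -> R) :
  H2on (-1) 0 rho1 -> H2on (-1) 0 sigma1 ->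
  H2on 0 1 rho2 -> H2on 0 1 sigma2 ->
  unif_pos (-1) 0 rho1 -> unif_pos (-1) 0 sigma1 ->
  unif_pos 0 1 rho2 -> unif_pos 0 1 sigma2 ->
  L1on (-1) 0 q1 -> L1on 0 1 q2 ->
  (forall x, -1 <= x <= 0 -> 0 <= q1 x) ->
  (forall x, 0 <= x <= 1 -> 0 <= q2 x) ->
  0 < M ->
  (* lam 0 < lam 1 < ... enumerates exactly the eigenvalues *)
  (forall n, lam n < lam n.+1) ->
  (forall mu : R,
     is_eigenvalue rho1 sigma1 q1 rho2 sigma2 q2 M mu <-> exists n, lam n = mu) ->
  (exists phi : nat -> nat,
     (forall n, (phi n < phi n.+1)%N) /\
     exists (C : R) (N : nat), forall n, (N <= n)%N ->
       `|Num.sqrt (lam (phi n).+1) - Num.sqrt (lam (phi n))| <= C / n%:R)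
  /\
  (exists delta : R, 0 < delta /\
     forall n, Num.sqrt (lam n.+2) - Num.sqrt (lam n) > 2 * delta).
Proof.
move=> Hr1 Hs1 Hr2 Hs2 pr1 ps1 pr2 ps2 qi1 qi2 q1p q2p M0 lamS lamP.
have lam_eig n : is_eigenvalue rho1 sigma1 q1 rho2 sigma2 q2 M (lam n).
  by apply/lamP; exists n.
have lam_gt0 n : 0 < lam n by apply: eigenvalue_gt0 (lam_eig n).
pose kap n := Num.sqrt (lam n).
have kap2 n : kap n ^+ 2 = lam n by rewrite sqr_sqrtr// ltW.
have kap_lt m n : (m < n)%N -> kap m < kap n.
  have lt i : kap i < kap i.+1 by rewrite ltr_sqrt.
  elim: n => // n IH; rewrite ltnS leq_eqVlt => /predU1P[->//|/IH h].
  exact: lt_trans h (lt n).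
have kap_le m n : (m <= n)%N -> kap m <= kap n.
  by rewrite leq_eqVlt => /predU1P[->//|/kap_lt/ltW].
have kap_inv m n : kap m < kap n -> (m < n)%N.
  by move=> h; rewrite ltnNge; apply/negP => /kap_le; rewrite leNgt h.
have close := close_eigenvalues Hr1 Hs1 Hr2 Hs2 pr1 ps1 pr2 ps2 qi1 qi2 M0.
have eigE x : 1 <= x -> is_eigenvalue rho1 sigma1 q1 rho2 sigma2 q2 M (x ^+ 2) ->
    exists n, x = kap n.
  move=> x1 /lamP[n E]; exists n; rewrite /kap E sqrtr_sqr ger0_norm//.
  exact: le_trans x1.
split.
- have gap n m : exists i, (m < i)%N /\ kap i.+1 - kap i <= n.+1%:R^-1.
    have eps0 : 0 < n.+1%:R^-1 :> R by rewrite invr_gt0.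
    have [x [y [mx x1 xy yx [ex ey]]]] := close _ (kap m.+1) eps0.
    have [i xE] := eigE x x1 ex; have [j yE] := eigE y (le_trans x1 (ltW xy)) ey.
    rewrite xE in mx xy yx; rewrite yE in xy yx.
    exists i; split; first by apply: kap_inv (lt_le_trans (kap_lt _ _ (ltnSn m)) mx).
    (* The two close eigenvalues need not be consecutive, but the successor of the first is at most
       the second. *)
    by apply: le_trans yx; rewrite lerB// kap_le// kap_inv.
  have /choice[next nextP] : forall nm : nat * nat, exists i, (nm.2 < i)%N /\
      kap i.+1 - kap i <= nm.1.+1%:R^-1 by move=> [n m]; exact: gap.
  pose phi := fix phi n := if n is n'.+1 then next (n, phi n') else next (0%N, 0%N).
  exists phi; split; first by move=> n; have [] := nextP (n.+1, phi n).
  (* The start at 1 avoids n = 0, where the quotient 1 / 0 is 0. *)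
  exists 1, 1%N => n n1.
  have phi_gap : kap (phi n).+1 - kap (phi n) <= n.+1%:R^-1.
    by case: n {n1} => [|n]; [have [] := nextP (0%N, 0%N)|have [] := nextP (n.+1, phi n)].
  rewrite ger0_norm ?subr_ge0 ?kap_le// div1r; apply: le_trans phi_gap _.
  by rewrite lef_pV2 ?posrE ?ltr0n// ler_nat.
have [d [K [d0 dP]]] := three_eigenvalues_gap Hr1 Hs1 Hr2 Hs2 pr1 ps1 pr2 ps2 qi1 qi2 M0.
(* The pairs of close eigenvalues exist beyond every threshold, so the frequencies pass [K]. *)
have [N KN] : exists N, K <= kap N.
  have [x [_ [Kx x1 _ _ [ex _]]]] := close 1 K ltr01.
  by have [n xE] := eigE x x1 ex; exists n; rewrite -xE.
have [e e0 eP] : exists2 e, 0 < e & forall n, (n < N)%N -> e <= kap n.+2 - kap n.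
  by apply: positive_lower_bound => n; rewrite subr_gt0 kap_lt.
(* [e] covers the finitely many indices below [N] and [d] the others; dividing by 4 leaves room for
   the strict inequality with [2 * delta]. *)
exists (Num.min d e / 4); split; first by rewrite divr_gt0// lt_min d0.
move=> n; have de0 : 0 < Num.min d e by rewrite lt_min d0.
apply: (@lt_le_trans _ _ (Num.min d e)); first lra.
have [nN|Nn] := ltnP n N; first by rewrite ge_min eP// orbT.
rewrite ge_min ltW//; apply: dP (kap_lt _ _ (ltnSn _)) (kap_lt _ _ (ltnSn _)) _ _ _;
  rewrite ?kap2//.
exact: le_trans (kap_le _ _ Nn).
Qed.
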